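(* Let $N\ge 1$ and let $\rho_0^+,\dots,\rho_{N-1}^+,\rho_1^-,\dots,\rho_N^-$ be admissible specializations of $\Lambda$, and let $\pi$ be a nonnegative specialization of $\Lambda$ such that $H(\pi;\rho_j^+)<\infty$ for all $0\le j<N$. Let $\mathcal X$ be the set of pairs of sequences of partitions $(\lambda,\mu)=((\lambda^{(1)},\dots,\lambda^{(N)}),(\mu^{(1)},\dots,\mu^{(N-1)}))$ such that $$s_{\lambda^{(1)}}(\rho_0^+)\,s_{\lambda^{(1)}/\mu^{(1)}}(\rho_1^-)\,s_{\lambda^{(2)}/\mu^{(1)}}(\rho_1^+)\,s_{\lambda^{(2)}/\mu^{(2)}}(\rho_2^-)\cdots s_{\lambda^{(N-1)}/\mu^{(N-1)}}(\rho_{N-1}^-)\,s_{\lambda^{(N)}/\mu^{(N-1)}}(\rho_{N-1}^+)>0 .$$ Define a matrix $\mathfrak P^\uparrow_\pi$ with rows and columns indexed by $\mathcal X$ by $$\mathfrak P^\uparrow_\pi((\lambda,\mu),(\tilde\lambda,\tilde\mu))=P_{\rho_0^+,\pi}\bigl(\varnothing,\lambda^{(1)}\uparrow\uparrow\tilde\lambda^{(1)}\bigr)\prod_{j=1}^{N-1}P_{\rho_j^-,\pi}\bigl(\tilde\lambda^{(j)},\mu^{(j)}\downarrow\uparrow\tilde\mu^{(j)}\bigr)\,P_{\rho_j^+,\pi}\bigl(\tilde\mu^{(j)},\lambda^{(j+1)}\uparrow\uparrow\tilde\lambda^{(j+1)}\bigr).$$ Then $\mathfrak P^\uparrow_\pi$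 is well-defined (every probability distribution occurring in this product, for $(\lambda,\mu)\in\mathcal X$ and the relevant $\tilde\lambda,\tilde\mu$, is defined) and stochastic, and $$\mathbf S(\rho_0^+,\dots,\rho_{N-1}^+;\rho_1^-,\dots,\rho_N^-)\,\mathfrak P^\uparrow_\pi=\mathbf S(\rho_0^+,\dots,\rho_{N-1}^+;\rho_1^-,\dots,\rho_{N-1}^-,(\rho_N^-,\pi)),$$ i.e. $\mathfrak P^\uparrow_\pi$ maps the Schur process to the Schur process whose last specialization $\rho_N^-$ is replaced by the union $(\rho_N^-,\pi)$.
   Context: $\Lambda$ is the algebra of symmetric functions; $s_\lambda$, $s_{\lambda/\mu}$ are (skew) Schur functions ($s_{\lambda/\mu}=0$ unless $\mu\subset\lambda$), $h_n$ complete homogeneous and $p_n$ Newton power sums; $\mathbb Y$ is the set of all partitions. A specialization is an algebra homomorphism $\rho:\Lambda\to\mathbb C$; the trivial specialization $\varnothing$ sends homogeneous elements of positive degree to $0$. The union $(\rho_1,\rho_2)$ is the specialization with $p_n(\rho_1,\rho_2)=p_n(\rho_1)+p_n(\rho_2)$, $n\ge1$. A specialization is nonnegative if $s_\lambda(\rho)\ge0$ for all partitions $\lambda$; it is admissible if it is nonnegative and $H(\rho;u)=\sum_{n\ge0}h_n(\rho)u^n$ is holomorphic in a disc $|u|<r$ with $r>1$. For nonnegative $\rho_1,\rho_2$, $H(\rho_1;\rho_2)=\sum_{\lambda\in\mathbb Y}s_\lambda(\rho_1)s_\lambda(\rho_2)=\exp(\sum_{n\ge1}p_n(\rho_1)p_n(\rho_2)/n)$.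 Schur process: for the given specializations, to sequences $\varnothing\subset\lambda^{(1)}\supset\mu^{(1)}\subset\lambda^{(2)}\supset\cdots\supset\mu^{(N-1)}\subset\lambda^{(N)}\supset\varnothing$ assign weight $\mathcal W(\lambda,\mu)=s_{\lambda^{(1)}}(\rho_0^+)s_{\lambda^{(1)}/\mu^{(1)}}(\rho_1^-)s_{\lambda^{(2)}/\mu^{(1)}}(\rho_1^+)\cdots s_{\lambda^{(N)}/\mu^{(N-1)}}(\rho_{N-1}^+)s_{\lambda^{(N)}}(\rho_N^-)$; the total weight is $\prod_{0\le i<j\le N}H(\rho_i^+;\rho_j^-)<\infty$, and $\mathbf S(\rho_0^+,\dots,\rho_{N-1}^+;\rho_1^-,\dots,\rho_N^-)$ is the probability measure proportional to $\mathcal W$. Transition distributions: for nonnegative specializations $\rho_1,\rho_2$ and $\lambda,\mu\in\mathbb Y$, define probability measures in $\nu\in\mathbb Y$ by $P_{\rho_1,\rho_2}(\lambda,\mu\uparrow\uparrow\nu)=c\cdot s_{\nu/\lambda}(\rho_1)s_{\nu/\mu}(\rho_2)$ (here assuming $H(\rho_1;\rho_2)<\infty$), $P_{\rho_1,\rho_2}(\lambda,\mu\downarrow\uparrow\nu)=c\cdot s_{\lambda/\nu}(\rho_1)s_{\nu/\mu}(\rho_2)$, $P_{\rho_1,\rho_2}(\lambda,\mu\uparrow\downarrow\nu)=c\cdot s_{\nu/\lambda}(\rho_1)s_{\mu/\nu}(\rho_2)$, $P_{\rho_1,\rho_2}(\lambda,\mu\downarrow\downarrow\nu)=c\cdot s_{\lambda/\nu}(\rho_1)s_{\mu/\nu}(\rho_2)$,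 where in each case the distribution is defined when the set of $\nu$ with positive right-hand side is nonempty, and the constant $c$ (depending on $\lambda,\mu$) makes the total mass $1$.
   Formalization: The formal theorem also assumes H(ρ_i^+;ρ_j^-)<∞ for all i<j, i.e. finite total weight; admissibility alone does not give this (N=1, H(ρ_0^+;u)=H(ρ_1^-;u)=1+2u), and without it the Schur process is undefined. *)

(* Defs.v *)
From HB Require Import structures.
From mathcomp Require Import all_boot all_order all_algebra all_fingroup.
From mathcomp Require mpoly.
From mathcomp Require Import boolp.
Set Implicit Arguments.
Unset Strict Implicit.
Unset Printing Implicit Defensive.
Import Order.TTheory GRing.Theory Num.Theory.
Local Open Scope ring_scope.

(* The notations of mpoly and of mathcomp-analysis cannot be active together,
   so mpoly is imported in this module only and analysis after it. *)
Module SymFun.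
Import mpoly.

Section Def.
Variable K : comNzRingType.

(* p(x_1, ..., x_k, 0). *)
Definition drop_last k (p : {mpoly K[k.+1]}) : {mpoly K[k]} :=
  p \mPo [tuple if unlift ord_max i is Some j then 'X_j else 0 | i < k.+1].

(* The algebra Lambda of symmetric functions over K, as the inverse limit, in
   the category of graded rings, of the rings K[x_1, ..., x_k]^{S_k}; the
   bound on the degrees is what makes the limit graded. *)
Record symfun := SymFun {
  sf_at :> forall k, {mpoly K[k]};
  sf_sym : forall k, sf_at k \is symmetric;
  sf_stable : forall k, drop_last (sf_at k.+1) = sf_at k;
  sf_bounded : exists d, forall k, (msize (sf_at k) <= d)%N }.

Lemma symfun_ext (f g : symfun) : (forall k, f k = g k) -> f = g.
Proof.
case: f g => [f f1 f2 f3] [g g1 g2 g3] /= fg.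
have e : f = g by apply: functional_extensionality_dep.
by subst g; congr SymFun; exact: Prop_irrelevance.
Qed.

HB.instance Definition _ := gen_eqMixin symfun.
HB.instance Definition _ := gen_choiceMixin symfun.

Lemma drop_lastZ k c (p : {mpoly K[k.+1]}) :
  drop_last (c *: p) = c *: drop_last p.
Proof. exact: linearZ. Qed.

Program Definition sf0 := @SymFun (fun=> 0) _ _ _.
Next Obligation. exact: rpred0. Qed.
Next Obligation. exact: raddf0. Qed.
Next Obligation. by exists 0%N => k; rewrite mmeasure0. Qed.

Program Definition sf1 := @SymFun (fun=> 1) _ _ _.
Next Obligation. exact: rpred1. Qed.
Next Obligation. exact: rmorph1. Qed.
Next Obligation. by exists 1%N => k; rewrite msize1. Qed.

Program Definition sf_opp (f : symfun) := @SymFun (fun k => - f k) _ _ _.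
Next Obligation. by rewrite rpredN sf_sym. Qed.
Next Obligation. by rewrite /drop_last raddfN; congr (- _); exact: sf_stable. Qed.
Next Obligation.
by have [d fd] := sf_bounded f; exists d => k; rewrite mmeasureN.
Qed.

Program Definition sf_add (f g : symfun) := @SymFun (fun k => f k + g k) _ _ _.
Next Obligation. by apply: rpredD; exact: sf_sym. Qed.
Next Obligation.
by rewrite /drop_last raddfD; congr (_ + _); exact: sf_stable.
Qed.
Next Obligation.
have [d fd] := sf_bounded f; have [e ge] := sf_bounded g.
exists (maxn d e) => k; apply: leq_trans (msizeD_le _ _) _.
by rewrite geq_max !leq_max fd ge orbT.
Qed.

Program Definition sf_mul (f g : symfun) := @SymFun (fun k => f k * g k) _ _ _.
Next Obligation. by apply: rpredM; exact: sf_sym. Qed.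
Next Obligation.
by rewrite /drop_last rmorphM; congr (_ * _); exact: sf_stable.
Qed.
Next Obligation.
have [d fd] := sf_bounded f; have [e ge] := sf_bounded g.
exists (d + e).+1 => k; apply: leq_trans (msizeM_le _ _) _.
by rewrite ltnS leq_add.
Qed.

Program Definition sf_scale c (f : symfun) := @SymFun (fun k => c *: f k) _ _ _.
Next Obligation. by apply: rpredZ; exact: sf_sym. Qed.
Next Obligation. by rewrite drop_lastZ sf_stable. Qed.
Next Obligation.
have [d fd] := sf_bounded f; exists d => k.
exact: leq_trans (msizeZ_le _ _) _.
Qed.

Fact sf_addA : associative sf_add.
Proof. by move=> f g h; apply: symfun_ext => k; exact: addrA. Qed.
Fact sf_addC : commutative sf_add.
Proof. by move=> f g; apply: symfun_ext => k; exact: addrC. Qed.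
Fact sf_add0 : left_id sf0 sf_add.
Proof. by move=> f; apply: symfun_ext => k; exact: add0r. Qed.
Fact sf_addN : left_inverse sf0 sf_opp sf_add.
Proof. by move=> f; apply: symfun_ext => k; exact: addNr. Qed.
HB.instance Definition _ :=
  GRing.isZmodule.Build symfun sf_addA sf_addC sf_add0 sf_addN.

Fact sf_mulA : associative sf_mul.
Proof. by move=> f g h; apply: symfun_ext => k; exact: mulrA. Qed.
Fact sf_mulC : commutative sf_mul.
Proof. by move=> f g; apply: symfun_ext => k; exact: mulrC. Qed.
Fact sf_mul1 : left_id sf1 sf_mul.
Proof. by move=> f; apply: symfun_ext => k; exact: mul1r. Qed.
Fact sf_mulDl : left_distributive sf_mul sf_add.
Proof. by move=> f g h; apply: symfun_ext => k; exact: mulrDl. Qed.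
Fact sf1_neq0 : sf1 != sf0.
Proof.
apply/eqP => /(congr1 (fun f : symfun => f 0%N)) /eqP.
by rewrite /= oner_eq0.
Qed.
HB.instance Definition _ := GRing.Zmodule_isComNzRing.Build symfun
  sf_mulA sf_mulC sf_mul1 sf_mulDl sf1_neq0.

Fact sf_scaleA a b f : sf_scale a (sf_scale b f) = sf_scale (a * b) f.
Proof. by apply: symfun_ext => k; exact: scalerA. Qed.
Fact sf_scale1 : left_id 1 sf_scale.
Proof. by move=> f; apply: symfun_ext => k; exact: scale1r. Qed.
Fact sf_scaleDr : right_distributive sf_scale +%R.
Proof. by move=> a f g; apply: symfun_ext => k; exact: scalerDr. Qed.
Fact sf_scaleDl f : {morph sf_scale^~ f : a b / a + b}.
Proof. by move=> a b; apply: symfun_ext => k; exact: scalerDl. Qed.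
HB.instance Definition _ := GRing.Zmodule_isLmodule.Build K symfun
  sf_scaleA sf_scale1 sf_scaleDr sf_scaleDl.

Fact sf_scaleAl a (f g : symfun) : a *: (f * g) = a *: f * g.
Proof. by apply: symfun_ext => k; exact: scalerAl. Qed.
HB.instance Definition _ := GRing.Lmodule_isLalgebra.Build K symfun sf_scaleAl.
HB.instance Definition _ := GRing.Lalgebra_isComAlgebra.Build K symfun.

Lemma mcoeff_drop_last k (p : {mpoly K[k.+1]}) m :
  (drop_last p)@_m = p@_(mnmwiden m).
Proof.
rewrite [in LHS](mpolyE p) /drop_last.
rewrite (raddf_sum (comp_mpoly _)).
rewrite raddf_sum /=.
rewrite [in RHS](mpolyE p) raddf_sum /=; apply: eq_bigr => m' _.
rewrite linearZ /= !mcoeffZ mcoeffX; congr (_ * _).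
rewrite comp_mpolyX big_ord_recr /= tnth_mktuple unlift_none.
rewrite (eq_bigr (fun i : 'I_k => 'X_i ^+ m' (widen_ord (leqnSn k) i))); last first.
  move=> i _; rewrite tnth_mktuple.
  have -> : widen_ord (leqnSn k) i = lift ord_max i.
    by apply: val_inj => /=; rewrite /bump leqNgt ltn_ord.
  by rewrite liftK.
pose w (i : 'I_k) := widen_ord (leqnSn k) i.
pose m2 := [multinom m' (w i) | i < k].
have -> : \prod_(i < k) 'X_i ^+ m' (w i) = 'X_[m2] :> {mpoly K[k]}.
  by rewrite mpolyXE_id; apply: eq_bigr => i _; rewrite mnmE.
have [m'0|m'0] := eqVneq (m' ord_max) 0%N.
  rewrite m'0 expr0 mulr1 mcoeffX /m2; congr (_%:R); congr (nat_of_bool _).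
  apply/eqP/eqP => [e|->]; last first.
    by apply/mnmP => i; rewrite mnmE mnmwiden_widen.
  rewrite -e; apply/mnmP => i; case: (unliftP ord_max i) => [j ->|->]; last first.
      by rewrite mnmwiden_ordmax.
    have -> : lift ord_max j = w j.
      by apply: val_inj => /=; rewrite /bump leqNgt ltn_ord.
    by rewrite mnmwiden_widen mnmE.
rewrite expr0n (negbTE m'0) mulr0 mcoeff0; case: eqVneq => // m'E.
by rewrite m'E mnmwiden_ordmax eqxx in m'0.
Qed.

Lemma mdeg_mnmwiden k (m : 'X_{1..k}) : mdeg (mnmwiden m) = mdeg m.
Proof.
rewrite !mdegE big_ord_recr /= mnmwiden_ordmax addn0.
by apply: eq_bigr => i _; rewrite mnmwiden_widen.
Qed.

(* The complete homogeneous symmetric polynomial h_n(x_1, ..., x_k). *)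
Definition hpoly n k : {mpoly K[k]} :=
  \sum_(m : 'X_{1..k < n.+1} | mdeg m == n) 'X_[m].

Lemma mcoeff_hpoly n k m : (hpoly n k)@_m = (mdeg m == n)%:R.
Proof.
rewrite /hpoly raddf_sum /=; have [mn|mn] := eqVneq (mdeg m) n.
  have lmn : (mdeg m < n.+1)%N by rewrite mn.
  rewrite (bigD1 (BMultinom lmn)) /= ?mn ?eqxx // mcoeffX eqxx big1 ?addr0 //.
  move=> m' /andP[_ m'm]; rewrite mcoeffX; case: eqVneq => // e.
  by case/eqP: m'm; apply: val_inj.
rewrite big1 // => m' /eqP m'n; rewrite mcoeffX; case: eqVneq => // e.
by rewrite -e m'n eqxx in mn.
Qed.

Program Definition hsym n := @SymFun (hpoly n) _ _ _.
Next Obligation.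
apply/issymP => s; apply/mpolyP => m.
by rewrite mcoeff_sym !mcoeff_hpoly mdeg_mperm.
Qed.
Next Obligation.
by apply/mpolyP => m; rewrite mcoeff_drop_last !mcoeff_hpoly mdeg_mnmwiden.
Qed.
Next Obligation.
exists n.+1 => k; apply: leq_trans (mmeasure_sum _ _ _ _) _.
by apply/bigmax_leqP => m /eqP mn; rewrite msizeX mn.
Qed.

(* psym n is p_{n+1}: the power sum p_0 is not an element of Lambda. *)
Program Definition psym n := @SymFun (fun k => \sum_(i < k) 'X_i ^+ n.+1) _ _ _.
Next Obligation.
apply/issymP => s; rewrite raddf_sum /= [RHS](reindex_inj (@perm_inj _ s)) /=.
apply: eq_bigr => i _; rewrite rmorphXn /=; congr (_ ^+ _).
by rewrite /msym mmapX mmap1U.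
Qed.
Next Obligation.
rewrite /drop_last raddf_sum big_ord_recr /= rmorphXn /=.
rewrite comp_mpolyXU -tnth_nth tnth_mktuple unlift_none expr0n addr0.
apply: eq_bigr => i _; rewrite rmorphXn /= comp_mpolyXU -tnth_nth tnth_mktuple.
have -> : widen_ord (leqnSn k) i = lift ord_max i.
  by apply: val_inj => /=; rewrite /bump leqNgt ltn_ord.
by rewrite liftK.
Qed.
Next Obligation.
exists n.+2 => k; apply: leq_trans (mmeasure_sum _ _ _ _) _.
apply/bigmax_leqP => i _; rewrite mpolyXn msizeX ltnS.
by rewrite mdegMn mdeg1 mul1n.
Qed.
End Def.
End SymFun.

From mathcomp Require Import complex.
From mathcomp Require Import all_classical all_reals all_analysis.
Import numFieldNormedType.Exports.
Import SymFun.
Local Open Scope classical_set_scope.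
Local Open Scope ring_scope.

Record part := Part {
  part_seq :> seq nat;
  part_seqP : sorted geq part_seq && (0%N \notin part_seq) }.
HB.instance Definition _ := [isSub for part_seq].
HB.instance Definition _ := [Countable of part by <:].

Definition empty_part : part := @Part [::] isT.

Section SchurFunctions.
Variable K : comNzRingType.

Definition hsymz (z : int) : symfun K := if z is Posz n then hsym K n else 0.

(* s_{la/mu} = det [h_{la_i - mu_j - i + j}], with h_k = 0 for k < 0, taken as
   the definition of skew Schur functions.  Any size at least the lengths of
   la and mu gives the same determinant; with a size smaller than the length
   of mu it could be nonzero for mu not contained in la. *)
Definition skew_schur (la mu : part) : symfun K :=
  \det (\matrix_(i < maxn (size la) (size mu), j < maxn (size la) (size mu))
    hsymz ((nth 0%N la i)%:Z - (nth 0%N mu j)%:Z - i%:Z + j%:Z)).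

Definition schur (la : part) : symfun K := skew_schur la empty_part.

End SchurFunctions.

Section Specializations.
Variable R : realType.

Definition specialization := {lrmorphism symfun R[i] -> R[i]^o}.

(* The order of R[i] is partial: 0 <= z means that z is real and nonnegative,
   and 0 < z that it is real and positive. *)
Definition nonneg_specialization (rho : specialization) :=
  forall la : part, 0 <= rho (schur R[i] la) :> R[i].

Definition Hseries (rho : specialization) (u : R[i]) : (R[i]^o)^nat :=
  series (fun n => rho (hsym R[i] n) * u ^+ n).

Definition Hfun (rho : specialization) (u : R[i]^o) : R[i]^o :=
  limn (Hseries rho u).

(* Derivability is over the field R[i], that is, complex differentiability. *)
Definition admissible (rho : specialization) :=
  nonneg_specialization rho /\
  exists r : R, 1 < r /\
    forall u : R[i], `|u| < r%:C%C ->
      cvgn (Hseries rho u) /\ derivable (Hfun rho) u 1.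

(* sigma is the union (rho1, rho2); psym n is p_{n+1}, so n ranges from 0. *)
Definition is_union (rho1 rho2 sigma : specialization) :=
  forall n, sigma (psym R[i] n) = rho1 (psym R[i] n) + rho2 (psym R[i] n).

Definition cauchyH (rho1 rho2 : specialization) : \bar R :=
  \esum_(la in [set: part])
    (complex.Re (rho1 (schur R[i] la) * rho2 (schur R[i] la)))%:E.

End Specializations.

Section Distributions.
Variables (R : realType) (T : choiceType).

Definition total_weight (w : T -> R[i]) : \bar R :=
  \esum_(x in [set: T]) (complex.Re (w x))%:E.

(* Some multiple of the weight w is a probability distribution. *)
Definition normalizable (w : T -> R[i]) :=
  [/\ forall x, 0 <= w x, exists x, 0 < w x & (total_weight w < +oo)%E].

(* The probability distribution proportional to w; only meaningful when w is
   normalizable. *)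
Definition normalize (w : T -> R[i]) (x : T) : R :=
  complex.Re (w x) / fine (total_weight w).

Definition prob_on (X : set T) (p : T -> R) :=
  [/\ forall x, X x -> 0 <= p x,
      forall x, ~ X x -> p x = 0 &
      \esum_(x in X) (p x)%:E = 1%E].

Definition stochastic_on (X : set T) (M : T -> T -> R) :=
  forall x, X x ->
    (forall y, X y -> 0 <= M x y) /\ \esum_(y in X) (M x y)%:E = 1%E.

(* Entry y of p M, for a row vector p and a matrix M indexed by X. *)
Definition measure_mul (X : set T) (p : T -> R) (M : T -> T -> R) (y : T) : \bar R :=
  \esum_(x in X) (p x * M x y)%:E.

End Distributions.

Section Transitions.
Variable R : realType.
Implicit Types (la mu nu : part).

Definition w_up_up (rho1 rho2 : specialization R) la mu nu : R[i] :=
  rho1 (skew_schur R[i] nu la) * rho2 (skew_schur R[i] nu mu).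
Definition P_up_up (rho1 rho2 : specialization R) la mu nu : R :=
  normalize (w_up_up rho1 rho2 la mu) nu.
Definition P_up_up_defined (rho1 rho2 : specialization R) la mu :=
  (cauchyH rho1 rho2 < +oo)%E /\ normalizable (w_up_up rho1 rho2 la mu).

Definition w_down_up (rho1 rho2 : specialization R) la mu nu : R[i] :=
  rho1 (skew_schur R[i] la nu) * rho2 (skew_schur R[i] nu mu).
Definition P_down_up (rho1 rho2 : specialization R) la mu nu : R :=
  normalize (w_down_up rho1 rho2 la mu) nu.
Definition P_down_up_defined (rho1 rho2 : specialization R) la mu :=
  normalizable (w_down_up rho1 rho2 la mu).

End Transitions.

(* The length N of a Schur process is n + 1.  Indices start at 0: rhop j,
   rhom j, x.1 j and x.2 j stand for rho_j^+, rho_{j+1}^-, lambda^{(j+1)} and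
   mu^{(j+1)}. *)
Section SchurProcess.
Variables (R : realType) (n : nat).
Variables (rhop rhom : 'I_n.+1 -> specialization R).

Definition state : choiceType :=
  ({ffun 'I_n.+1 -> part} * {ffun 'I_n -> part})%type.
Implicit Types x y : state.

Definition lower (i : 'I_n) : 'I_n.+1 := widen_ord (leqnSn n) i.
Definition upper (i : 'I_n) : 'I_n.+1 := lift ord0 i.

(* The Schur weight without its last factor s_{lambda^{(N)}}(rho_N^-). *)
Definition truncated_weight x : R[i] :=
  rhop ord0 (schur R[i] (x.1 ord0)) *
  \prod_(i < n) (rhom (lower i) (skew_schur R[i] (x.1 (lower i)) (x.2 i)) *
                 rhop (upper i) (skew_schur R[i] (x.1 (upper i)) (x.2 i))).

Definition schur_weight x : R[i] :=
  truncated_weight x * rhom ord_max (schur R[i] (x.1 ord_max)).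

Definition schur_process : state -> R := normalize schur_weight.

Definition admissible_states : set state :=
  [set x | 0 < truncated_weight x].

Variable varpi : specialization R.

Definition first_step x y : R :=
  P_up_up (rhop ord0) varpi empty_part (x.1 ord0) (y.1 ord0).
Definition down_step (i : 'I_n) x y : R :=
  P_down_up (rhom (lower i)) varpi (y.1 (lower i)) (x.2 i) (y.2 i).
Definition up_step (i : 'I_n) x y : R :=
  P_up_up (rhop (upper i)) varpi (y.2 i) (x.1 (upper i)) (y.1 (upper i)).

Definition update x y : R :=
  first_step x y * \prod_(i < n) (down_step i x y * up_step i x y).

(* The factors of update depend on the earlier entries of y: the distribution
   of an entry has to be defined whenever the earlier entries of y have been
   chosen with positive probability. *)
Definition update_well_defined (X : set state) :=
  forall x, X x ->
    P_up_up_defined (rhop ord0) varpi empty_part (x.1 ord0) /\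
    forall y (i : 'I_n),
      0 < first_step x y *
          \prod_(k < n | (k < i)%N) (down_step k x y * up_step k x y) ->
      P_down_up_defined (rhom (lower i)) varpi (y.1 (lower i)) (x.2 i) /\
      (0 < down_step i x y ->
       P_up_up_defined (rhop (upper i)) varpi (y.2 i) (x.1 (upper i))).

End SchurProcess.

(* Main.v *)
From mathcomp Require Import all_boot all_order all_algebra all_fingroup.
From mathcomp Require mpoly.
From mathcomp Require Import ring lra zify.
Require Import Defs.
Set Implicit Arguments.
Unset Strict Implicit.
Unset Printing Implicit Defensive.
Import Order.TTheory GRing.Theory Num.Theory.
Local Open Scope ring_scope.

(** A specialization enters only through the sequence x n = rho(h_n), whose skew
    Schur functions are the minors of the Toeplitz matrix T_x = (x (i - j)); a
    union of specializations is a convolution of sequences, i.e. a product of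
    Toeplitz matrices, so that branching is the Cauchy-Binet formula.

    Skew Cauchy identity.  Truncating H(u) and factoring it over the complex
    numbers, every sequence agrees up to a given order with a product of factors
    1 + b u.  For two single factors, T_a^t T_b and T_b T_a^t differ in one
    corner entry only, and expanding along the last row yields the identity,
    which is stable under convolution in each argument.

    Skew positivity.  After convolution with (1 + e u)^m, e > 0, all straight
    Schur functions are strictly positive; Fekete's argument, by the three-term
    Pluecker relation, then makes all skew ones nonnegative, and e tends to 0.

    Markov chain.  Multiplying the Schur weight by the transition matrix and
    summing over lambda^(1), mu^(1), lambda^(2), ... in turn, each sum cancels
    the normalization of the next transition, by the symmetry of the union or by
    the skew Cauchy identity. The normalization of the new Schur process is
    then found by summing over the new state, the matrix being stochastic. *)

(** * The Cauchy-Binet formula *)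

(** The factor H comes from the size of the determinants. A minor of one Toeplitz matrix with x_0 =
    1 does not change when both partitions are padded by a zero part. The determinant of T_a^t T_b
    does change: each further row multiplies it by a b and adds the down-down sum once, whence the
    series 1 + a b + (a b)^2 + ...

    The numbers b obtained by factoring are complex and bring neither positivity nor convergence.
    The skew Cauchy identity is therefore stated separately in each degree, as a finite algebraic
    identity in finitely many h_n. Its coefficients need no computation: the case of two empty
    partitions identifies them with the components of H. Series appear only afterwards, with
    nonnegative terms in the extended reals, where sums may be exchanged freely. Skew positivity is
    what makes this possible, since the hypotheses speak of straight Schur functions only. *)

Definition decreasing L (f : 'I_L -> nat) :=
  forall i j : 'I_L, (i < j)%N -> (f j < f i)%N.

(** A strictly increasing self-map dominates the identity; this applies to [s] and to its
    inverse. *)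
Lemma increasing_perm1 L (s : 'S_L) :
  (forall i j : 'I_L, (i < j)%N -> (s i < s j)%N) -> s = 1%g.
Proof.
have le_inc (t : 'S_L) :
    (forall i j : 'I_L, (i < j)%N -> (t i < t j)%N) -> forall i : 'I_L, (i <= t i)%N.
  move=> t_inc [i lt_i] /=; elim: i lt_i => [//|i IHi] lt_iL.
  exact: leq_ltn_trans (IHi (ltnW lt_iL)) (t_inc (Ordinal _) _ _).
move=> s_inc; apply/permP => i; apply: val_inj; apply/eqP.
rewrite perm1 eqn_leq le_inc // andbT.
rewrite -{2}(permK s i); apply: le_inc => j k lt_jk.
rewrite ltnNge; apply/negP; rewrite leq_eqVlt => /orP[/eqP/val_inj/perm_inj e|].
  by rewrite e ltnn in lt_jk.
by move/s_inc; rewrite !permKV ltnNge (ltnW lt_jk).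
Qed.

Section CauchyBinet.
Variables (K : comPzRingType) (L M : nat).
Implicit Types f g : {ffun 'I_L -> 'I_M}.

Definition decb f := [forall i : 'I_L, forall j : 'I_L, (i < j)%N ==> (f j < f i)%N].

Lemma decbP f : reflect (decreasing (fun i => f i : nat)) (decb f).
Proof.
apply: (iffP forallP) => [h i j|h i]; first by have /forallP/(_ j)/implyP := h i.
by apply/forallP => j; apply/implyP; apply: h.
Qed.

(** Uniqueness, with existence in [decb_sort]: an injective function is a decreasing one composed
    with a permutation in exactly one way. *)
Lemma decb_perm_inj f g (s t : 'S_L) : decb f -> decb g ->
  (forall i, f (s i) = g (t i)) -> f = g /\ s = t.
Proof.
move=> /decbP f_dec /decbP g_dec fg.
have fE i : f i = g (t (s^-1%g i)) by rewrite -fg permKV.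
have e : (s^-1 * t = 1)%g.
  apply: increasing_perm1 => i j lt_ij; have := f_dec _ _ lt_ij.
  rewrite !fE !permM => lt_g; rewrite ltnNge; apply/negP.
  rewrite leq_eqVlt => /orP[/eqP/val_inj e|/g_dec]; first by rewrite e ltnn in lt_g.
  by rewrite ltnNge (ltnW lt_g).
have st : s = t by rewrite -[LHS]mulg1 -e mulKVg.
by split=> //; apply/ffunP => i; rewrite fE st permKV.
Qed.

Lemma decb_sort f : injectiveb f -> exists s : 'S_L, decb [ffun i => f (s i)].
Proof.
move=> /injectiveP f_inj; pose t0 := [tuple f i | i < L].
pose r := [rel u v : 'I_M | (v <= u)%N].
have r_total : total r by move=> u v /=; rewrite leq_total.
have r_tr : transitive r by move=> u v w /= h1 h2; apply: leq_trans h2 h1.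
have /tuple_permP[p e] : perm_eq (sort r t0) t0 by rewrite perm_sort.
have u0 : uniq t0 by rewrite map_inj_uniq // enum_uniq.
exists p; apply/decbP => i j lt_ij; rewrite !ffunE.
have fpE k : f (p k) = tnth (sort_tuple r t0) k.
  rewrite (tnth_nth (f k)) /= e -(tnth_nth _ [tuple of _]) !tnth_mktuple.
  by [].
have := sort_sorted r_total t0 => /(sorted_leq_nth r_tr (fun=> leqnn _)).
move=> /(_ (f i) i j); rewrite !inE size_sort size_tuple !ltn_ord.
move=> /(_ isT isT (ltnW lt_ij)) /=.
rewrite !fpE !(tnth_nth (f i)) /= => le_ji; rewrite ltn_neqAle le_ji andbT.
apply/negP => /eqP/val_inj/eqP; rewrite nth_uniq ?sort_uniq ?size_sort ?size_tuple
    ?card_ord //.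
by move=> /eqP/esym e'; rewrite e' ltnn in lt_ij.
Qed.

(** Expanding the rows of the product gives a sum over all functions [f]; the injective ones are
    then grouped by their decreasing rearrangement. *)
Lemma cauchy_binet (A : 'M[K]_(L, M)) (B : 'M[K]_(M, L)) :
  \det (A *m B) =
    \sum_(f : {ffun 'I_L -> 'I_M} | decb f) \det (colsub f A) * \det (rowsub f B).
Proof.
have -> : \det (A *m B) = \sum_(f : {ffun 'I_L -> 'I_M}) (\prod_i A i (f i)) * \det (rowsub
    f B).
  rewrite /determinant.
  under [RHS]eq_bigr do rewrite big_distrr /=.
  rewrite exchange_big /=; apply: eq_bigr => s _.
  under eq_bigr do rewrite mxE.
  rewrite bigA_distr_bigA big_distrr /=; apply: eq_bigr => f _.
  rewrite big_split /= mulrCA; congr (_ * (_ * _)).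
  by apply: eq_bigr => i _; rewrite !mxE.
pose h (p : {ffun 'I_L -> 'I_M} * 'S_L) : {ffun 'I_L -> 'I_M} :=
  [ffun i => p.1 (p.2 i)].
pose D := [set p : {ffun 'I_L -> 'I_M} * 'S_L | decb p.1].
have h_inj : {in D &, injective h}.
  move=> [f s] [g t]; rewrite !inE /= => f_dec g_dec /ffunP e.
  have [i|<- <-//] := @decb_perm_inj f g s t f_dec g_dec.
  by have := e i; rewrite !ffunE.
(* A function outside the image of [h] is not injective, and then two rows of [rowsub f B] agree. *)
rewrite (bigID (fun f : {ffun _} => f \in h @: D)) /= [X in _ + X]big1 ?addr0; last first.
  move=> f /imsetP nf; suff : ~~ injectiveb f.
    case/injectivePn => i [j ne_ij e].
    rewrite (determinant_alternate ne_ij) ?mulr0 // => k.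
    by rewrite !mxE e.
  apply/negP => /decb_sort[s s_dec]; case: nf.
  exists ([ffun i => f (s i)], s^-1%g); first by rewrite inE.
  by apply/ffunP => i; rewrite /h !ffunE /= permKV.
rewrite big_imset //=.
rewrite (eq_bigl (fun p : {ffun 'I_L -> 'I_M} * 'S_L => decb p.1 && true)); last first.
  by move=> p; rewrite inE andbT.
rewrite -(pair_big_dep decb (fun _ _ => true) (fun f s =>
  (\prod_i A i (h (f, s) i)) * \det (rowsub (h (f, s)) B))) /=.
apply: eq_bigr => f _.
rewrite {2}/determinant big_distrl /=; apply: eq_bigr => s _.
have -> : rowsub (h (f, s)) B = row_perm s (rowsub f B).
  by apply/matrixP => i j; rewrite !mxE ffunE.
rewrite row_permE det_mulmx det_perm mulrA [_ * (-1) ^+ _]mulrC.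
congr (_ * _ * _); apply: eq_bigr => i _; by rewrite !mxE ffunE.
Qed.

End CauchyBinet.

(** * Partitions and Toeplitz minors *)

Lemma eq_big_support (V : nmodType) (T : eqType) (s1 s2 : seq T) (F : T -> V) :
  uniq s1 -> uniq s2 ->
  (forall t, F t != 0 -> (t \in s1) = (t \in s2)) ->
  \sum_(t <- s1) F t = \sum_(t <- s2) F t.
Proof.
move=> u1 u2 s12; rewrite (bigID (fun t => F t == 0)) /= big1 ?add0r; last first.
  by move=> t /eqP.
rewrite [RHS](bigID (fun t => F t == 0)) /= [in RHS]big1 ?add0r; last first.
  by move=> t /eqP.
rewrite -big_filter -[RHS]big_filter; apply: perm_big; apply: uniq_perm.
- exact: filter_uniq.
- exact: filter_uniq.
by move=> t; rewrite !mem_filter; case: eqVneq => //= /s12.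
Qed.

Lemma nth_part_le (la : part) i j : (i <= j)%N ->
  (nth 0%N la j <= nth 0%N la i)%N.
Proof.
move=> le_ij; have [lt_j|le_j] := ltnP j (size la); last by rewrite nth_default.
have /andP[la_sorted _] := part_seqP la.
have geq_tr : transitive geq by move=> a b c /= h1 h2; apply: leq_trans h2 h1.
apply: (sorted_leq_nth geq_tr leqnn 0%N la_sorted) => //.
by rewrite inE (leq_ltn_trans le_ij).
Qed.

Lemma nth_part_gt0 (la : part) i : (0 < nth 0%N la i)%N = (i < size la)%N.
Proof.
have [lt_i|le_i] := ltnP i (size la); last by rewrite nth_default.
have /andP[_ la0] := part_seqP la.
by rewrite lt0n; apply: contra la0 => /eqP <-; exact: mem_nth.
Qed.

Lemma nth_le_sumn (s : seq nat) i : (nth 0 s i <= sumn s)%N.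
Proof.
elim: s i => [|a s IHs] [|i] //=; first exact: leq_addr.
exact: leq_trans (IHs i) (leq_addl _ _).
Qed.

Lemma size_part_le (la : part) : (size la <= sumn la)%N.
Proof.
have /andP[_] := part_seqP la.
elim: (part_seq la) => //= a s IHs; rewrite inE negb_or eq_sym -lt0n.
by move=> /andP[a0 /IHs le_s]; rewrite -add1n leq_add.
Qed.

Lemma sumn_nth (s : seq nat) L : (size s <= L)%N ->
  sumn s = (\sum_(i < L) nth 0%N s i)%N.
Proof.
elim: s L => [L _|a s IHs [//|L] /= le_sL]; last by rewrite big_ord_recl -IHs.
by rewrite big1 // => i _; rewrite nth_nil.
Qed.

Lemma nth_part_inj (la mu : part) :
  (forall i, nth 0%N la i = nth 0%N mu i) -> la = mu.
Proof.
move=> e; apply: val_inj; apply: (@eq_from_nth _ 0%N) => [|i _]; last exact: e.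
apply/eqP; rewrite eqn_leq.
have le (n m : part) : (forall i, nth 0%N n i = nth 0%N m i) ->
    (size n <= size m)%N.
  move=> nm; rewrite leqNgt -(nth_part_gt0 n) nm -leqNgt.
  by rewrite nth_default.
by rewrite !le.
Qed.

(* The parts of la become the positions of particles on the half-line; adding
   the staircase turns weakly decreasing sequences into strictly decreasing
   ones. *)
Definition particle L (la : seq nat) i := (nth 0%N la i + (L - i.+1))%N.

Lemma particle_decreasing L (la : part) :
  decreasing (fun i : 'I_L => particle L la i).
Proof.
move=> i j lt_ij; rewrite /particle.
have := nth_part_le la (ltnW lt_ij); have := ltn_ord j; lia.
Qed.

Lemma sum_particle L (la : part) : (size la <= L)%N ->
  (\sum_(i < L) particle L la i = sumn la + \sum_(i < L) (L - i.+1))%N.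
Proof. by move=> le_L; rewrite big_split /= -sumn_nth. Qed.

Section Box.
Variables L C : nat.
Implicit Types f : {ffun 'I_L -> 'I_(L + C)}.

(** Inverse of [particle]: the staircase is subtracted and the zero parts are dropped. The default
    of [insubd] only serves functions that are not decreasing. *)
Definition part_of f : part := insubd empty_part
  [seq n <- mkseq (fun i => (oapp (fun k : 'I_L => f k : nat) 0 (insub i)) - (L - i.+1))%N
      L | n != 0%N].

(** The zeros of a weakly decreasing sequence stand at its end, so that deleting them replaces
    entries 0 by the default value 0. *)
Lemma nth_filter_neq0 (s : seq nat) i : sorted geq s ->
  nth 0%N [seq n <- s | n != 0%N] i = nth 0%N s i.
Proof.
have geq_tr : transitive geq by move=> a b c /= h1 h2; apply: leq_trans h2 h1.
elim: s i => //= a s IHs i a_s; have [a0|a0] /= := eqVneq a 0%N.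
  have s0 : all (pred1 0%N) s.
    apply: sub_all (order_path_min geq_tr a_s) => n /=.
    by rewrite a0 leqn0.
  have -> : [seq n <- s | n != 0%N] = [::].
    by apply/eqP; rewrite -(negbK (_ == _)) -has_filter; apply/hasPn => n /(allP s0) /=
        /eqP ->.
  rewrite a0 (all_pred1P _ _ s0); by case: i => //= i; rewrite nth_nseq if_same.
by case: i => //= i; rewrite IHs // (path_sorted a_s).
Qed.

Lemma particle_part_of f (i : 'I_L) : decb f -> particle L (part_of f) i = f i.
Proof.
move=> /decbP f_dec.
(* A strictly decreasing sequence of naturals dominates the staircase, so that the truncated
   subtraction in [part_of] loses nothing. *)
have f_ge (k : 'I_L) : (L - k.+1 <= f k)%N.
  have [m] := ubnP (L - k)%N; elim: m k => // m IHm k le_m.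
  have [lt_kL|] := ltnP k.+1 L; last by lia.
  have /= := IHm (Ordinal lt_kL); have := f_dec k (Ordinal lt_kL) (leqnn _).
  by move=> /=; lia.
pose s := mkseq (fun i => (oapp (fun k : 'I_L => f k : nat) 0 (insub i)) - (L - i.+1))%N L.
have sE (k : 'I_L) : nth 0%N s k = (f k - (L - k.+1))%N.
  by rewrite nth_mkseq // valK.
have geq_tr : transitive geq by move=> a b c /= h1 h2; apply: leq_trans h2 h1.
have s_sorted : sorted geq s.
  apply/(sortedP 0%N) => k; rewrite size_mkseq => lt_k.
  rewrite (sE (Ordinal lt_k)) (sE (Ordinal (ltnW lt_k))) /=.
  by have := f_dec (Ordinal (ltnW lt_k)) (Ordinal lt_k) (leqnn _); lia.
rewrite /particle /part_of /insubd insubT /=.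
  apply/andP; split; first exact: sorted_filter.
  by rewrite mem_filter eqxx.
by move=> ?; rewrite nth_filter_neq0 // sE subnK.
Qed.

Lemma size_part_of f : (size (part_of f) <= L)%N.
Proof.
rewrite /part_of /insubd; case: insubP => //= u _ ->.
by rewrite size_filter (leq_trans (count_size _ _)) ?size_mkseq.
Qed.

Lemma part_ofP (la : part) f : (size la <= L)%N ->
  (forall i : 'I_L, f i = particle L la i :> nat) -> part_of f = la.
Proof.
move=> le_la fE; have f_dec : decb f.
  by apply/decbP => i j; rewrite !fE; exact: particle_decreasing.
apply: nth_part_inj => i; have [lt_i|le_i] := ltnP i L.
  have := particle_part_of (Ordinal lt_i) f_dec.
  by rewrite fE /particle /= => /addIn.
by rewrite !nth_default // (leq_trans _ le_i) // size_part_of.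
Qed.

Definition box : seq part :=
  [seq part_of f | f <- enum {ffun 'I_L -> 'I_(L + C)} & decb f].

Lemma box_uniq : uniq box.
Proof.
rewrite map_inj_in_uniq ?filter_uniq -?enumT ?enum_uniq // => f g.
rewrite !mem_filter => /andP[f_dec _] /andP[g_dec _] e.
apply/ffunP => i; apply: val_inj.
by rewrite /= -(particle_part_of i f_dec) e particle_part_of.
Qed.

Lemma mem_box (la : part) :
  (la \in box) = (size la <= L)%N && (nth 0%N la 0 <= C)%N.
Proof.
apply/mapP/andP => [[f]|[le_L le_C]].
  rewrite mem_filter => /andP[f_dec _] ->; split; first exact: size_part_of.
  have [L0|L0] := posnP L.
    have s0 : size (part_of f) = 0%N by have := size_part_of f; lia.
    by rewrite (size0nil s0).
  have := particle_part_of (Ordinal L0) f_dec.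
  have := ltn_ord (f (Ordinal L0)); rewrite /particle /=; lia.
have lt i : (i < L)%N -> (particle L la i < L + C)%N.
  by have := nth_part_le la (leq0n i); rewrite /particle; lia.
exists [ffun i : 'I_L => Ordinal (lt i (ltn_ord i))].
  rewrite mem_filter mem_enum andbT; apply/decbP => i j; rewrite !ffunE /=.
  exact: particle_decreasing.
by apply/esym/part_ofP => // i; rewrite ffunE.
Qed.

Lemma big_box (V : nmodType) (F : ('I_L -> nat) -> V) :
  (forall g h, g =1 h -> F g = F h) ->
  \sum_(f : {ffun 'I_L -> 'I_(L + C)} | decb f) F (fun i => f i : nat) =
  \sum_(nu <- box) F (fun i => particle L nu i).
Proof.
move=> F_ext; rewrite big_map big_filter big_enum_cond /=.
apply: eq_bigr => f f_dec.
by apply: F_ext => i; rewrite particle_part_of.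
Qed.

End Box.

Definition parts_le n : seq part := [seq nu : part <- box n n | (sumn nu <= n)%N].
Definition parts n : seq part := [seq nu : part <- box n n | sumn nu == n].

Lemma mem_parts_le n (nu : part) : (nu \in parts_le n) = (sumn nu <= n)%N.
Proof.
rewrite mem_filter mem_box andb_idr // => le_n.
by rewrite (leq_trans (size_part_le nu) le_n) (leq_trans (nth_le_sumn nu 0) le_n).
Qed.

Lemma mem_parts n (nu : part) : (nu \in parts n) = (sumn nu == n).
Proof.
rewrite mem_filter mem_box andb_idr // => /eqP <-.
by rewrite size_part_le nth_le_sumn.
Qed.

Lemma parts_le_uniq n : uniq (parts_le n).
Proof. by rewrite filter_uniq // box_uniq. Qed.
Lemma parts_uniq n : uniq (parts n).
Proof. by rewrite filter_uniq // box_uniq. Qed.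

Section Toeplitz.
Variable K : comNzRingType.
Implicit Types x y : nat -> K.

Definition toep x (i j : nat) : K := if (j <= i)%N then x (i - j)%N else 0.

Definition convol x y n : K := \sum_(k < n.+1) x k * y (n - k)%N.

Lemma convolC x y : convol x y =1 convol y x.
Proof.
move=> n; rewrite /convol (reindex_inj rev_ord_inj) /=; apply: eq_bigr => i _.
by rewrite mulrC subSS subKn // -ltnS.
Qed.

Lemma convol0 x y : convol x y 0 = x 0%N * y 0%N.
Proof. by rewrite /convol big_ord_recl big_ord0 addr0. Qed.

(** Row [i] of a lower triangular matrix ends at column [i], so that the infinite matrix product is
    a sum below [M]. *)
Lemma toep_convol x y M i j : (i < M)%N ->
  toep (convol x y) i j = \sum_(n < M) toep x i n * toep y n j.
Proof.
move=> lt_iM.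
rewrite /toep; case: leqP => [le_ji|lt_ij]; last first.
  rewrite big1 // => n _; case: leqP => [le_ni|]; last by rewrite mul0r.
  by rewrite leqNgt (leq_ltn_trans le_ni lt_ij) mulr0.
rewrite convolC /convol -(big_mkord xpredT (fun k => y k * x (i - j - k)%N)).
rewrite -(big_mkord xpredT (fun n => (if (n <= i)%N then x (i - n)%N else 0) * (if (j <=
    n)%N then y (n - j)%N else 0))).
rewrite [RHS](@big_cat_nat _ _ _ j) ?(leq_trans le_ji (ltnW lt_iM)) //=.
rewrite [X in _ = X + _]big_nat [X in _ = X + _]big1 ?add0r; last first.
  by move=> n /andP[_ lt_nj]; rewrite [(j <= n)%N]leqNgt lt_nj mulr0.
rewrite [RHS](@big_cat_nat _ _ _ i.+1) ?(leq_trans le_ji) //=.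
rewrite [X in _ = _ + X]big_nat [X in _ = _ + X]big1 ?addr0; last first.
  by move=> n /andP[lt_in _]; rewrite leqNgt lt_in mul0r.
rewrite -[X in _ = \big[_/_]_(X <= _ < _) _]add0n big_addn subSn //; apply: eq_big_nat => k
    /andP[_ lt_k].
by rewrite leq_addl addnK mulrC -subnDA [(j + k)%N]addnC ifT //; lia.
Qed.

Definition minor x L (l m : 'I_L -> nat) : K :=
  \det (\matrix_(i < L, j < L) toep x (l i) (m j)).

(* If l i < m i, the rows >= i and the columns <= i span a block of zeros too
   large for the determinant not to vanish. *)
Lemma minor_eq0 x L (l m : 'I_L -> nat) i : decreasing l -> decreasing m ->
  (l i < m i)%N -> minor x l m = 0.
Proof.
move=> l_dec m_dec lt_i; rewrite /minor /determinant big1 // => s _.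
suff [k le_ik le_si] : exists2 k : 'I_L, (i <= k)%N & (s k <= i)%N.
  rewrite (bigD1 k) //= mxE /toep leqNgt ifF ?mul0r ?mulr0 //; apply/negbF.
  apply: (@leq_ltn_trans (l i)); first last.
    apply: leq_trans lt_i _; move: le_si; rewrite leq_eqVlt.
    by case/orP => [/eqP/val_inj <-//|/m_dec/ltnW].
  by move: le_ik; rewrite leq_eqVlt => /orP[/eqP/val_inj <-//|/l_dec/ltnW].
(* Otherwise [s] maps the indices [>= i] injectively into those [> i], which are fewer by one. *)
apply/exists_inP; apply: contraT; rewrite negb_exists_in => /forall_inP h.
pose A := [set k : 'I_L | (i <= k)%N]; pose B := [set k : 'I_L | (i < k)%N].
have sAB : [set s k | k in A] \subset B.
  apply/subsetP => _ /imsetP[k + ->]; rewrite !inE => le_ik.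
  by rewrite ltnNge h.
have := subset_leq_card sAB; rewrite card_imset; last exact: perm_inj.
have -> : A = i |: B.
  by apply/setP => k; rewrite !inE leq_eqVlt eq_sym; congr (_ || _).
by rewrite cardsU1 inE ltnn /= add1n ltnn.
Qed.

Lemma minor_diag x L (l : 'I_L -> nat) : x 0%N = 1 -> decreasing l ->
  minor x l l = 1.
Proof.
move=> x0 l_dec; rewrite /minor -det_tr det_trig.
  by rewrite big1 // => i _; rewrite !mxE /toep leqnn subnn.
apply/is_trig_mxP => i j lt_ij; rewrite !mxE /toep ifF //.
by rewrite leqNgt l_dec.
Qed.

Lemma minor_neq0_le x L (l m : 'I_L -> nat) : decreasing l -> decreasing m ->
  minor x l m != 0 -> forall i, (m i <= l i)%N.
Proof.
by move=> l_dec m_dec h i; rewrite leqNgt; apply: contra h => /minor_eq0 ->.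
Qed.

(** The scaled Toeplitz matrix is conjugate to the original by the diagonal matrix of powers of [t].
    Written without division, this holds for every [t]. *)
Lemma minor_scale x t L (l m : 'I_L -> nat) :
  minor (fun n => x n * t ^+ n) l m * t ^+ (\sum_i m i) =
  t ^+ (\sum_i l i) * minor x l m.
Proof.
rewrite -!prodrXr /minor.
have [] := (det_diag (\row_j t ^+ m j), det_diag (\row_i t ^+ l i)).
under eq_bigr do rewrite mxE; under [in X in _ -> X]eq_bigr do rewrite mxE.
move=> <- <-; rewrite -!det_mulmx; congr (\det _).
apply/matrixP => i j; rewrite mul_mx_diag mul_diag_mx !mxE /toep.
case: leqP => [le_ml|]; last by rewrite mul0r mulr0.
by rewrite -mulrA -exprD subnK // mulrC.
Qed.

(** Cauchy-Binet with the decreasing choices of intermediate positions below [L + C] read as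
    partitions in a box. [A] and [B] are arbitrary, so that transposed Toeplitz matrices are
    covered. *)
Lemma det_box L C (A B : nat -> nat -> K) (l m : 'I_L -> nat) :
  \det (\matrix_(i < L, j < L) \sum_(n < L + C) A (l i) n * B n (m j)) =
  \sum_(nu <- box L C) \det (\matrix_(i, j) A (l i) (particle L nu j)) *
                       \det (\matrix_(i, j) B (particle L nu i) (m j)).
Proof.
rewrite -(@big_box L C _ (fun f => \det (\matrix_(i, j) A (l i) (f j)) *
   \det (\matrix_(i, j) B (f i) (m j)))); last first.
  by move=> g h gh; congr (_ * _); congr (\det _); apply/matrixP => i j; rewrite !mxE gh.
transitivity (\det ((\matrix_(i < L, n < L + C) A (l i) n) *m
                    (\matrix_(n < L + C, j < L) B n (m j)))).
  congr (\det _); apply/matrixP => i j; rewrite !mxE.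
  by apply: eq_bigr => n _; rewrite !mxE.
rewrite cauchy_binet; apply: eq_bigr => f _.
by congr (_ * _); congr (\det _); apply/matrixP => i j; rewrite !mxE.
Qed.

Definition skew_at x L (la mu : part) : K :=
  minor x (fun i : 'I_L => particle L la i) (fun j => particle L mu j).

(* s_{la/mu} for the sequence h_n = x n, when x 0 = 1. *)
Definition sk x (la mu : part) : K := skew_at x (maxn (size la) (size mu)) la mu.

(** The last particle of [la] now sits at position 0, so that the last row is (0, ..., 0, 1). The
    other particles move by one, which a Toeplitz matrix does not notice. *)
Lemma skewS x L (la mu : part) : x 0%N = 1 ->
  (size la <= L)%N -> (size mu <= L)%N -> skew_at x L.+1 la mu = skew_at x L la mu.
Proof.
move=> x0 le_la le_mu; rewrite /skew_at /minor.
rewrite (expand_det_row _ ord_max) (bigD1 ord_max) //= big1 ?addr0; last first.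
  move=> j ne_j; rewrite mxE /particle nth_default // subnn /toep /= ifF ?mul0r //.
  by have := ltn_ord j; have : (j : nat) != L by []; lia.
rewrite mxE /toep /particle !nth_default // leqnn !subnn x0 mul1r /cofactor.
rewrite /= addnn -signr_odd odd_double mul1r; congr (\det _).
apply/matrixP => i j; rewrite !mxE /= /bump !(leqNgt L) !ltn_ord /= !add0n.
have := ltn_ord i; have := ltn_ord j => lt_j lt_i.
rewrite !subSS /toep.
have -> : (nth 0 la i + (L - i) = (nth 0 la i + (L - i.+1)).+1)%N by lia.
have -> : (nth 0 mu j + (L - j) = (nth 0 mu j + (L - j.+1)).+1)%N by lia.
by rewrite subSS ltnS.
Qed.

Lemma skewE x L (la mu : part) : x 0%N = 1 ->
  (size la <= L)%N -> (size mu <= L)%N -> skew_at x L la mu = sk x la mu.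
Proof.
move=> x0 le_la le_mu.
have : (maxn (size la) (size mu) <= L)%N by rewrite geq_max le_la.
elim: L {le_la le_mu} => [|L IHL]; rewrite leq_eqVlt => /orP[/eqP e|].
- by rewrite /sk e.
- by [].
- by rewrite /sk e.
rewrite ltnS => le_L; rewrite skewS ?IHL //; move: le_L; rewrite geq_max.
  by case/andP.
by case/andP.
Qed.

Lemma sk_neq0 x (la mu : part) : sk x la mu != 0 ->
  forall i, (nth 0%N mu i <= nth 0%N la i)%N.
Proof.
move=> h i; have [lt_i|le_i] := ltnP i (maxn (size la) (size mu)).
  have := minor_neq0_le (@particle_decreasing _ la) (@particle_decreasing _ mu) h.
  by move=> /(_ (Ordinal lt_i)); rewrite leq_add2r.
by rewrite nth_default // (leq_trans _ le_i) // leq_maxr.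
Qed.

Lemma sk_sumn x (la mu : part) : sk x la mu != 0 -> (sumn mu <= sumn la)%N.
Proof.
move=> /sk_neq0 h; rewrite !(@sumn_nth _ (maxn (size la) (size mu))) ?leq_maxl ?leq_maxr //.
exact: leq_sum.
Qed.

Lemma sk_gt x (la mu : part) : (sumn la < sumn mu)%N -> sk x la mu = 0.
Proof.
by move=> lt; apply: contraTeq lt => /sk_sumn; rewrite -leqNgt.
Qed.

Lemma sk_diag x (la : part) : x 0%N = 1 -> sk x la la = 1.
Proof. by move=> x0; apply: minor_diag => //; exact: particle_decreasing. Qed.

(** A skew Schur function reads finitely many h_n; this is what permits truncating H(u). *)
Lemma eq_sk x y (la mu : part) :
  (forall n, (n < maxn (size la) (size mu) + sumn la)%N -> x n = y n) ->
  sk x la mu = sk y la mu.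
Proof.
move=> xy; congr (\det _); apply/matrixP => i j; rewrite !mxE /toep.
case: ifP => // _; apply: xy; apply: leq_ltn_trans (leq_subr _ _) _.
rewrite /particle; have := nth_le_sumn la i; have := ltn_ord i; lia.
Qed.

(** Branching rule: Cauchy-Binet for a product of Toeplitz matrices, in a determinant large enough
    for every [nu] of size at most [n]. *)
Lemma sk_convol x y n (la mu : part) : x 0%N = 1 -> y 0%N = 1 ->
  (sumn la <= n)%N ->
  sk (convol x y) la mu = \sum_(nu <- parts_le n) sk x la nu * sk y nu mu.
Proof.
move=> x0 y0 le_n; pose L := (n + size mu)%N.
have le_la : (size la <= L)%N.
  by rewrite (leq_trans (size_part_le la)) // (leq_trans le_n) // leq_addr.
have le_mu : (size mu <= L)%N by rewrite leq_addl.
have c0 : convol x y 0 = 1 by rewrite convol0 x0 y0 mul1r.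
rewrite -(@skewE _ L) // /skew_at /minor.
transitivity (\sum_(nu <- box L L) skew_at x L la nu * skew_at y L nu mu).
  rewrite -(det_box L (toep x) (toep y)); congr (\det _).
  apply/matrixP => i j; rewrite !mxE (@toep_convol _ _ (L + L)) //.
  rewrite /particle; have := nth_le_sumn la i; have := ltn_ord i; rewrite /L; lia.
rewrite big_seq (eq_bigr (fun nu => sk x la nu * sk y nu mu)); last first.
  by move=> nu; rewrite mem_box => /andP[le_nu _]; rewrite !skewE.
rewrite -big_seq; apply: eq_big_support.
- exact: box_uniq.
- exact: parts_le_uniq.
move=> nu nz; have nu_la : (sumn nu <= sumn la)%N.
  by apply: (@sk_sumn x); apply: contraNneq nz => ->; rewrite mul0r.
have le_nu := leq_trans nu_la le_n.
rewrite mem_box mem_parts_le le_nu (leq_trans (size_part_le nu)).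
  rewrite (leq_trans (nth_le_sumn nu 0)) //.
  by rewrite (leq_trans le_nu) // leq_addr.
by rewrite (leq_trans le_nu) // leq_addr.
Qed.

End Toeplitz.

(** * The skew Cauchy identity *)

Lemma big_parts_le_widen (V : nmodType) m n (F : part -> V) : (m <= n)%N ->
  (forall nu, F nu != 0 -> (sumn nu <= m)%N) ->
  \sum_(nu <- parts_le m) F nu = \sum_(nu <- parts_le n) F nu.
Proof.
move=> le_mn F0; apply: eq_big_support; rewrite ?parts_le_uniq // => nu /F0 le_nu.
by rewrite !mem_parts_le le_nu (leq_trans le_nu).
Qed.

Lemma big_parts_le (V : nmodType) n (F : part -> V) :
  \sum_(nu <- parts_le n) F nu = \sum_(k < n.+1) \sum_(nu <- parts k) F nu.
Proof.
transitivity (\sum_(k < n.+1) \sum_(nu <- parts_le n | sumn nu == k) F nu).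
  rewrite (exchange_big_dep xpredT) //= big_seq [RHS]big_seq.
  apply: eq_bigr => nu; rewrite mem_parts_le -ltnS => lt_nu.
  rewrite (bigD1 (Ordinal lt_nu)) //= big1 ?addr0 // => k /andP[/eqP e ne].
  by case/eqP: ne; apply: val_inj.
apply: eq_bigr => k _; rewrite -big_filter; apply: perm_big; apply: uniq_perm.
- by rewrite filter_uniq // parts_le_uniq.
- exact: parts_uniq.
move=> nu; rewrite mem_filter mem_parts_le mem_parts.
by case: eqVneq => //= ->; rewrite -ltnS ltn_ord.
Qed.

Lemma toepDr (K : comNzRingType) (x : nat -> K) i j k :
  toep x (i + k) (j + k) = toep x i j.
Proof. by rewrite /toep leq_add2r subnDr. Qed.

Lemma parts_le0 : parts_le 0 = [:: empty_part].
Proof.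
apply: perm_small_eq => //; apply: uniq_perm; rewrite ?parts_le_uniq // => nu.
rewrite mem_parts_le leqn0 inE; apply/eqP/eqP => [nu0|-> //].
have := size_part_le nu; rewrite nu0 leqn0 => /eqP/size0nil nu_nil.
exact: val_inj.
Qed.

Section Sing.
Variable K : comNzRingType.
Implicit Types (a b : K) (x y z : nat -> K).

(** The coefficients of 1 + b u, that is, a single dual variable [b]. *)
Definition sing b n : K := if n is n'.+1 then if n' is 0%N then b else 0 else 1.

Lemma toep_sing b i j : toep (sing b) i j = (i == j)%:R + b * (i == j.+1)%:R.
Proof.
rewrite /toep /sing; case: leqP => [le_ji|lt_ij]; last first.
  by rewrite !ltn_eqF ?mulr0 ?addr0 // ltnW.
rewrite -(subnK le_ji); move: (i - j)%N => n; rewrite addnK.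
case: n => [|[|n]]; rewrite ?add0n ?add1n ?eqxx ?mulr1.
- by rewrite ltn_eqF // mulr0 addr0.
- by rewrite gtn_eqF // add0r.
by rewrite !gtn_eqF ?mulr0 ?addr0 //; lia.
Qed.

Lemma convol_sing b x n : convol (sing b) x n = x n + (if n is n'.+1 then b * x n' else 0).
Proof.
case: n => [|n]; first by rewrite convol0 mul1r addr0.
rewrite /convol !big_ord_recl /= mul1r subn0 big1 ?addr0 ?subSS ?subn0 //.
by move=> i _; rewrite mul0r.
Qed.

(* In a nonzero term of the expansion of the determinant, l i - m (s i) is 0 or
   1 for all i, so that s has no inversion. *)
Lemma minor_sing b L (l m : 'I_L -> nat) : decreasing l -> decreasing m ->
  minor (sing b) l m = \prod_i toep (sing b) (l i) (m i).
Proof.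
move=> l_dec m_dec; rewrite /minor /determinant (bigD1 1%g) //= [X in _ + X]big1 ?addr0.
  rewrite odd_perm1 mul1r; apply: eq_bigr => i _; by rewrite mxE perm1.
move=> s ne_s1; have [p0|] := eqVneq (\prod_i toep (sing b) (l i) (m (s i))) 0.
  by under eq_bigr do rewrite mxE; rewrite p0 mulr0.
move=> nz; case/eqP: ne_s1; apply: increasing_perm1 => i j lt_ij.
have near k : (l k == m (s k)) || (l k == (m (s k)).+1).
  apply: contraNT nz; rewrite negb_or => /andP[/negPf e1 /negPf e2].
  by rewrite (bigD1 k) //= toep_sing e1 e2 mulr0 addr0 mul0r.
rewrite ltnNge; apply/negP; rewrite leq_eqVlt.
case/orP => [/eqP/val_inj/perm_inj e|/m_dec]; first by rewrite e ltnn in lt_ij.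
have := l_dec _ _ lt_ij; move: (near i) (near j); lia.
Qed.

(* The entries of T_a^t T_b and T_b T_a^t on the half-line, for the sequences
   1 + a u and 1 + b u. *)
Definition TtT a b p q : K :=
  (p == q)%:R + b * (p == q.+1)%:R + a * (p.+1 == q)%:R + a * b * (p == q)%:R.
Definition TTt a b p q : K := TtT a b p q - a * b * ((p == 0) && (q == 0))%:R.

Lemma sum_delta n M (F : nat -> K) : (n < M)%N ->
  \sum_(k < M) (k == n :> nat)%:R * F k = F n.
Proof.
move=> lt_n; rewrite (bigD1 (Ordinal lt_n)) //= eqxx mul1r big1 ?addr0 // => k.
by rewrite -val_eqE /= => /negPf ->; rewrite mul0r.
Qed.

Lemma TtTE a b M p q : (p.+1 < M)%N ->
  \sum_(n < M) toep (sing a) n p * toep (sing b) n q = TtT a b p q.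
Proof.
move=> lt_p; under eq_bigr do rewrite (toep_sing a) mulrDl -mulrA.
rewrite big_split /= -big_distrr /=.
rewrite !(@sum_delta _ _ (fun n => toep (sing b) n q)) ?(ltnW lt_p) //.
rewrite !toep_sing eqSS.
by rewrite /TtT; ring.
Qed.

(** Row 0 has no column to the left of the diagonal; the term a b missing there is the corner
    correction in [TTt]. *)
Lemma TTtE a b M p q : (p < M)%N ->
  \sum_(n < M) toep (sing b) p n * toep (sing a) q n = TTt a b p q.
Proof.
move=> lt_p; under eq_bigr do rewrite (toep_sing b) mulrDl -mulrA [p == _]eq_sym.
rewrite big_split /= -big_distrr /=.
rewrite (@sum_delta _ _ (fun n => toep (sing a) q n)) // /TTt /TtT.
case: p lt_p => [|p] lt_p.
  rewrite [X in b * X]big1 ?mulr0 ?addr0; last by move=> n _; rewrite mul0r.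
  by rewrite toep_sing [q == 0%N]eq_sym [q == 1%N]eq_sym; case: q => [|q]; rewrite /=
      ?eqxx; ring.
under [X in b * X]eq_bigr do rewrite eqSS eq_sym.
rewrite (@sum_delta _ _ (fun n => toep (sing a) q n)) ?(ltnW lt_p) // !toep_sing [q ==
    p.+1]eq_sym [q == p.+2]eq_sym.
by rewrite [q == p]eq_sym !eqSS /=; ring.
Qed.

(** The last particles of [la] and [mu] sit at position 0, so that the two matrices differ in the
    corner entry only. Its cofactor is the determinant of size [L], because [TtT] is invariant under
    shifting both positions. *)
Lemma det_TtT_S a b L (la mu : part) : (size la <= L)%N -> (size mu <= L)%N ->
  \det (\matrix_(i < L.+1, j < L.+1) TtT a b (particle L.+1 la i) (particle L.+1 mu j)) =
  \det (\matrix_(i < L.+1, j < L.+1) TTt a b (particle L.+1 la i) (particle L.+1 mu j)) +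
  a * b * \det (\matrix_(i < L, j < L) TtT a b (particle L la i) (particle L mu j)).
Proof.
move=> le_la le_mu.
have particle_max (nu : part) : (size nu <= L)%N -> particle L.+1 nu L = 0%N.
  by move=> le_nu; rewrite /particle nth_default // subnn.
have particle_lt (nu : part) i : (i < L)%N -> particle L.+1 nu i = (particle L nu i).+1.
  by move=> lt_i; rewrite /particle; lia.
rewrite !(expand_det_row _ ord_max).
(* The rows other than the last have positive positions, where [TtT] and [TTt] agree. *)
have cof j : cofactor (\matrix_(i < L.+1, j < L.+1) TTt a b (particle L.+1 la i) (particle
    L.+1 mu j)) ord_max j =
    cofactor (\matrix_(i < L.+1, j < L.+1) TtT a b (particle L.+1 la i) (particle L.+1 mu
        j)) ord_max j.
  congr (_ * \det _); apply/matrixP => i k; rewrite !mxE /=.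
  have -> : bump L i = i by rewrite /bump leqNgt ltn_ord.
  by rewrite particle_lt // /TTt /= mulr0 subr0.
under [in RHS]eq_bigr do rewrite cof.
under [in RHS]eq_bigr do rewrite mxE /TTt mulrBl.
rewrite sumrB; under eq_bigr do rewrite mxE.
rewrite [X in _ = _ - X + _](bigD1 ord_max) //= [X in _ - (_ + X)]big1 ?addr0; last first.
  move=> j ne_j; have lt_j : (j < L)%N.
    by have := ltn_ord j; have : (j : nat) != L by []; lia.
  by rewrite [particle _ mu j]particle_lt // andbF mulr0 mul0r.
rewrite !particle_max // mulr1 /cofactor /= addnn -signr_odd odd_double mul1r.
set d1 := (X in _ - _ * X + _); set d2 := (X in _ + _ * X).
suff -> : d1 = d2 by rewrite subrK.
congr (\det _); apply/matrixP => i j; rewrite !mxE /=.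
by rewrite /bump !(leqNgt L) !ltn_ord /= !add0n !particle_lt // /TtT !eqSS.
Qed.

Lemma det_TtT_box a b L C (la mu : part) : (nth 0%N la 0 < C)%N ->
  \det (\matrix_(i < L, j < L) TtT a b (particle L la i) (particle L mu j)) =
  \sum_(nu <- box L C) skew_at (sing a) L nu la * skew_at (sing b) L nu mu.
Proof.
move=> lt_C; transitivity (\det (\matrix_(i < L, j < L) \sum_(n < L + C)
   toep (sing a) n (particle L la i) * toep (sing b) n (particle L mu j))).
  congr (\det _); apply/matrixP => i j; rewrite !mxE TtTE // /particle.
  have := nth_part_le la (leq0n i); have := ltn_ord i; lia.
rewrite (@det_box _ _ _ (fun p n => toep (sing a) n p) (toep (sing b))); apply: eq_bigr =>
    nu _; congr (_ * _).
by rewrite -det_tr; congr (\det _); apply/matrixP => i j; rewrite !mxE.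
Qed.

Lemma det_TTt_box a b L C (la mu : part) : (nth 0%N la 0 <= C)%N ->
  \det (\matrix_(i < L, j < L) TTt a b (particle L la i) (particle L mu j)) =
  \sum_(ka <- box L C) skew_at (sing b) L la ka * skew_at (sing a) L mu ka.
Proof.
move=> le_C; transitivity (\det (\matrix_(i < L, j < L) \sum_(n < L + C)
   toep (sing b) (particle L la i) n * toep (sing a) (particle L mu j) n)).
  congr (\det _); apply/matrixP => i j; rewrite !mxE TTtE // /particle.
  have := nth_part_le la (leq0n i); have := ltn_ord i; lia.
rewrite (@det_box _ _ _ (toep (sing b)) (fun n p => toep (sing a) p n)); apply: eq_bigr =>
    nu _; congr (_ * _).
by rewrite -[LHS]det_tr; congr (\det _); apply/matrixP => i j; rewrite !mxE.
Qed.

(** Once both partitions fit, the size [L] no longer matters: the inhomogeneous term of the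
    recursion [det_TtT_S] is constant. *)
Lemma det_TTt a b L (la mu : part) : (sumn la + sumn mu <= L)%N ->
  \det (\matrix_(i < L, j < L) TTt a b (particle L la i) (particle L mu j)) =
  \sum_(ka <- parts_le (sumn la + sumn mu)) sk (sing b) la ka * sk (sing a) mu ka.
Proof.
move=> le_L; rewrite (@det_TTt_box _ _ _ L); last first.
  by rewrite (leq_trans (nth_le_sumn la 0)) // (leq_trans _ le_L) // leq_addr.
have le_la : (size la <= L)%N.
  by rewrite (leq_trans (size_part_le la)) // (leq_trans _ le_L) // leq_addr.
have le_mu : (size mu <= L)%N.
  by rewrite (leq_trans (size_part_le mu)) // (leq_trans _ le_L) // leq_addl.
rewrite big_seq (eq_bigr (fun nu => sk (sing b) la nu * sk (sing a) mu nu)); last first.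
  by move=> nu; rewrite mem_box => /andP[le_nu _]; rewrite !skewE.
rewrite -big_seq; apply: eq_big_support; rewrite ?box_uniq ?parts_le_uniq //.
move=> nu nz; have nu_la : (sumn nu <= sumn la)%N.
  by apply: (@sk_sumn _ (sing b)); apply: contraNneq nz => ->; rewrite mul0r.
rewrite mem_box mem_parts_le (leq_trans nu_la) ?leq_addr //.
have le_nu : (sumn nu <= L)%N.
  by rewrite (leq_trans nu_la) // (leq_trans _ le_L) // leq_addr.
by rewrite (leq_trans (size_part_le nu)) // (leq_trans (nth_le_sumn nu 0)).
Qed.

(** The recursion [det_TtT_S] iterated [r] times; the geometric sum is the truncation of H = 1 / (1
    - a b). *)
Lemma det_TtT_iter a b (la mu : part) L r : (sumn la + sumn mu <= L)%N ->
  \det (\matrix_(i < L + r, j < L + r) TtT a b (particle (L + r) la i) (particle (L + r) mu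
      j)) =
  (\sum_(k < r) (a * b) ^+ k) *
    (\sum_(ka <- parts_le (sumn la + sumn mu)) sk (sing b) la ka * sk (sing a) mu ka) +
  (a * b) ^+ r *
    \det (\matrix_(i < L, j < L) TtT a b (particle L la i) (particle L mu j)).
Proof.
move=> le_L; have le_la : (size la <= L)%N.
  by rewrite (leq_trans (size_part_le la)) // (leq_trans _ le_L) // leq_addr.
have le_mu : (size mu <= L)%N.
  by rewrite (leq_trans (size_part_le mu)) // (leq_trans _ le_L) // leq_addl.
elim: r => [|r IHr].
  by rewrite big_ord0 mul0r add0r mul1r addn0.
rewrite addnS det_TtT_S ?(leq_trans _ (leq_addr _ _)) // IHr det_TTt; last first.
  by rewrite (leq_trans le_L) // -addnS leq_addr.
rewrite mulrDr !mulrA -exprS addrA; congr (_ + _).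
rewrite big_ord_recl expr0 -{1}[\sum_(ka <- _) _]mul1r -mulrDl; congr ((_ + _) * _).
by rewrite big_distrr /=; apply: eq_bigr => i _; rewrite -exprS.
Qed.

(* The component of degree N of the skew Cauchy identity; z k is the component
   of degree k of H(x; y). *)
Definition skew_cauchy x y z := forall (N : nat) (la mu : part),
  \sum_(nu <- parts N) sk x nu la * sk y nu mu =
  \sum_(ka <- parts_le (sumn la + sumn mu))
    toep z (N + sumn ka) (sumn la + sumn mu) * (sk y la ka * sk x mu ka).

Lemma skew_cauchyC x y z : skew_cauchy x y z -> skew_cauchy y x z.
Proof.
move=> E N la mu; rewrite addnC; under eq_bigr do rewrite mulrC.
by rewrite E; apply: eq_bigr => ka _; rewrite [sk y _ _ * _]mulrC.
Qed.

Lemma sk_morph (K' : comNzRingType) (f : {rmorphism K -> K'}) x (la mu : part) :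
  f (sk x la mu) = sk (fun n => f (x n)) la mu.
Proof.
rewrite /sk /skew_at /minor -det_map_mx; congr (\det _).
by apply/matrixP => i j; rewrite !mxE /toep; case: ifP; rewrite ?rmorph0.
Qed.

(** [y] is moved past [x2] and then past [x1]: branching splits the convolution, the two identities
    are applied in turn, and branching reassembles it. *)
Lemma skew_cauchy_convol x1 x2 y z1 z2 :
  x1 0%N = 1 -> x2 0%N = 1 -> y 0%N = 1 ->
  skew_cauchy x1 y z1 -> skew_cauchy x2 y z2 ->
  skew_cauchy (convol x1 x2) y (convol z1 z2).
Proof.
move=> x10 x20 y0 E1 E2 N la mu.
have convolE nu ka : sk (convol x1 x2) nu ka = sk (convol x2 x1) nu ka.
  by apply: eq_sk => n _; rewrite convolC.
(* Branching with [x2] as the outer factor, hence the commuted convolution; [al] lies between [la]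
   and [nu]. *)
transitivity (\sum_(al <- parts_le N) sk x1 al la *
    \sum_(nu <- parts N) sk x2 nu al * sk y nu mu).
  under [RHS]eq_bigr do rewrite big_distrr /=.
  rewrite exchange_big /= big_seq [RHS]big_seq; apply: eq_bigr => nu.
  rewrite mem_parts => /eqP nuN.
  rewrite convolE (@sk_convol _ _ _ N) ?nuN // big_distrl /=.
  by apply: eq_bigr => al _; ring.
set S := (sumn la + sumn mu)%N.
(* The identity for [x2], with the partitions [al] sorted by their size [k]. *)
transitivity (\sum_(k < N.+1) \sum_(ka <- parts_le S) sk x2 mu ka *
   toep z2 (N + sumn ka) (k + sumn mu) * \sum_(al <- parts k) sk x1 al la * sk y al ka).
  rewrite big_parts_le; apply: eq_bigr => k _.
  under [RHS]eq_bigr do rewrite big_distrr /=.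
  rewrite [RHS]exchange_big /= big_seq [RHS]big_seq; apply: eq_bigr => al.
  rewrite mem_parts => /eqP alk; rewrite E2 alk big_distrr /=.
  have le1 : (sumn mu <= k + sumn mu)%N by exact: leq_addl.
  have le2 : (sumn mu <= S)%N by exact: leq_addl.
  rewrite -(big_parts_le_widen le1); last first.
    move=> ka nz; apply: (@sk_sumn _ x2); apply: contraNneq nz => ->.
    by rewrite !mulr0.
  rewrite -(big_parts_le_widen le2); last first.
    move=> ka nz; apply: (@sk_sumn _ x2); apply: contraNneq nz => ->.
    by rewrite !mul0r.
  by apply: eq_bigr => ka _; ring.
(* The identity for [x1]; the sum over [k] then combines [z1] and [z2] into their convolution. *)
transitivity (\sum_(ka <- parts_le S) \sum_(ka' <- parts_le S)
    toep (convol z1 z2) (N + sumn ka') S * (sk y la ka' * (sk x2 mu ka * sk x1 ka ka'))).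
  rewrite exchange_big /=; apply: eq_bigr => ka _.
  have [mu_ka|mu_ka] := eqVneq (sk x2 mu ka) 0.
    rewrite !big1 // => i _; rewrite mu_ka ?mul0r ?mulr0 //.
  have le_ka := sk_sumn mu_ka.
  have le1 : (sumn la <= sumn la + sumn ka)%N by exact: leq_addr.
  have le2 : (sumn la <= S)%N by exact: leq_addr.
  transitivity (\sum_(k < N.+1) \sum_(ka' <- parts_le (sumn la)) sk x2 mu ka *
     toep z2 (N + sumn ka) (k + sumn mu) * (toep z1 (k + sumn ka') (sumn la + sumn ka) *
       (sk y la ka' * sk x1 ka ka'))).
    apply: eq_bigr => k _; rewrite E1 -(big_parts_le_widen le1); last first.
      move=> ka' nz; apply: (@sk_sumn _ y); apply: contraNneq nz => ->.
      by rewrite !(mul0r, mulr0).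
    by rewrite big_distrr.
  rewrite -(big_parts_le_widen le2); last first.
    move=> ka' nz; apply: (@sk_sumn _ y); apply: contraNneq nz => ->.
    by rewrite !(mul0r, mulr0).
  rewrite exchange_big /= big_seq [RHS]big_seq; apply: eq_bigr => ka'.
  rewrite mem_parts_le => le_ka'.
  have -> : toep (convol z1 z2) (N + sumn ka') S =
      \sum_(k < N.+1) toep z2 (N + sumn ka) (k + sumn mu) * toep z1 (k + sumn ka') (sumn la
          + sumn ka).
    transitivity (toep (convol z2 z1) (N + sumn ka + sumn ka') (sumn la + sumn mu + sumn ka)).
      rewrite [(N + _ + _)%N]addnAC toepDr /toep.
      by case: ifP => // _; rewrite convolC.
    rewrite (@toep_convol _ _ _ (N + sumn mu + sumn ka').+1); last by lia.
    (* The matrix product runs over n = k + d; below [d] the entries of [z1] lie above the diagonal,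
       since |ka'| <= |la|. *)
    set d := (sumn mu + sumn ka')%N.
    rewrite -(big_mkord xpredT (fun n => toep z2 (N + sumn ka + sumn ka') n * toep z1 n
        (sumn la + sumn mu + sumn ka))).
    rewrite (@big_cat_nat _ _ _ d) //=; last by rewrite /d; lia.
    rewrite big_nat big1 ?add0r; last first.
      move=> n /andP[_ lt_n]; rewrite [toep z1 _ _]/toep ifF ?mulr0 //.
      by apply/negbTE; rewrite -ltnNge; rewrite /d in lt_n; lia.
    rewrite -[X in \big[_/_]_(X <= _ < _) _]add0n big_addn.
    have -> : ((N + sumn mu + sumn ka').+1 - d = N.+1)%N by rewrite /d; lia.
    rewrite big_mkord; apply: eq_bigr => k _; congr (_ * _).
      by rewrite /d [(k + _)%N]addnA toepDr.
    by rewrite /d [(_ + sumn mu + _)%N]addnAC [(sumn mu + _)%N]addnC addnA toepDr.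
  by rewrite [RHS]mulr_suml; apply: eq_bigr => k _; ring.
rewrite exchange_big /=; apply: eq_bigr => ka' _.
under eq_bigr do rewrite mulrA.
rewrite -big_distrr /= mulrA; congr (_ * _).
by rewrite convolE (@sk_convol _ _ _ S) // leq_addl.
Qed.

Fixpoint sings (bs : seq K) : nat -> K :=
  if bs is b :: bs' then convol (sing b) (sings bs') else sing 0.

Lemma sings0 bs : sings bs 0 = 1.
Proof. by elim: bs => //= b bs IHs; rewrite convol0 IHs mul1r. Qed.

Lemma sings_gt bs n : (size bs < n)%N -> sings bs n = 0.
Proof.
elim: bs n => [|b bs IHs] [|n] //=; first by case: n.
by rewrite ltnS convol_sing => lt_n; rewrite !IHs ?mulr0 ?addr0 // ltnW.
Qed.

End Sing.

(** Homogeneity. The staircase contributes the same power of [t] to rows and columns, and it is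
    cancelled at the end. *)
Lemma sk_scale (K : idomainType) (x : nat -> K) (t : K) (la mu : part) : t != 0 ->
  sk (fun n => x n * t ^+ n) la mu = t ^+ (sumn la - sumn mu) * sk x la mu.
Proof.
move=> t0; have [mu_la|la_mu] := leqP (sumn mu) (sumn la); last first.
  by rewrite !sk_gt // mulr0.
have := minor_scale x t (fun i : 'I_(maxn (size la) (size mu)) => particle (maxn (size la)
    (size mu)) la i)
  (fun i => particle (maxn (size la) (size mu)) mu i).
rewrite /= !sum_particle ?leq_maxl ?leq_maxr // !exprD => e.
apply: (mulIf (expf_neq0 (sumn mu) t0)).
rewrite mulrAC -exprD subnK //.
set c := (\sum_(i < _) (maxn (size la) (size mu) - i.+1))%N in e.
apply: (mulIf (expf_neq0 c t0)); by rewrite -[LHS]mulrA [LHS]e mulrAC.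
Qed.

Section Field.
Variable K : fieldType.
Implicit Types (a b : K) (x y z : nat -> K).

(* Grading by powers of 'X turns the recursion for the determinants of T_a^t T_b
   into the geometric series of the commutation relation. *)
Lemma skew_cauchy_sing a b : skew_cauchy (sing a) (sing b) (fun k => (a * b) ^+ k).
Proof.
move=> N la mu; set S := (sumn la + sumn mu)%N; pose r := N.+1.
have X0 : 'X != 0 :> {poly K} by rewrite polyX_eq0.
have singX n : sing (a%:P * 'X) n = (sing a n)%:P * 'X ^+ n :> {poly K}.
  by case: n => [|[|n]]; rewrite /= ?expr0 ?mulr1 ?mul0r.
have skX (nu ka : part) :
    sk (sing (a%:P * 'X)) nu ka = 'X^(sumn nu - sumn ka) * (sk (sing a) nu ka)%:P.
  rewrite sk_morph -sk_scale //; apply: eq_sk => n _; exact: singX.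
have skC (nu ka : part) : sk (sing b%:P) nu ka = (sk (sing b) nu ka)%:P.
  by rewrite sk_morph; apply: eq_sk => -[|[|n]].
(* Only the sequence of [a] carries ['X]. The remainder of the recursion is then divisible by ['X^r]
   with r = N + 1, and does not reach the coefficient of degree [N]. *)
have := det_TtT_iter (a%:P * 'X) b%:P r (leqnn S).
rewrite (@det_TtT_box _ _ _ _ (S + r)); last first.
  by rewrite (leq_ltn_trans (nth_le_sumn la 0)) // /S /r; lia.
(* The factor ['X^(sumn la)] turns the exponents |nu| - |la| into |nu|, so that the coefficient of
   degree [N] selects the partitions of [N]. *)
set D := \det _ => /(congr1 (fun p => ('X^(sumn la) * p)`_N)) /=.
have -> : 'X^(sumn la) * (\sum_(nu <- box (S + r) (S + r))
      skew_at (sing (a%:P * 'X)) (S + r) nu la * skew_at (sing b%:P) (S + r) nu mu) =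
    \sum_(nu <- box (S + r) (S + r)) 'X^(sumn nu) * (sk (sing a) nu la * sk (sing b) nu mu)%:P.
  rewrite mulr_sumr big_seq [RHS]big_seq; apply: eq_bigr => nu.
  rewrite mem_box => /andP[le_nu _].
  have le_la : (size la <= S + r)%N by rewrite (leq_trans (size_part_le la)) // /S; lia.
  have le_mu : (size mu <= S + r)%N by rewrite (leq_trans (size_part_le mu)) // /S; lia.
  rewrite !skewE // skX skC polyCM !mulrA -exprD.
  have [->|nz] := eqVneq (sk (sing a) nu la) 0; first by rewrite !(mulr0, mul0r).
  by rewrite subnKC // (sk_sumn nz).
have -> : 'X^(sumn la) * ((\sum_(k < r) (a%:P * 'X * b%:P) ^+ k) *
      (\sum_(ka <- parts_le S) sk (sing b%:P) la ka * sk (sing (a%:P * 'X)) mu ka) +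
      (a%:P * 'X * b%:P) ^+ r * D) =
    \sum_(ka <- parts_le S) \sum_(k < r) 'X^(sumn la + k + (sumn mu - sumn ka)) *
      ((a * b) ^+ k * (sk (sing b) la ka * sk (sing a) mu ka))%:P +
    'X^r * ('X^(sumn la) * (a%:P * b%:P) ^+ r * D).
  rewrite mulrDr; congr (_ + _); last by rewrite !exprMn; ring.
  rewrite mulr_suml mulr_sumr exchange_big /=; apply: eq_bigr => k _.
  rewrite !mulr_sumr; apply: eq_bigr => ka _.
  by rewrite skX skC !polyCM !exprD !rmorphXn /= !rmorphM /= !exprMn; ring.
rewrite coefD coefXnM ltnSn addr0 !coef_sum => e.
transitivity (\sum_(nu <- box (S + r) (S + r) | sumn nu == N) sk (sing a) nu la * sk (sing
    b) nu mu).
  rewrite -[RHS]big_filter; apply: eq_big_support.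
  - exact: parts_uniq.
  - by rewrite filter_uniq // box_uniq.
  move=> nu _; rewrite mem_parts mem_filter mem_box andb_idr // => /eqP nuN.
  rewrite (leq_trans (size_part_le nu)) ?(leq_trans (nth_le_sumn nu 0)) //.
    by rewrite nuN /r; lia.
  by rewrite nuN /r; lia.
rewrite big_mkcond /=; under eq_bigr => nu _.
  have -> : (if sumn nu == N then sk (sing a) nu la * sk (sing b) nu mu else 0) =
     ('X^(sumn nu) * (sk (sing a) nu la * sk (sing b) nu mu)%:P)`_N.
    by rewrite coefMC coefXn eq_sym; case: eqP; rewrite ?mul1r ?mul0r.
  over.
rewrite {}e; apply: eq_bigr => ka _; rewrite coef_sum.
have [z|nz] := eqVneq (sk (sing a) mu ka) 0.
  by rewrite z !mulr0 big1 // => k _; rewrite !mulr0 coef0.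
have le_ka := sk_sumn nz.
under eq_bigr => k _ do rewrite coefMC coefXn mulrA.
rewrite -mulr_suml; congr (_ * _); rewrite /toep /S; case: leqP => [le_N|lt_N].
  have lt : (N + sumn ka - (sumn la + sumn mu) < r)%N by rewrite /r; lia.
  rewrite (bigD1 (Ordinal lt)) //= big1 ?addr0.
    by rewrite (_ : _ == _ = true) ?mul1r //; apply/eqP; lia.
  move=> k ne_k; rewrite (_ : _ == _ = false) ?mul0r //.
  apply/eqP => e; case/eqP: ne_k; apply: val_inj => /=; lia.
rewrite big1 // => k _; rewrite (_ : _ == _ = false) ?mul0r //.
apply/eqP; lia.
Qed.

(** The coefficients [z] may stay existential, since [skew_cauchy_closed] recovers them from the
    identity itself. *)
Lemma skew_cauchy_sings as_ bs : exists z, skew_cauchy (sings as_) (sings bs) z.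
Proof.
have sing_l a : exists z, skew_cauchy (sing a) (sings bs) z.
  elim: bs => [|b bs [z Ez]] /=; first by eexists; apply: skew_cauchy_sing.
  exists (convol (fun k => (b * a) ^+ k) z); apply: skew_cauchyC.
  apply: skew_cauchy_convol; rewrite ?sings0 //; first exact: skew_cauchy_sing.
  exact: skew_cauchyC.
elim: as_ => [|a as_ [z Ez]] /=; first exact: sing_l.
have [z' Ez'] := sing_l a; exists (convol z' z).
by apply: skew_cauchy_convol; rewrite ?sings0.
Qed.

(** Reading coefficients from the top turns X - r into 1 - r u, hence the negated roots. *)
Lemma coef_prod_sings (rs : seq K) n : (n <= size rs)%N ->
  (\prod_(r <- rs) ('X - r%:P))`_(size rs - n) = sings (map -%R rs) n.
Proof.
elim: rs n => [|r rs IHs] n /=.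
  by rewrite leqn0 => /eqP ->; rewrite big_nil coef1.
rewrite big_cons convol_sing mulrBl coefB coefXM coefCM.
set p := \prod_(_ <- _) _; case: n => [_|n].
  rewrite subn0 /= -{1}[size rs]subn0 IHs // addr0 [p`__]nth_default ?mulr0 ?subr0 //.
  by rewrite size_prod_XsubC.
rewrite ltnS subSS => le_n; rewrite IHs // mulNr; congr (_ - _).
move: le_n; rewrite leq_eqVlt => /orP[/eqP ->|lt_n].
  by rewrite subnn eqxx sings_gt // size_map.
by rewrite subn_eq0 leqNgt lt_n /= -subnS IHs.
Qed.

End Field.

(* The factors 1 + b u come from the roots of the reversed truncation of H(u). *)
Lemma closed_field_sings (K : closedFieldType) (x : nat -> K) M : x 0%N = 1 ->
  exists bs, forall n, (n <= M)%N -> x n = sings bs n.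
Proof.
move=> x0; pose p := \poly_(i < M.+1) x (M - i)%N.
have size_p : size p = M.+1 by rewrite size_poly_eq // subnn x0 oner_neq0.
have p_monic : p \is monic.
  by rewrite monicE lead_coefE size_p coef_poly ltnSn subnn x0.
have [rs p_rs] := closed_field_poly_normal p.
rewrite (monicP p_monic) scale1r in p_rs.
have size_rs : size rs = M.
  by apply: succn_inj; rewrite -size_p p_rs size_prod_XsubC.
exists (map -%R rs) => n le_n.
rewrite -coef_prod_sings size_rs // -p_rs coef_poly.
by rewrite ltnS leq_subr subKn.
Qed.

(** The component of degree [k] of the Cauchy sum H(x; y). *)
Definition hsum (K : comNzRingType) (x y : nat -> K) k :=
  \sum_(tau <- parts k) sk x tau empty_part * sk y tau empty_part.

Lemma skew_cauchy_closed (K : closedFieldType) (x y : nat -> K) :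
  x 0%N = 1 -> y 0%N = 1 -> skew_cauchy x y (hsum x y).
Proof.
move=> x0 y0 N la mu; set S := (sumn la + sumn mu)%N.
(* By [eq_sk], partitions of size at most N + S involve only terms of index below 2 (N + S). *)
pose M := (2 * (N + S))%N.
have [as_ xE] := closed_field_sings M x0; have [bs yE] := closed_field_sings M y0.
have [z E] := skew_cauchy_sings as_ bs.
have bound (nu ka : part) : (sumn nu <= N + S)%N -> sk x nu ka = sk (sings as_) nu ka /\ sk
    y nu ka = sk (sings bs) nu ka.
  move=> le_nu; have [le_ka|lt_ka] := leqP (sumn ka) (sumn nu); last first.
    by rewrite !sk_gt.
  split; apply: eq_sk => k lt_k; [apply: xE | apply: yE].
    move: (size_part_le nu) (size_part_le ka); rewrite /M; lia.
  move: (size_part_le nu) (size_part_le ka); rewrite /M; lia.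
(* For two empty partitions the right side of the identity is the single term [z k]. *)
have zE k : (k <= N + S)%N -> hsum x y k = z k.
  move=> le_k; have := E k empty_part empty_part; rewrite /= addn0.
  rewrite parts_le0.
  rewrite big_seq1 /= !sk_diag ?sings0 // !mulr1 addn0 /toep leq0n subn0 => <-.
  rewrite /hsum big_seq [RHS]big_seq; apply: eq_bigr => nu; rewrite mem_parts => /eqP nu_k.
  by have [|-> ->] := bound nu empty_part; rewrite ?nu_k.
transitivity (\sum_(nu <- parts N) sk (sings as_) nu la * sk (sings bs) nu mu).
  rewrite big_seq [RHS]big_seq; apply: eq_bigr => nu; rewrite mem_parts => /eqP nu_N.
  have le : (sumn nu <= N + S)%N by rewrite nu_N leq_addr.
  by have [-> _] := bound nu la le; have [_ ->] := bound nu mu le.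
rewrite E big_seq [RHS]big_seq; apply: eq_bigr => ka; rewrite mem_parts_le => le_ka.
have [_ ->] := bound la ka ltac:(rewrite /S; lia).
have [-> _] := bound mu ka ltac:(rewrite /S; lia).
congr (_ * _); rewrite /toep; case: ifP => // _; rewrite zE //.
by rewrite leq_subLR /S; lia.
Qed.

(** * Positivity of skew Schur functions *)

Section Pluecker.
Variables (K : comNzRingType) (T : nat -> nat -> K).

Definition detf n (f : nat -> nat) := \det (\matrix_(i < n, j < n) T i (f j)).

Lemma eq_detf n f g : (forall j, (j < n)%N -> f j = g j) -> detf n f = detf n g.
Proof. by move=> fg; congr (\det _); apply/matrixP => i j; rewrite !mxE fg. Qed.

Lemma detf_eq0 n f j k : (j < n)%N -> (k < n)%N -> j != k -> f j = f k ->
  detf n f = 0.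
Proof.
move=> lt_j lt_k ne fjk; rewrite /detf -det_tr.
rewrite (@determinant_alternate _ _ _ (Ordinal lt_j) (Ordinal lt_k)) // => i.
by rewrite !mxE /= fjk.
Qed.

(* The maximal minors of an L x (L + 1) matrix, with alternating signs, are
   annihilated by its rows. *)
Lemma detf_kernel n i : (i < n)%N ->
  \sum_(j < n.+1) (-1) ^+ j * T i j * detf n (bump j) = 0.
Proof.
move=> lt_i; pose Z := \matrix_(a < n.+1, j < n.+1) T (if a == 0%N :> nat then i else a.-1) j.
have Z0 : \det Z = 0.
  apply: (@determinant_alternate _ _ _ ord0 (lift ord0 (Ordinal lt_i))) => // j.
  by rewrite !mxE.
rewrite -[RHS]Z0 (expand_det_row _ ord0); apply: eq_bigr => j _.
rewrite mxE /= /cofactor add0n mulrA [T i j * _]mulrC; congr (_ * _).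
by congr (\det _); apply/matrixP => a b; rewrite !mxE /=.
Qed.

(** [w j] is the minor on n + 1 rows with column [j] followed by the [n] columns [L], hence a
    combination of rows of [T]. Paired with the kernel vector of [detf_kernel], it leaves only the
    three columns 0, t + 1 and n + 2 that [L] omits. *)
Lemma pluecker n t : (t <= n)%N ->
  detf n.+2 (bump t.+1) * detf n.+1 S =
  detf n.+2 S * detf n.+1 (bump t.+1) +
  detf n.+2 id * detf n.+1 (fun j => (bump t j).+1).
Proof.
move=> le_tn; pose L b := (bump t b).+1.
pose w j : K := \sum_(i < n.+1) (-1) ^+ i * T i j *
  \det (\matrix_(a < n, b < n) T (bump i a) (L b)).
(* Moving the column in place [s] to the front costs the sign (-1)^s. *)
have wE f s : (s <= n)%N -> (forall b, (b < n)%N -> f (bump s b) = L b) ->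
    detf n.+1 f = (-1) ^+ s * w (f s).
  rewrite -ltnS => lt_s fL; rewrite /detf (expand_det_col _ (Ordinal lt_s)).
  rewrite /w mulr_sumr; apply: eq_bigr => i _; rewrite mxE /= /cofactor /= exprD.
  set d1 := \det _; set d2 := \det _; suff -> : d1 = d2 by ring.
  by congr (\det _); apply/matrixP => a b; rewrite !mxE /= fL.
have B1 : detf n.+1 S = (-1) ^+ t * w t.+1 by apply: wE.
have B2 : detf n.+1 (bump t.+1) = w 0%N.
  by rewrite (wE _ 0%N) ?mul1r //= => b _; rewrite /L /bump; lia.
have B3 : detf n.+1 L = (-1) ^+ n * w n.+2.
  rewrite (wE _ n) //; last by move=> b lt_b; rewrite /L [bump n b]/bump leqNgt lt_b.
  by rewrite /L /bump le_tn.
have w0 j : (j < n.+3)%N -> j != 0%N -> j != t.+1 -> j != n.+2 -> w j = 0.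
  move=> lt_j j0 jt jn; pose b := unbump t j.-1.
  have Lb : L b = j by rewrite /L /b unbumpKcond; lia.
  have lt_b : (b < n)%N by rewrite /b /unbump; lia.
  have := wE (fun k => if k is k'.+1 then L k' else j) 0%N isT (fun b _ => erefl).
  by rewrite mul1r => <-; rewrite (@detf_eq0 _ _ 0%N b.+1).
have : \sum_(j < n.+3) (-1) ^+ j * w j * detf n.+2 (bump j) = 0.
  under eq_bigr do rewrite /w mulrAC mulr_sumr.
  rewrite exchange_big big1 //= => i _.
  pose c : K := (-1) ^+ i * \det (\matrix_(a < n, b < n) T (bump i a) (L b)).
  transitivity (c * \sum_(j < n.+3) (-1) ^+ j * T i j * detf n.+2 (bump j)).
    by rewrite [RHS]mulr_sumr; apply: eq_bigr => j _; rewrite /c; ring.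
  by rewrite detf_kernel ?mulr0 // ltnW // ltnS ltn_ord.
have lt_t : (t.+1 < n.+3)%N by lia.
rewrite (bigD1 ord0) //= (bigD1 (Ordinal lt_t)) //= (bigD1 ord_max) /=; last first.
  by rewrite -val_eqE /=; lia.
rewrite big1 ?addr0; last first.
  move=> j /andP[/andP[ne1 ne2] ne3]; rewrite w0 ?mulr0 ?mul0r //.
rewrite -/L B1 B2 B3 expr0 mul1r !exprS => e.
rewrite (@eq_detf _ id (bump n.+2)); last by move=> j lt_j; rewrite /bump leqNgt lt_j.
rewrite (@eq_detf _ S (bump 0)) //.
apply/eqP; rewrite -subr_eq0 -oppr_eq0 -[X in _ == X]e; apply/eqP; ring.
Qed.

End Pluecker.

(** * Fekete's criterion for total positivity *)

Definition decn L (f : nat -> nat) := forall i j, (i < j < L)%N -> (f j < f i)%N.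

Section Fekete.
Variables (R : realFieldType) (x : nat -> R) (M : nat).

Definition tminor L (r c : nat -> nat) := detf (fun i j => toep x (r i) j) L c.

(** The columns are consecutive here: up to a shift by [s], these minors are straight Schur
    functions. *)
Hypothesis solid_gt0 : forall L r s, decn L r ->
  (forall i, (i < L)%N -> (s + (L - i.+1) <= r i < M)%N) ->
  0 < tminor L r (fun j => s + (L - j.+1))%N.

(* By induction on L and on c 0 - c (L - 1): a column filling a gap of c has
   Pluecker relations with minors that are smaller in this order. *)
Lemma fekete L r c : decn L r -> decn L c ->
  (forall i, (i < L)%N -> (c i <= r i < M)%N) -> 0 < tminor L r c.
Proof.
elim: L r c => [|[|n] IHL] r c r_dec c_dec cr.
- by rewrite /tminor /detf det_mx00.
- rewrite /tminor (@eq_detf _ _ _ _ (fun j => c 0%N + (1 - j.+1))%N); last first.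
    by case=> // _; rewrite addn0.
  by apply: solid_gt0 => // -[|//] _; rewrite addn0 cr.
have [D] := ubnP (c 0%N - c n.+1)%N; elim: D c c_dec cr => // D IHD c c_dec cr le_D.
have [gap|no_gap] := boolP [exists t : 'I_n.+1, (c t.+1).+1 < c t]%N; last first.
  have cS t : (t < n.+1)%N -> c t = (c t.+1).+1.
    move=> lt_t; have := c_dec t t.+1; rewrite ltnS leqnn ltnS lt_t => /(_ isT).
    move: no_gap; rewrite negb_exists => /forallP/(_ (Ordinal lt_t)) /=; lia.
  have c_solid k : (k < n.+2)%N -> c (n.+1 - k)%N = (c n.+1 + k)%N.
    elim: k => [|k IHk] lt_k; first by rewrite subn0 addn0.
    have := cS (n.+1 - k.+1)%N; rewrite -subSn ?subSS // => -> //; last by lia.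
    by rewrite IHk ?addnS // ltnW.
  rewrite /tminor (@eq_detf _ _ _ _ (fun j => c n.+1 + (n.+2 - j.+1))%N).
    apply: solid_gt0 => // i lt_i; have := cr i lt_i.
    by rewrite -c_solid; [rewrite subSS subKn // -ltnS | lia].
  by move=> j lt_j; rewrite -c_solid; [rewrite subSS subKn // -ltnS | lia].
have /existsP[[t lt_t] /= gap_t] := gap.
(* [d] inserts the column [(c t).-1] into the gap after [c t]; leaving it out gives back [c]. *)
pose d i := if (i <= t)%N then c i else if i == t.+1 then (c t).-1 else c i.-1.
have d_bump j : d (bump t.+1 j) = c j.
  rewrite /d /bump; case: (ltnP t j) => lt_j.
    by rewrite add1n ltnNge (ltnW lt_j) /= eqSS gtn_eqF.
  by rewrite add0n lt_j.
have d_le j : (j <= t)%N -> d j = c j by rewrite /d => ->.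
have d_t : d t.+1 = (c t).-1 by rewrite /d ltnn eqxx.
have d_gt j : (t < j)%N -> d j.+1 = c j.
  by move=> lt_j; rewrite -(d_bump j) /bump lt_j.
have c_dec1 j : (j < n.+1)%N -> (c j.+1 < c j)%N.
  by move=> lt_j; apply: c_dec; rewrite ltnS leqnn ltnS.
have d_decS j : (j < n.+2)%N -> (d j.+1 < d j)%N.
  move=> lt_j; case: (ltngtP j t) => [lt_jt|lt_tj|->].
  - by rewrite !d_le ?(ltnW lt_jt) // c_dec1 // (ltn_trans lt_jt).
  - case: j lt_j lt_tj => // j lt_j lt_tj; rewrite d_gt //.
    move: lt_tj; rewrite ltnS leq_eqVlt => /orP[/eqP <-|lt_tj].
      by rewrite d_t; lia.
    by rewrite d_gt // c_dec1.
  - by rewrite d_t d_le //; lia.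
have d_dec : decn n.+3 d.
  move=> i j /andP[lt_ij lt_j]; elim: j lt_ij lt_j => // j IHj.
  rewrite ltnS leq_eqVlt => /orP[/eqP ->|lt_ij] lt_j; first exact: d_decS.
  exact: ltn_trans (d_decS _ _) (IHj lt_ij (ltnW lt_j)).
have dS_le j : (j < n.+2)%N -> (d j.+1 <= c j)%N.
  by rewrite -(d_bump j) /bump => lt_j; case: ltnP => // _; apply/ltnW/d_decS.
have tminorE L (f : nat -> nat) :
  detf (fun i j => toep x (r i) (d j)) L f = tminor L r (d \o f) by [].
have r_decW : decn n.+1 r.
  by move=> i j /andP[lt_ij lt_j]; apply: r_dec; rewrite lt_ij ltnW.
(* The minor sought times a positive minor of order n + 1 becomes a sum of two products. Their
   factors of order n + 2 lack the first or the last column of [c], hence are narrower. *)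
have := pluecker (fun i j => toep x (r i) (d j)) (t := t) (n := n).
rewrite -ltnS lt_t !tminorE => /(_ isT).
have bumpE L : tminor L r (d \o bump t.+1) = tminor L r c.
  by apply: eq_detf => j _; apply: d_bump.
rewrite !bumpE.
have B1 : 0 < tminor n.+1 r (d \o S).
  apply: IHL => // [i j /andP[lt_ij lt_j]|i lt_i] /=; first by apply: d_dec; lia.
  by have := cr i; have := dS_le i; lia.
have d0 : d 0%N = c 0%N by rewrite d_le.
have dL : d n.+2 = c n.+1 by rewrite d_gt.
have A0 : 0 < tminor n.+2 r (d \o S).
  apply: IHD => [i j /andP[lt_ij lt_j]|i lt_i|] /=; first by apply: d_dec; lia.
    by have := cr i; have := dS_le i; lia.
  by have := d_decS 0%N isT; have := d_dec 0%N n.+2 (ltnSn _); lia.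
have B2 : 0 < tminor n.+1 r c.
  apply: IHL => // [i j /andP[lt_ij lt_j]|i lt_i]; first by apply: c_dec; lia.
  by apply: cr; lia.
(* The inserted column moves later ones by one place, so that [d i <= r i] may fail. The minor is
   then 0, and nonnegativity is enough here. *)
have A2 : 0 <= tminor n.+2 r (d \o id).
  have [ok|] := boolP [forall i : 'I_n.+2, d i <= r i]%N.
    apply/ltW/IHD => [i j /andP[lt_ij lt_j]|i lt_i|] /=.
    - by apply: d_dec; lia.
    - have /= -> := forallP ok (Ordinal lt_i); by have := cr i lt_i; lia.
    - have := d_decS n.+1 (ltnSn _); have := d_dec 0%N n.+1 (ltnW (ltnSn _)).
      by lia.
  rewrite negb_forall => /existsP[i]; rewrite -ltnNge => lt_i.
  rewrite /tminor /detf.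
  have -> // : \det (\matrix_(i0 < n.+2, j < n.+2) toep x (r i0) ((d \o id) j)) = 0.
  apply: (@minor_eq0 _ x _ (fun i => r i) (fun i => d i) i) => //.
    by move=> a b lt_ab; apply: r_dec; rewrite lt_ab /=.
  by move=> a b lt_ab; apply: d_dec; rewrite lt_ab /= ltnW // ltnS.
have B3 : 0 < tminor n.+1 r (d \o (fun j => (bump t j).+1)).
  have e j : (d \o (fun j => (bump t j).+1)) j = c j.+1.
    by rewrite -(d_bump j.+1) /= /bump ltnS; case: leqP; rewrite ?add1n ?add0n.
  rewrite /tminor (@eq_detf _ _ _ _ (fun j => c j.+1)) //.
  apply: IHL => // [i j /andP[lt_ij lt_j]|i lt_i]; first by apply: c_dec; lia.
  by have := c_dec1 i lt_i; have := cr i; lia.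
move=> e; rewrite -(pmulr_lgt0 _ B1) e; apply: ltr_wpDr; last exact: mulr_gt0.
by apply: mulr_ge0 => //; apply: ltW.
Qed.

End Fekete.

(** Continuity at 0 made explicit: write p = q X + c, bound q by [C] on [0, 1], and if c < 0 exhibit
    a small [e] where p is negative. *)
Lemma horner0_ge0 (R : realFieldType) (p : {poly R}) :
  (forall e, 0 < e -> 0 <= p.[e]) -> 0 <= p.[0].
Proof.
have bound (q : {poly R}) : exists2 C, 0 <= C & forall e, 0 <= e <= 1 -> `|q.[e]| <= C.
  elim/poly_ind: q => [|q c [C C0 qC]].
    by exists 0 => // e _; rewrite horner0 normr0.
  exists (C + `|c|) => [|e e01]; first by rewrite addr_ge0.
  rewrite hornerMXaddC (le_trans (ler_normD _ _)) // lerD2r normrM.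
  rewrite -[C]mulr1 ler_pM ?qC //; by have /andP[e0 e1] := e01; rewrite ger0_norm.
elim/poly_ind: p => [|q c _ p_ge0]; first by rewrite horner0.
have [C C0 qC] := bound q; rewrite hornerMXaddC mulr0 add0r leNgt.
(* Chosen so that 0 < e <= 1 and C e < - c. *)
apply/negP => c_lt0; pose e := - c / (- c + C + 1).
have d_gt0 : 0 < - c + C + 1 by lra.
have e_gt0 : 0 < e by rewrite divr_gt0 // oppr_gt0.
have e_le1 : e <= 1 by rewrite ler_pdivrMr // mul1r; lra.
have := p_ge0 e e_gt0; rewrite hornerMXaddC.
have : q.[e] * e <= C * e.
  rewrite ler_wpM2r ?(ltW e_gt0) // (le_trans (ler_norm _)) // qC //.
  by rewrite (ltW e_gt0).
have : C * e < - c.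
  rewrite /e mulrA ltr_pdivrMr // mulrC ltr_pM2l ?oppr_gt0 //; lra.
by lra.
Qed.

Lemma part_pred_subproof (la : part) :
  sorted geq [seq n <- map predn la | n != 0%N] && (0%N \notin [seq n <- map predn la | n
      != 0%N]).
Proof.
have geq_tr : transitive geq by move=> a b c /= h1 h2; apply: leq_trans h2 h1.
apply/andP; split; last by rewrite mem_filter eqxx.
apply: sorted_filter => //; apply/(sortedP 0%N) => k; rewrite size_map => lt_k.
rewrite !(nth_map 0%N) ?(ltnW lt_k) //=.
by have := nth_part_le la (leqnSn k); lia.
Qed.
(** The diagram without its first column. What was removed is a vertical strip, the kind of skew
    shape on which [sing b] does not vanish. *)
Definition part_pred la := @Part _ (part_pred_subproof la).

Lemma nth_part_pred (la : part) i : nth 0%N (part_pred la) i = (nth 0%N la i).-1.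
Proof.
rewrite /= nth_filter_neq0.
  have [lt_i|le_i] := ltnP i (size la); first by rewrite (nth_map 0%N).
  by rewrite !nth_default // size_map.
apply/(sortedP 0%N) => k; rewrite size_map => lt_k.
rewrite !(nth_map 0%N) ?(ltnW lt_k) //=.
by have := nth_part_le la (leqnSn k); lia.
Qed.

(** * Perturbation by factors 1 + e u *)

Section Positivity.
Variable R : realFieldType.
Implicit Types (b e : R) (x y : nat -> R).

Lemma sk_sing_ge0 b (la mu : part) : 0 <= b -> 0 <= sk (sing b) la mu.
Proof.
move=> b0; rewrite /sk /skew_at minor_sing; try exact: particle_decreasing.
by apply: prodr_ge0 => i _; rewrite toep_sing addr_ge0 ?mulr_ge0 ?ler0n.
Qed.

Lemma sk_sing_pred b (la : part) : 0 < b -> 0 < sk (sing b) la (part_pred la).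
Proof.
move=> b0; rewrite /sk /skew_at minor_sing; try exact: particle_decreasing.
apply: prodr_gt0 => i _; rewrite toep_sing /particle nth_part_pred.
case: (nth 0%N la i) => [|n] /=; first by rewrite eqxx ltr_wpDr ?mulr_ge0 ?ler0n ?ltW.
by rewrite addSn eqxx mulr1 ltr_wpDl ?ler0n.
Qed.

Lemma sk_sings_ge0 b m (la mu : part) : 0 <= b -> 0 <= sk (sings (nseq m b)) la mu.
Proof.
move=> b0; elim: m la mu => [|m IHm] la mu /=; first exact: sk_sing_ge0.
rewrite (@sk_convol _ _ _ (sumn la)) ?sings0 //.
by apply: sumr_ge0 => nu _; rewrite mulr_ge0 ?sk_sing_ge0.
Qed.

Lemma ler_term (T : eqType) (s : seq T) (F : T -> R) t :
  (forall u, 0 <= F u) -> t \in s -> F t <= \sum_(u <- s) F u.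
Proof.
move=> F0 ts; rewrite (perm_big _ (perm_to_rem ts)) /=.
by rewrite big_cons lerDl sumr_ge0.
Qed.

(** Each factor 1 + b u can strip one column, so that [m] factors lead from [la] down to the empty
    partition. *)
Lemma sk_sings_gt0 b m (la : part) : 0 < b -> (nth 0%N la 0 <= m)%N ->
  0 < sk (sings (nseq m b)) la empty_part.
Proof.
move=> b0; elim: m la => [|m IHm] la le_m /=.
  have -> : la = empty_part; last by rewrite sk_diag.
  apply: val_inj; apply: size0nil; apply/eqP; rewrite -leqn0 leqNgt -nth_part_gt0.
  by rewrite -leqNgt.
rewrite (@sk_convol _ _ _ (sumn la)) ?sings0 //.
have la_pred : part_pred la \in parts_le (sumn la).
  by rewrite mem_parts_le (@sk_sumn _ (sing b)) // lt0r_neq0 // sk_sing_pred.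
apply: lt_le_trans (ler_term _ la_pred).
  by rewrite mulr_gt0 ?sk_sing_pred // IHm // nth_part_pred; lia.
by move=> nu; rewrite mulr_ge0 ?sk_sing_ge0 ?sk_sings_ge0 // ltW.
Qed.

Variable x : nat -> R.
Hypothesis x0 : x 0%N = 1.
Hypothesis schur_ge0 : forall la : part, 0 <= sk x la empty_part.

(** In the branching sum the term of the empty partition is positive and all others are
    nonnegative. *)
Lemma sk_perturb_gt0 b m (la : part) : 0 < b -> (nth 0%N la 0 <= m)%N ->
  0 < sk (convol (sings (nseq m b)) x) la empty_part.
Proof.
move=> b0 le_m; rewrite (@sk_convol _ _ _ (sumn la)) ?sings0 //.
have e_in : empty_part \in parts_le (sumn la) by rewrite mem_parts_le.
apply: lt_le_trans (ler_term _ e_in).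
  by rewrite mulr_gt0 ?sk_sings_gt0 // sk_diag.
by move=> nu; rewrite mulr_ge0 ?sk_sings_ge0 // ltW.
Qed.

Lemma skew_perturb_ge0 b m (la mu : part) : 0 < b ->
  (nth 0%N la 0 + size la + size mu <= m)%N ->
  0 <= sk (convol (sings (nseq m b)) x) la mu.
Proof.
move=> b0 le_m; set y := convol _ x.
have y0 : y 0%N = 1 by rewrite /y convol0 sings0 x0 mul1r.
(* Shifting rows and columns down by [s] turns a minor on consecutive columns into a straight Schur
   function, whose first row is at most [m]. *)
have solid L r s : decn L r ->
    (forall i, (i < L)%N -> (s + (L - i.+1) <= r i < m)%N) ->
    0 < tminor y L r (fun j => s + (L - j.+1))%N.
  move=> r_dec r_s.
  have lt i : (i < L)%N -> (r i - s < L + m)%N by move=> lt_i; have := r_s i lt_i; lia.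
  pose f : {ffun 'I_L -> 'I_(L + m)} := [ffun i : 'I_L => Ordinal (lt i (ltn_ord i))].
  have f_dec : decb f.
    apply/decbP => i j lt_ij; rewrite !ffunE /=.
    have := r_dec i j; rewrite lt_ij ltn_ord => /(_ isT).
    by have := r_s i (ltn_ord i); have := r_s j (ltn_ord j); lia.
  have nuE (i : 'I_L) : particle L (part_of f) i = (r i - s)%N.
    by rewrite particle_part_of // ffunE.
  have -> : tminor y L r (fun j => s + (L - j.+1))%N = skew_at y L (part_of f) empty_part.
    congr (\det _); apply/matrixP => i j; rewrite !mxE nuE.
    rewrite -(toepDr _ (r i - s) _ s) subnK; last by have := r_s i (ltn_ord i); lia.
    by rewrite /particle /= nth_nil add0n addnC.
  rewrite skewE ?size_part_of // sk_perturb_gt0 //.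
  have [L0|L0] := posnP L.
    by rewrite nth_default // (leq_trans (size_part_of f)) // L0.
  have := nuE (Ordinal L0); rewrite /particle /=.
  by have := r_s 0%N L0; lia.
pose L := maxn (size la) (size mu).
have dec_particle (nu : part) : decn L (particle L nu).
  move=> i j /andP[lt_ij lt_j].
  exact: (@particle_decreasing L nu (Ordinal (ltn_trans lt_ij lt_j)) (Ordinal lt_j)).
have [ok|] := boolP [forall i : 'I_L, particle L mu i <= particle L la i]%N.
  apply/ltW/(fekete solid (dec_particle la) (dec_particle mu)) => i lt_i.
  have /= -> := forallP ok (Ordinal lt_i); rewrite /particle.
  by have := nth_part_le la (leq0n i); rewrite /L in lt_i *; lia.
rewrite negb_forall => /existsP[i]; rewrite -ltnNge => lt_i.
by rewrite /sk /skew_at (minor_eq0 _ _ _ lt_i) //; apply: particle_decreasing.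
Qed.

Lemma sk_ge0 (la mu : part) : 0 <= sk x la mu.
Proof.
pose m := (nth 0%N la 0 + size la + size mu)%N.
(* The perturbed skew function as a polynomial in the parameter e; its value at 0 is the unperturbed
   one. *)
pose p := sk (convol (sings (nseq m 'X)) (polyC \o x)) la mu.
have sings_horner e n k : (sings (nseq n ('X : {poly R})) k).[e] = sings (nseq n e) k.
  elim: n k => [|n IHn] k /=; first by case: k => [|[|k]]; rewrite /= ?hornerC ?horner0.
  rewrite /convol horner_sum; apply: eq_bigr => i _; rewrite hornerM IHn; congr (_ * _).
  by case: (i : nat) => [|[|j]]; rewrite /= ?hornerC ?hornerX ?horner0.
have pE e : p.[e] = sk (convol (sings (nseq m e)) x) la mu.
  rewrite -/(horner_eval e p) /p (sk_morph (horner_eval e)); apply: eq_sk => k _.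
  rewrite /convol rmorph_sum; apply: eq_bigr => i _.
  by rewrite rmorphM /= /horner_eval sings_horner hornerC.
have convol_delta k : convol (sings (nseq m 0)) x k = x k.
  elim: {p pE} m k => [|n IHn] k.
    by rewrite convol_sing; case: k => [|k]; rewrite ?mul0r addr0.
  rewrite /=.
  transitivity (convol (sings (nseq n 0)) x k); last exact: IHn.
  apply: eq_bigr => i _; rewrite convol_sing.
  by case: (i : nat) => [|j]; rewrite ?mul0r addr0.
rewrite -(@eq_sk _ (convol (sings (nseq m 0)) x) x) // -pE.
by apply: horner0_ge0 => e e0; rewrite pE skew_perturb_ge0.
Qed.

End Positivity.

(** * Specializations *)

Module Newton.
Import mpoly SymFun.

Section Newton.
Variable K : comNzRingType.

Lemma mcoeff_hpolyMX n k (m0 m : 'X_{1..k}) : (mdeg m0 <= n)%N ->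
  (hpoly K (n - mdeg m0) k * 'X_[m0])@_m = ((m0 <= m)%MM && (mdeg m == n))%:R.
Proof.
move=> le_n; case: (boolP (m0 <= m)%MM) => [le_m|nle_m] /=.
  rewrite -{1}(submK le_m) addmC mcoeffMX mcoeff_hpoly.
  rewrite -[in RHS](submK le_m) mdegD; congr (_%:R); congr nat_of_bool.
  by apply/eqP/eqP; lia.
rewrite mcoeffM big1 // => -[k1 k2] /= /eqP mE; rewrite mcoeffX.
case: eqVneq => [e|_]; last by rewrite mulr0.
by case/negP: nle_m; rewrite mE e /= lem_addl.
Qed.

Lemma sum_ltn n a : (\sum_(k < n) (k < a) = minn n a)%N.
Proof.
elim: n => [|n IHn]; first by rewrite big_ord0 min0n.
by rewrite big_ord_recr /= IHn; lia.
Qed.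

(** In the coefficient of x^m, with m of degree [n], each pair (i, k) with k < m i contributes 1 on
    the right, in total the degree of m. *)
Lemma newton n :
  hsym K n *+ n = \sum_(k < n) psym K k * hsym K (n - k.+1).
Proof.
apply: symfun_ext => N.
have sf_sum (I : Type) (r : seq I) (F : I -> symfun K) :
    (\sum_(i <- r) F i : symfun K) N = \sum_(i <- r) F i N.
  by elim: r => [|i r IHr]; rewrite ?big_nil // !big_cons -IHr.
have sf_muln (f : symfun K) k : (f *+ k) N = (f N) *+ k.
  by elim: k => [|k IHk]; rewrite ?mulr0n // !mulrS -IHk.
rewrite sf_sum sf_muln /=; apply/mpolyP => m; rewrite mcoeffMn mcoeff_hpoly.
transitivity (\sum_(k < n) \sum_(i < N) ((k < m i)%N && (mdeg m == n))%:R : K).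
  case: eqVneq => [mn|_]; last first.
    by rewrite mul0rn big1 // => k _; rewrite big1 // => i _; rewrite andbF.
  under eq_bigr do under eq_bigr do rewrite andbT.
  rewrite exchange_big /= -{1}mn mdegE natr_sum; apply: eq_bigr => i _.
  rewrite -natr_sum sum_ltn; congr (_%:R).
  by rewrite (minn_idPr _) // -mn mdegE (bigD1 i) //= leq_addr.
rewrite raddf_sum /=; apply: eq_bigr => k _.
rewrite mulr_suml raddf_sum /=; apply: eq_bigr => i _.
have dX : mdeg (U_(i) *+ k.+1)%MM = k.+1 by rewrite mdegMn mdeg1 mul1n.
rewrite mpolyXn mulrC -{2}dX mcoeff_hpolyMX ?dX ?ltn_ord //.
congr (_%:R); congr (nat_of_bool (_ && _)).
apply/idP/mnm_lepP => [lt_k j|/(_ i)]; last by rewrite mulmnE mnm1E eqxx mul1n.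
by rewrite mulmnE mnm1E; case: eqVneq => [<-|_]; rewrite ?mul1n ?mul0n.
Qed.

Lemma hsym0 : hsym K 0 = 1.
Proof.
apply: symfun_ext => k; apply/mpolyP => m.
by rewrite /= mcoeff_hpoly mcoeff1 mdeg_eq0.
Qed.

End Newton.
End Newton.

(** * The convolution algebra and logarithmic derivatives *)

Section ConvAlgebra.
Variable K : comNzRingType.
Implicit Types x y z p : nat -> K.

Lemma toep_n0 x n : toep x n 0 = x n.
Proof. by rewrite /toep subn0. Qed.

(** Associativity of the matrix product, read in column 0. *)
Lemma convolA x y z : convol x (convol y z) =1 convol (convol x y) z.
Proof.
move=> n; rewrite -[LHS]toep_n0 -[RHS]toep_n0 !(@toep_convol _ _ _ n.+1) //.
under eq_bigr => k _ do rewrite (@toep_convol _ _ _ n.+1) // mulr_sumr.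
rewrite exchange_big /=; apply: eq_bigr => l _.
rewrite (@toep_convol _ _ _ n.+1) // mulr_suml.
by apply: eq_bigr => k _; rewrite mulrA.
Qed.

Lemma eq_convol x x' y y' : x =1 x' -> y =1 y' -> convol x y =1 convol x' y'.
Proof. by move=> xx yy n; apply: eq_bigr => k _; rewrite xx yy. Qed.

(* Newton's identities: n h_n = sum_(1 <= k <= n) p_k h_(n - k), the sequence p
   starting with p 0 = 0. *)
Definition newton_seq p x := forall n, x n *+ n = convol p x n.

(** Multiplying the n-th term by n is a derivation for the convolution, so that logarithmic
    derivatives add. *)
Lemma newton_convol p q x y : newton_seq p x -> newton_seq q y ->
  newton_seq (fun n => p n + q n) (convol x y).
Proof.
move=> px qy n.
have -> : convol (fun n => p n + q n) (convol x y) n = convol p (convol x y) n + convol q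
    (convol x y) n.
  by rewrite -big_split; apply: eq_bigr => k _; rewrite mulrDl.
have -> : convol q (convol x y) n = convol x (convol q y) n.
  rewrite (eq_convol (fun=> erefl) (convolC x y)) convolA convolC.
  exact: eq_convol.
rewrite convolA -sumrMnl -big_split; apply: eq_bigr => k _ /=.
rewrite -px -qy mulrnAl mulrnAr -mulrnDr subnKC // -ltnS.
exact: ltn_ord.
Qed.

End ConvAlgebra.

(** Since p 0 = 0, the right side only involves earlier terms; in characteristic 0 the factor n can
    be cancelled. *)
Lemma newton_seq_inj (K : numFieldType) (p x y : nat -> K) : p 0%N = 0 ->
  x 0%N = y 0%N -> newton_seq p x -> newton_seq p y -> x =1 y.
Proof.
move=> p0 xy0 px py n; have [m] := ubnP n; elim: m n => // m IHm [|n] // lt_n.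
have n0 : n.+1%:R != 0 :> K by rewrite pnatr_eq0.
apply: (mulfI n0); rewrite !mulr_natl px py.
apply: eq_bigr => k _; have [->|k0] := eqVneq (k : nat) 0%N; first by rewrite p0 !mul0r.
by rewrite IHm //; lia.
Qed.

From mathcomp Require Import complex.
From mathcomp Require Import all_classical all_reals all_analysis.
Import SymFun.
Local Open Scope classical_set_scope.
Local Open Scope ring_scope.

Section Specializations.
Variable R : realType.
Implicit Type rho : specialization R.

Definition hseq rho n : R := complex.Re (rho (hsym R[i] n)).

Definition real_specialization rho :=
  forall n, rho (hsym R[i] n) = (hseq rho n)%:C%C.

Lemma hseq0 rho : hseq rho 0 = 1.
Proof. by rewrite /hseq Newton.hsym0 rmorph1. Qed.

(** The index la_i - mu_j - i + j is a difference of particle positions; where it is negative, both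
    conventions give 0. *)
Lemma skew_schurE rho (la mu : part) : real_specialization rho ->
  rho (skew_schur R[i] la mu) = (sk (hseq rho) la mu)%:C%C.
Proof.
move=> rhoE; rewrite /skew_schur -det_map_mx (sk_morph (real_complex R)).
congr (\det _); apply/matrixP => i j; rewrite !mxE /toep.
set L := maxn _ _; set n := (particle L la i - particle L mu j)%N.
case: leqP => [le_ml|lt_lm].
  have -> : (nth 0%N la i)%:Z - (nth 0%N mu j)%:Z - i%:Z + j%:Z = n%:Z.
    move: le_ml; rewrite /n /particle; have := ltn_ord i; have := ltn_ord j.
    by rewrite -/L; lia.
  by rewrite /= rhoE.
have [k ->] : exists k, (nth 0%N la i)%:Z - (nth 0%N mu j)%:Z - i%:Z + j%:Z = Negz k.
  exists (particle L mu j - particle L la i).-1.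
  move: lt_lm; rewrite /particle; have := ltn_ord i; have := ltn_ord j.
  by rewrite -/L NegzE; lia.
by rewrite /= rmorph0.
Qed.

(** h_n is the Schur function of a one-row partition, and a nonnegative element of [R[i]] is
    real. *)
Lemma nonneg_real rho : nonneg_specialization rho -> real_specialization rho.
Proof.
move=> rho_ge0 [|n]; first by rewrite hseq0 Newton.hsym0 !rmorph1.
rewrite /hseq; pose la := @Part [:: n.+1] isT.
have -> : hsym R[i] n.+1 = schur R[i] la.
  rewrite /schur /skew_schur /= (expand_det_row _ ord0) big_ord1 mxE /= /cofactor.
  by rewrite det_mx00 !mulr1 !addn0.
have := rho_ge0 la; rewrite lecE => /andP[/eqP /= im0 _].
by case: (rho _) im0 => a b /= ->.
Qed.

Lemma schur_hseqE rho (la : part) : real_specialization rho ->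
  rho (schur R[i] la) = (sk (hseq rho) la empty_part)%:C%C.
Proof. exact: skew_schurE. Qed.

Lemma sk_hseq_ge0 rho (la mu : part) : nonneg_specialization rho ->
  0 <= sk (hseq rho) la mu.
Proof.
move=> rho_ge0; apply: sk_ge0; first exact: hseq0.
move=> nu; rewrite -lecR -schur_hseqE ?rho_ge0 //; exact: nonneg_real.
Qed.

(** A union is given on power sums; Newton's identities carry it over to the h_n. *)
Lemma union_hsym (rho1 rho2 sigma : specialization R) :
  is_union rho1 rho2 sigma -> forall n,
  sigma (hsym R[i] n) =
    convol (fun k => rho1 (hsym R[i] k)) (fun k => rho2 (hsym R[i] k)) n :> R[i].
Proof.
move=> uni; pose p (rho : specialization R) n : R[i] := if n is k.+1 then rho (psym R[i] k)
    else 0.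
have newton_rho (rho : specialization R) : newton_seq (p rho) (fun k => rho (hsym R[i] k) :
    R[i]).
  move=> n; rewrite /convol big_ord_recl mul0r add0r -rmorphMn /= Newton.newton rmorph_sum.
  by apply: eq_bigr => k _; rewrite rmorphM.
apply: (@newton_seq_inj _ (fun n => p rho1 n + p rho2 n)).
- by rewrite /= addr0.
- by rewrite convol0 Newton.hsym0 !rmorph1 mulr1.
- by move=> n; rewrite newton_rho; apply: eq_convol => // -[|k] /=; rewrite ?addr0.
- exact: newton_convol.
Qed.

Lemma hseq_union (rho1 rho2 sigma : specialization R) :
  nonneg_specialization rho1 -> nonneg_specialization rho2 ->
  is_union rho1 rho2 sigma ->
  real_specialization sigma /\ hseq sigma =1 convol (hseq rho1) (hseq rho2).
Proof.
move=> /nonneg_real r1 /nonneg_real r2 /union_hsym uni.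
have sE n : sigma (hsym R[i] n) = (convol (hseq rho1) (hseq rho2) n)%:C%C.
  rewrite uni /convol (rmorph_sum (real_complex R)); apply: eq_bigr => k _.
  by rewrite r1 r2 -(rmorphM (real_complex R)).
have hE : hseq sigma =1 convol (hseq rho1) (hseq rho2) by move=> n; rewrite /hseq sE.
by split=> // n; rewrite hE.
Qed.

Lemma skew_cauchy_real (x y : nat -> R) :
  x 0%N = 1 -> y 0%N = 1 -> skew_cauchy x y (hsum x y).
Proof.
move=> x0 y0 N la mu; apply: (@complexI R).
have := @skew_cauchy_closed R[i] (fun n => (x n)%:C%C) (fun n => (y n)%:C%C).
rewrite x0 y0 => /(_ erefl erefl N la mu) e.
have toepE i j : (toep (hsum x y) i j)%:C%C =
    toep (hsum (fun n => (x n)%:C%C) (fun n => (y n)%:C%C)) i j.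
  rewrite /toep; case: ifP => // _; rewrite (rmorph_sum (real_complex R)).
  by apply: eq_bigr => nu _; rewrite rmorphM /= !(sk_morph (real_complex R)).
rewrite !(rmorph_sum (real_complex R)).
transitivity (\sum_(nu <- parts N) sk (fun n => (x n)%:C%C) nu la * sk (fun n => (y
    n)%:C%C) nu mu).
  by apply: eq_bigr => nu _; rewrite rmorphM /= !(sk_morph (real_complex R)).
rewrite e; apply: eq_bigr => ka _.
by rewrite !rmorphM /= toepE !(sk_morph (real_complex R)).
Qed.

End Specializations.

(** * Sums over partitions *)

Section Esum.
Local Open Scope ereal_scope.
Variables (R : realType) (T : choiceType).

Lemma esumZl (S : set T) (r : R) (a : T -> \bar R) : (0 <= r)%R ->
  (forall i, 0 <= a i) ->
  \esum_(i in S) (r%:E * a i) = r%:E * \esum_(i in S) a i.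
Proof.
move=> r0 a0; rewrite /esum -ereal_supZl //; last first.
  apply/set0P; exists (\sum_(x \in set0) a x), set0 => //.
  exact: fsets_set0.
congr ereal_sup; rewrite image_comp; apply: eq_imagel => A [finA AS] /=.
by rewrite ge0_mule_fsumr.
Qed.

Lemma esum_ge_term (a : T -> \bar R) t : a t <= \esum_(u in [set: T]) a u.
Proof.
apply: esum_ge; exists [set t]; first by split=> //; exact: finite_set1.
by rewrite fsbig_set1.
Qed.

(** For x = +oo both sides are 0 if all terms vanish, and +oo otherwise. *)
Lemma esumMl (x : \bar R) (a : T -> \bar R) : 0 <= x -> (forall i, 0 <= a i) ->
  \esum_(i in [set: T]) (x * a i) = x * \esum_(i in [set: T]) a i.
Proof.
case: x => [r r0 a0||//]; first by rewrite esumZl.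
move=> _ a0; have [all0|/existsNP[t /eqP at_neq0]] := pselect (forall t, a t = 0).
  by rewrite !esum1 ?mule0 // => t _; rewrite all0 mule0.
have at_gt0 : 0 < a t by rewrite lt_def at_neq0 a0.
rewrite gt0_mulye; last by apply: lt_le_trans (esum_ge_term a t).
have := esum_ge_term (fun i => +oo * a i) t.
by rewrite gt0_mulye // leye_eq => /eqP.
Qed.

Lemma esum_exchange (T' : choiceType) (a : T -> T' -> \bar R) :
  (forall i j, 0 <= a i j) ->
  \esum_(i in [set: T]) \esum_(j in [set: T']) a i j =
  \esum_(j in [set: T']) \esum_(i in [set: T]) a i j.
Proof.
move=> a0; rewrite !esum_esum //.
rewrite (@reindex_esum _ _ _ ([set: T] `*`` (fun=> [set: T'])) _ (fun p => (p.2, p.1))) //.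
split=> [[i j] //|[i j] [i' j'] _ _ [-> ->] //|[j i] _]; by exists (i, j).
Qed.

Lemma esum_seq (s : seq T) (f : T -> R) : uniq s -> (forall t, 0 <= f t)%R ->
  (forall t, (f t != 0)%R -> t \in s) ->
  \esum_(t in [set: T]) (f t)%:E = (\sum_(t <- s) f t)%R%:E.
Proof.
move=> s_uniq f0 fs; rewrite -sumEFin fsbig_seq // -esum_fset //; last first.
  by move=> i _; rewrite lee_fin.
rewrite [RHS]esum_mkcond; apply: eq_esum => t _; case: ifPn => // nt.
congr EFin; apply/eqP/negbNE/negP => /fs ts.
by move/negP: nt; apply; rewrite inE.
Qed.
End Esum.

Section Partitions.
Local Open Scope ereal_scope.
Variable R : realType.

Lemma esum_parts (f : part -> R) : (forall nu, 0 <= f nu)%R ->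
  \esum_(nu in [set: part]) (f nu)%:E =
  \esum_(N in [set: nat]) (\sum_(nu <- parts N) f nu)%R%:E.
Proof.
move=> f0; pose J N := [set nu : part | sumn nu = N].
have -> : [set: part] = \bigcup_(k in [set: nat]) J k.
  by apply/seteqP; split => // nu _; exists (sumn nu).
rewrite esum_bigcupT; first last.
- by move=> nu; rewrite lee_fin.
- by move=> i j _ _ [nu [<- <-]].
apply: eq_esum => N _.
transitivity (\esum_(nu in [set: part]) (if sumn nu == N then f nu else 0%R)%:E).
  rewrite esum_mkcond; apply: eq_esum => nu _; rewrite /J.
  by case: eqP => [e|ne]; [rewrite mem_set | rewrite memNset].
rewrite (esum_seq (parts_uniq N)).
- congr EFin; rewrite big_seq [RHS]big_seq; apply: eq_bigr => nu.
  by rewrite mem_parts => ->.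
- by move=> nu; case: ifP.
- by move=> nu; rewrite mem_parts; case: ifP => //; rewrite eqxx.
Qed.

Definition total_positive (x : nat -> R) :=
  (x 0%N = 1 /\ forall la mu : part, 0 <= sk x la mu)%R.

Lemma total_positive_convol x y : total_positive x -> total_positive y ->
  total_positive (convol x y).
Proof.
move=> [x0 x_ge0] [y0 y_ge0]; split=> [|la mu].
  by rewrite convol0 x0 y0 mulr1.
rewrite (@sk_convol _ _ _ (sumn la)) //.
by apply: sumr_ge0 => nu _; rewrite mulr_ge0.
Qed.

Definition cauchy_sum (x y : nat -> R) : \bar R :=
  \esum_(tau in [set: part]) (sk x tau empty_part * sk y tau empty_part)%R%:E.

Lemma cauchy_sumC x y : cauchy_sum x y = cauchy_sum y x.
Proof. by apply: eq_esum => nu _; rewrite mulrC. Qed.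

Section Sums.
Variables x y : nat -> R.
Hypotheses (x_tp : total_positive x) (y_tp : total_positive y).
Let x0 : x 0%N = 1%R. Proof. by case: x_tp. Qed.
Let y0 : y 0%N = 1%R. Proof. by case: y_tp. Qed.
Let xy_ge0 (a b c d : part) : (0 <= sk x a b * sk y c d)%R.
Proof. by apply: mulr_ge0; [case: x_tp | case: y_tp]. Qed.
Let yx_ge0 (a b c d : part) : (0 <= sk y a b * sk x c d)%R.
Proof. by rewrite mulrC. Qed.

Lemma esum_down_up (la mu : part) :
  \esum_(nu in [set: part]) (sk x la nu * sk y nu mu)%R%:E =
  (sk (convol x y) la mu)%:E.
Proof.
rewrite (esum_seq (parts_le_uniq (sumn la))) //.
  by rewrite (@sk_convol _ _ _ (sumn la)).
move=> nu nz; rewrite mem_parts_le (@sk_sumn _ x) //.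
by apply: contraNneq nz => ->; rewrite mul0r.
Qed.

(** The skew Cauchy sum without its factor H. The arguments are ordered as in the up-up sum, which
    is why [y] goes with [la]. *)
Definition down_down (la mu : part) : R :=
  \sum_(ka <- parts_le (sumn la + sumn mu)) sk y la ka * sk x mu ka.

Lemma esum_down_down (la mu : part) :
  \esum_(ka in [set: part]) (sk y la ka * sk x mu ka)%R%:E = (down_down la mu)%:E.
Proof.
rewrite (esum_seq (parts_le_uniq (sumn la + sumn mu))) //.
move=> nu nz; rewrite mem_parts_le (leq_trans _ (leq_addr _ _)) // (@sk_sumn _ y) //.
by apply: contraNneq nz => ->; rewrite mul0r.
Qed.

(** The graded identity summed over all degrees: for each fixed [ka] the coefficients run through
    every component of H. In the extended reals, with 0 * +oo = 0, this includes a divergent H. *)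
Lemma esum_up_up (la mu : part) :
  \esum_(nu in [set: part]) (sk x nu la * sk y nu mu)%R%:E =
  (down_down la mu)%:E * cauchy_sum x y.
Proof.
have z_ge0 k : (0 <= hsum x y k)%R by apply: sumr_ge0 => nu _.
have H : cauchy_sum x y = \esum_(k in [set: nat]) (hsum x y k)%:E by rewrite /cauchy_sum
    esum_parts.
have toep_ge0 i j : (0 <= toep (hsum x y) i j)%R by rewrite /toep; case: ifP.
rewrite esum_parts //; under eq_esum => N _ do rewrite skew_cauchy_real // -sumEFin.
rewrite esum_sum; last by move=> i j _ _; rewrite lee_fin mulr_ge0.
rewrite /down_down -sumEFin ge0_sume_distrl; last by move=> ka _; rewrite lee_fin.
apply: eq_bigr => ka _; under eq_esum => N _ do rewrite mulrC EFinM.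
rewrite esumZl //; last by move=> N; rewrite lee_fin.
have [->|nz] := eqVneq (sk y la ka * sk x mu ka)%R 0%R; first by rewrite !mul0e.
congr (_ * _); rewrite H.
have ka_la : (sumn ka <= sumn la)%N.
  by apply: (@sk_sumn _ y); apply: contraNneq nz => ->; rewrite mul0r.
(* The subtraction is exact because |ka| <= |la|. Entries with N < d vanish, so that the index may
   be shifted by [d]. *)
pose d := (sumn la + sumn mu - sumn ka)%N.
transitivity (\esum_(N in [set: nat]) (toep (hsum x y) N d)%:E).
  apply: eq_esum => N _; congr EFin.
  by rewrite -(toepDr _ N _ (sumn ka)) subnK // (leq_trans ka_la) // leq_addr.
transitivity (\esum_(k in [set: nat]) (toep (hsum x y) (d + k) d)%:E); last first.
  by apply: eq_esum => k _; rewrite /toep leq_addr addKn.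
rewrite -(@esum_image _ _ _ [set: nat] (addn d) (fun N => (toep (hsum x y) N d)%:E)).
  rewrite [RHS]esum_mkcond; apply: eq_esum => N _.
  case: ifPn => // /negP N_d; rewrite /toep ifF //; apply/negP => le_dN.
  by apply: N_d; rewrite inE; exists (N - d)%N => //; rewrite subnKC.
by move=> i j _ _ /addnI.
Qed.

End Sums.
End Partitions.

(** * Sums over interlacing sequences *)

Section Chain.
Variable R : realType.
Implicit Types (f : part -> R) (g : nat -> part -> part -> part -> R).
Implicit Types (e : part -> \bar R).

(** The common form of the truncated Schur weight and of the rows and columns of the transition
    matrix, so that one induction on the length serves them all. *)
Definition chain_weight n f g (x : state n) : R :=
  f (x.1 ord0) * \prod_(i < n) g i (x.1 (lower i)) (x.2 i) (x.1 (upper i)).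

Definition chain n f g e : \bar R :=
  (\esum_(x in [set: state n]) ((chain_weight f g x)%:E * e (x.1 ord_max)))%E.

(** A transfer operator: it sums out the last pair of partitions, and by [chainS] shortens the chain
    from its end. *)
Definition chain_step (g : part -> part -> part -> R) e (la : part) : \bar R :=
  (\esum_(mu in [set: part]) \esum_(nu in [set: part]) ((g la mu nu)%:E * e nu))%E.

Lemma chain_weight_ge0 n f g (x : state n) : (forall la, 0 <= f la) ->
  (forall i la mu nu, 0 <= g i la mu nu) -> 0 <= chain_weight f g x.
Proof. by move=> f_ge0 g_ge0; rewrite mulr_ge0 // prodr_ge0. Qed.

Lemma chain_weightM n f f' g g' (x : state n) :
  chain_weight (fun la => f la * f' la)
    (fun i la mu nu => g i la mu nu * g' i la mu nu) x =
  chain_weight f g x * chain_weight f' g' x.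
Proof. by rewrite /chain_weight big_split /= mulrACA. Qed.

(** [insub] fails exactly at the last index, where the default supplies the new entry. *)
Definition extend n (p : state n * (part * part)) : state n.+1 :=
  ([ffun i : 'I_n.+2 => oapp p.1.1 p.2.2 (insub (val i))],
   [ffun i : 'I_n.+1 => oapp p.1.2 p.2.1 (insub (val i))]).

Definition restrict n (x : state n.+1) : state n * (part * part) :=
  (([ffun i : 'I_n.+1 => x.1 (widen_ord (leqnSn _) i)],
    [ffun i : 'I_n => x.2 (widen_ord (leqnSn _) i)]),
   (x.2 ord_max, x.1 ord_max)).

Lemma oapp_insub_lt n T (f : 'I_n -> T) (t : T) k (lt_k : (k < n)%N) :
  oapp f t (insub k) = f (Ordinal lt_k).
Proof. by rewrite insubT. Qed.

Lemma oapp_insub_ge n T (f : 'I_n -> T) (t : T) : oapp f t (insub n) = t.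
Proof. by rewrite insubF ?ltnn. Qed.

Lemma extendK n : cancel (@extend n) (@restrict n).
Proof.
move=> [[x1 x2] [mu nu]]; congr ((_, _), (_, _)); rewrite /= ?ffunE ?oapp_insub_ge //.
  by apply/ffunP => i; rewrite !ffunE /= valK.
by apply/ffunP => i; rewrite !ffunE /= valK.
Qed.

Lemma restrictK n : cancel (@restrict n) (@extend n).
Proof.
move=> [x1 x2]; congr (_, _); apply/ffunP => i; rewrite !ffunE /=.
  have [lt_i|] := ltnP i n.+1.
    by rewrite oapp_insub_lt ffunE; congr (x1 _); apply: val_inj.
  move=> le_i; have -> : i = ord_max by apply: val_inj => /=; have := ltn_ord i; lia.
  by rewrite oapp_insub_ge.
have [lt_i|] := ltnP i n.
  by rewrite oapp_insub_lt ffunE; congr (x2 _); apply: val_inj.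
move=> le_i; have -> : i = ord_max by apply: val_inj => /=; have := ltn_ord i; lia.
by rewrite oapp_insub_ge.
Qed.

Lemma chain_weight_extend n f g (x : state n) mu nu :
  chain_weight f g (extend (x, (mu, nu))) =
  chain_weight f g x * g n (x.1 ord_max) mu nu.
Proof.
rewrite /chain_weight big_ord_recr /= mulrA; congr (_ * _ * _).
- by rewrite ffunE (oapp_insub_lt _ _ (ltn0Sn n)); congr (f (_ _)); apply: val_inj.
- apply: eq_bigr => i _; rewrite !ffunE /=.
  have lt_i := ltn_ord i; have lt_i1 : (i < n.+1)%N by rewrite ltnS ltnW.
  have lt_i2 : (bump 0 i < n.+1)%N by rewrite /bump.
  rewrite (oapp_insub_lt _ _ lt_i) (oapp_insub_lt _ _ lt_i1) (oapp_insub_lt _ _ lt_i2).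
  by congr (g i (x.1 _) (x.2 _) (x.1 _)); apply: val_inj.
- rewrite !ffunE /= (oapp_insub_lt _ _ (ltnSn n)) /bump /= add1n !oapp_insub_ge.
  by congr (g n (x.1 _) _ _); apply: val_inj.
Qed.

Lemma chain0 f g e :
  chain 0 f g e = (\esum_(la in [set: part]) ((f la)%:E * e la))%E.
Proof.
rewrite /chain (@reindex_esum _ _ _ [set: part] _
  (fun la => ([ffun=> la], [ffun=> empty_part]) : state 0)); last first.
  split=> // [la mu _ _ [/ffunP/(_ ord0)]|]; first by rewrite !ffunE.
  move=> [x1 x2] _; exists (x1 ord0) => //; congr (_, _); apply/ffunP => i.
    by rewrite ffunE (ord1 i).
  by have := ltn_ord i; rewrite ltn0.
by apply: eq_esum => la _; rewrite /chain_weight big_ord0 mulr1 !ffunE.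
Qed.

Lemma chainS n f g e : (forall la, 0 <= f la) ->
  (forall i la mu nu, 0 <= g i la mu nu) -> (forall la, 0 <= e la)%E ->
  chain n.+1 f g e = chain n f g (chain_step (g n) e).
Proof.
move=> f_ge0 g_ge0 e_ge0.
have ge_ge0 i la mu nu : (0 <= (g i la mu nu)%:E * e nu)%E.
  by rewrite mule_ge0 // lee_fin.
rewrite /chain (@reindex_esum _ _ _ ([set: state n] `*`` (fun=> [set: part * part])) _
    (@extend n)); last first.
  split=> // [p q _ _ /(can_inj (@extendK n)) //|x _].
  by exists (restrict x) => //; rewrite restrictK.
rewrite -(@esum_esum _ _ _ [set: state n] (fun=> [set: part * part])
  (fun x p => ((chain_weight f g (extend (x, p)))%:E * e ((extend (x, p)).1 ord_max))%E));
      last first.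
  by move=> x p _ _; rewrite mule_ge0 // lee_fin chain_weight_ge0.
apply: eq_esum => x _; rewrite /chain_step.
rewrite (@esum_esum _ _ _ [set: part] (fun=> [set: part])
  (fun mu nu => ((g n (x.1 ord_max) mu nu)%:E * e nu)%E)) //.
rewrite -esumZl ?chain_weight_ge0 //.
have -> : [set: part] `*`` (fun=> [set: part]) = [set: part * part].
  by apply/seteqP; split.
apply: eq_esum => -[mu nu] _; rewrite chain_weight_extend EFinM muleA.
by congr (_ * e _)%E; rewrite ffunE oapp_insub_ge.
Qed.

Lemma eq_chain n f g e e' :
  (forall x : state n, chain_weight f g x != 0 -> e (x.1 ord_max) = e' (x.1 ord_max)) ->
  chain n f g e = chain n f g e'.
Proof.
move=> ee; apply: eq_esum => x _.
by have [->|/ee ->//] := eqVneq (chain_weight f g x) 0; rewrite !mul0e.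
Qed.

Lemma chainZl n f g r e : (forall la, 0 <= f la) ->
  (forall i la mu nu, 0 <= g i la mu nu) -> (forall la, 0 <= e la)%E -> 0 <= r ->
  chain n f g (fun la => r%:E * e la)%E = (r%:E * chain n f g e)%E.
Proof.
move=> f_ge0 g_ge0 e_ge0 r0; rewrite /chain -esumZl // => [|x].
  by apply: eq_esum => x _; rewrite muleCA.
by rewrite mule_ge0 // lee_fin chain_weight_ge0.
Qed.

End Chain.

(** * The transition matrix *)

Section Kernels.
Variable R : realType.
Implicit Types x y a b c : nat -> R.

Lemma sk_empty x (ka : part) : x 0%N = 1 -> sk x empty_part ka = (ka == empty_part)%:R.
Proof.
move=> x0; case: eqVneq => [->|ne]; first exact: sk_diag.
apply/eqP; apply: contraNT ne => /sk_sumn; rewrite leqn0 => /eqP ka0.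
have : ka \in parts_le 0 by rewrite mem_parts_le ka0.
by rewrite parts_le0 inE.
Qed.

Lemma big_parts_le_eq n (la : part) (F : part -> R) : (sumn la <= n)%N ->
  \sum_(ka <- parts_le n) F ka * (ka == la)%:R = F la.
Proof.
move=> le_n; rewrite (bigD1_seq la) /= ?parts_le_uniq ?mem_parts_le //.
by rewrite eqxx mulr1 big1 ?addr0 // => ka /negPf ->; rewrite mulr0.
Qed.

Lemma down_down_empty_r x y (la : part) : x 0%N = 1 ->
  down_down x y la empty_part = sk y la empty_part.
Proof.
move=> x0; rewrite /down_down; under eq_bigr do rewrite sk_empty //.
exact: big_parts_le_eq.
Qed.

Lemma down_down_empty_l x y (mu : part) : y 0%N = 1 ->
  down_down x y empty_part mu = sk x mu empty_part.
Proof.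
move=> y0; rewrite /down_down; under eq_bigr do rewrite mulrC sk_empty //.
exact: big_parts_le_eq.
Qed.

Lemma down_down_ge x y (la mu ka : part) : total_positive x -> total_positive y ->
  sk y la ka * sk x mu ka <= down_down x y la mu.
Proof.
move=> [_ x_ge0] [_ y_ge0].
have [-> |nz] := eqVneq (sk y la ka * sk x mu ka) 0.
  by apply: sumr_ge0 => nu _; rewrite mulr_ge0.
apply: (@ler_term _ _ _ (fun ka => sk y la ka * sk x mu ka)).
  by move=> nu; rewrite mulr_ge0.
rewrite mem_parts_le (leq_trans _ (leq_addr _ _)) // (@sk_sumn _ y) //.
by apply: contraNneq nz => ->; rewrite mul0r.
Qed.

Lemma down_down_ge0 x y (la mu : part) : total_positive x -> total_positive y ->
  0 <= down_down x y la mu.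
Proof. by move=> [_ x_ge0] [_ y_ge0]; apply: sumr_ge0 => nu _; rewrite mulr_ge0. Qed.

Lemma sk_convol_ge x y (la nu mu : part) : total_positive x -> total_positive y ->
  sk x la nu * sk y nu mu <= sk (convol x y) la mu.
Proof.
move=> [x0 x_ge0] [y0 y_ge0]; rewrite (@sk_convol _ _ _ (sumn la)) //.
have [->|nz] := eqVneq (sk x la nu * sk y nu mu) 0.
  by apply: sumr_ge0 => ka _; rewrite mulr_ge0.
apply: (@ler_term _ _ _ (fun ka => sk x la ka * sk y ka mu)).
  by move=> ka; rewrite mulr_ge0.
by rewrite mem_parts_le (@sk_sumn _ x) //; apply: contraNneq nz => ->; rewrite mul0r.
Qed.

Lemma cauchy_sum_ge1 x y : total_positive x -> total_positive y -> (1 <= cauchy_sum x y)%E.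
Proof.
move=> [x0 x_ge0] [y0 y_ge0]; rewrite /cauchy_sum.
apply: esum_ge; exists [set empty_part].
  by split=> //; exact: finite_set1.
by rewrite fsbig_set1 !sk_diag // mulr1.
Qed.

Lemma cauchy_sum_fin x y : total_positive x -> total_positive y ->
  (cauchy_sum x y < +oo)%E -> cauchy_sum x y = (fine (cauchy_sum x y))%:E /\ 0 < fine
      (cauchy_sum x y).
Proof.
move=> x_tp y_tp H; have H1 := cauchy_sum_ge1 x_tp y_tp.
have Hfin : cauchy_sum x y \is a fin_num.
  by rewrite ge0_fin_numE // (le_trans _ H1).
by rewrite fineK //; split => //; rewrite fine_gt0 // H (lt_le_trans _ H1).
Qed.

(** Multiplicativity of H in unions: branching in the second argument, then the skew Cauchy identity
    with an empty partition. *)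
Lemma cauchy_sum_convol x y1 y2 :
  total_positive x -> total_positive y1 -> total_positive y2 ->
  (cauchy_sum x y1 < +oo)%E ->
  cauchy_sum x (convol y1 y2) = (cauchy_sum x y1 * cauchy_sum x y2)%E.
Proof.
move=> x_tp y1_tp y2_tp /(cauchy_sum_fin x_tp y1_tp)[HE /ltW h_ge0].
have [[[x0 x_ge0] [y10 y1_ge0]] [y20 y2_ge0]] := (x_tp, y1_tp, y2_tp).
transitivity (\esum_(tau in [set: part]) \esum_(mu in [set: part])
    (sk x tau empty_part * (sk y1 tau mu * sk y2 mu empty_part))%:E)%E.
  apply: eq_esum => tau _; rewrite EFinM -esum_down_up // -esumZl //.
  by move=> mu; rewrite lee_fin mulr_ge0.
rewrite esum_exchange; last by move=> i j; rewrite lee_fin !mulr_ge0.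
rewrite HE -esumZl // => [|i]; last by rewrite lee_fin mulr_ge0.
apply: eq_esum => mu _.
have := esum_up_up x_tp y1_tp empty_part mu; rewrite down_down_empty_l // HE => e.
transitivity ((sk y2 mu empty_part)%:E *
  \esum_(tau in [set: part]) (sk x tau empty_part * sk y1 tau mu)%:E)%E.
  rewrite -esumZl // => [|i]; last by rewrite lee_fin mulr_ge0.
  by apply: eq_esum => tau _; rewrite -EFinM; congr EFin; ring.
by rewrite e -!EFinM; congr EFin; ring.
Qed.

Section Transitions.
Variables a b c : nat -> R.
Hypotheses (a_tp : total_positive a) (b_tp : total_positive b).
Hypothesis c_tp : total_positive c.
Hypothesis H_fin : (cauchy_sum a c < +oo)%E.
Let h := fine (cauchy_sum a c).
Let a_ge0 la mu : 0 <= sk a la mu. Proof. by case: a_tp. Qed.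
Let b_ge0 la mu : 0 <= sk b la mu. Proof. by case: b_tp. Qed.
Let c_ge0 la mu : 0 <= sk c la mu. Proof. by case: c_tp. Qed.

(** The transition probability with its normalization evaluated, here by the skew Cauchy identity
    and in [p_down] by branching. *)
Definition p_up (la mu nu : part) : R :=
  sk a nu la * sk c nu mu / (down_down a c la mu * h).
Definition p_down (la mu nu : part) : R :=
  sk b la nu * sk c nu mu / sk (convol b c) la mu.

Let h_gt0 : 0 < h. Proof. by case: (cauchy_sum_fin a_tp c_tp H_fin). Qed.
Let HE : cauchy_sum a c = h%:E. Proof. by case: (cauchy_sum_fin a_tp c_tp H_fin). Qed.

Lemma p_up_ge0 la mu nu : 0 <= p_up la mu nu.
Proof. by rewrite divr_ge0 ?mulr_ge0 ?down_down_ge0 // ltW. Qed.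

Lemma p_down_ge0 la mu nu : 0 <= p_down la mu nu.
Proof. by rewrite divr_ge0 ?mulr_ge0 //; case: (total_positive_convol b_tp c_tp). Qed.

(* Where the normalization vanishes, and p_up is 0 as x / 0 = 0, the weight on
   the right vanishes as well. *)
Lemma p_up_mul la mu nu :
  down_down a c la mu * p_up la mu nu = h^-1 * (sk a nu la * sk c nu mu).
Proof.
rewrite /p_up invfM; have [z|nz] := eqVneq (down_down a c la mu) 0; last first.
  by rewrite -[in RHS](mulKf nz (_ * _)); field; rewrite nz gt_eqF.
rewrite z mul0r; have := esum_up_up a_tp c_tp la mu; rewrite z mul0e => e.
have := esum_ge_term (fun nu => (sk a nu la * sk c nu mu)%:E) nu.
rewrite e lee_fin => le0; suff -> : sk a nu la * sk c nu mu = 0 by rewrite mulr0.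
by apply: le_anti; rewrite le0 mulr_ge0.
Qed.

(** Where the normalization vanishes, so does each of its nonnegative terms, in particular the one
    on the right. *)
Lemma p_down_mul la mu nu :
  sk (convol b c) la mu * p_down la mu nu = sk b la nu * sk c nu mu.
Proof.
rewrite /p_down mulrC; have [z|nz] := eqVneq (sk (convol b c) la mu) 0; last first.
  by rewrite divfK.
have := sk_convol_ge la nu mu b_tp c_tp; rewrite z mulr0 => le0.
by apply/esym/le_anti; rewrite le0 mulr_ge0.
Qed.

Lemma esum_p_up la mu : 0 < down_down a c la mu ->
  (\esum_(nu in [set: part]) (p_up la mu nu)%:E = 1)%E.
Proof.
move=> d_gt0; pose r := (down_down a c la mu * h)^-1.
transitivity (\esum_(nu in [set: part]) (r%:E * (sk a nu la * sk c nu mu)%:E))%E.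
  by apply: eq_esum => nu _; rewrite -EFinM mulrC.
rewrite esumZl; last by move=> nu; rewrite lee_fin mulr_ge0.
  by rewrite esum_up_up // HE -!EFinM mulVf // mulf_neq0 ?gt_eqF.
by rewrite invr_ge0 mulr_ge0 // ltW.
Qed.

Lemma esum_p_down la mu : 0 < sk (convol b c) la mu ->
  (\esum_(nu in [set: part]) (p_down la mu nu)%:E = 1)%E.
Proof.
move=> d_gt0; pose r := (sk (convol b c) la mu)^-1.
transitivity (\esum_(nu in [set: part]) (r%:E * (sk b la nu * sk c nu mu)%:E))%E.
  by apply: eq_esum => nu _; rewrite -EFinM mulrC.
rewrite esumZl; last by move=> nu; rewrite lee_fin mulr_ge0.
  by rewrite esum_down_up // -EFinM mulVf // gt_eqF.
by rewrite invr_ge0 ltW.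
Qed.

End Transitions.

End Kernels.

Section Process.
Variables (R : realType) (a b : nat -> nat -> R) (c : nat -> R).
Hypotheses (a_tp : forall i, total_positive (a i)).
Hypotheses (b_tp : forall i, total_positive (b i)).
Hypothesis c_tp : total_positive c.
Let a_ge0 i la mu : 0 <= sk (a i) la mu. Proof. by case: (a_tp i). Qed.
Let b_ge0 i la mu : 0 <= sk (b i) la mu. Proof. by case: (b_tp i). Qed.
Let c_ge0 la mu : 0 <= sk c la mu. Proof. by case: c_tp. Qed.

Definition first_weight (la : part) : R := sk (a 0) la empty_part.
Definition step_weight i (la mu nu : part) : R := sk (b i) la mu * sk (a i.+1) nu mu.

Lemma first_weight_ge0 la : 0 <= first_weight la. Proof. exact: a_ge0. Qed.
Lemma step_weight_ge0 i la mu nu : 0 <= step_weight i la mu nu.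
Proof. by rewrite mulr_ge0. Qed.

(** [y] is general because summing out the last two partitions yields the factor H(a_(n+1); y) and a
    shorter chain that ends with the union of [b n] and [y]. *)
Lemma chain_weights_fin n y : total_positive y ->
  (forall i, (i <= n)%N -> cauchy_sum (a i) y < +oo)%E ->
  (forall i j, (i <= j < n)%N -> cauchy_sum (a i) (b j) < +oo)%E ->
  (chain n first_weight step_weight (fun la => (sk y la empty_part)%:E) < +oo)%E.
Proof.
have first_ge0 := first_weight_ge0; have step_ge0 := step_weight_ge0.
elim: n y => [|n IHn] y y_tp ay_fin ab_fin.
  rewrite chain0; apply: le_lt_trans (ay_fin 0%N isT).
  by apply: le_esum => la _; rewrite -EFinM.
have [y0 y_ge0] := y_tp; rewrite chainS //; last by move=> la; rewrite lee_fin.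
have [HE h_gt0] := cauchy_sum_fin (a_tp n.+1) y_tp (ay_fin _ (leqnn _)).
set h := fine _ in HE h_gt0.
have stepE la : chain_step (step_weight n) (fun la => (sk y la empty_part)%:E) la =
    (h%:E * (sk (convol (b n) y) la empty_part)%:E)%E.
  rewrite -esum_down_up // -esumZl ?ltW //; last by move=> mu; rewrite lee_fin mulr_ge0.
  apply: eq_esum => mu _.
  have e := esum_up_up (a_tp n.+1) y_tp mu empty_part.
  rewrite down_down_empty_r ?HE in e; last by case: (a_tp n.+1).
  transitivity ((sk (b n) la mu)%:E *
    \esum_(nu in [set: part]) (sk (a n.+1) nu mu * sk y nu empty_part)%:E)%E.
    rewrite -esumZl // => [|nu]; last by rewrite lee_fin mulr_ge0.
    by apply: eq_esum => nu _; rewrite -!EFinM /step_weight mulrA.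
  by rewrite e -!EFinM; congr EFin; ring.
rewrite (@eq_chain _ _ _ _ _ (fun la => h%:E * (sk (convol (b n) y) la empty_part)%:E)%E);
    last first.
  by move=> x _; rewrite stepE.
have by_tp := total_positive_convol (b_tp n) y_tp.
have by_ge0 la : (0 <= (sk (convol (b n) y) la empty_part)%:E)%E.
  by rewrite lee_fin; case: by_tp.
rewrite chainZl ?ltW //; apply: lte_mul_pinfty; rewrite ?lee_fin ?ltW //.
apply: IHn => // [i le_i|i j /andP[le_ij lt_j]].
  rewrite cauchy_sum_convol ?ab_fin ?le_i ?ltnSn //.
  have := ab_fin i n; rewrite le_i ltnSn => /(_ isT)/(cauchy_sum_fin (a_tp i) (b_tp n))[->
      /ltW ?].
  by rewrite lte_mul_pinfty ?lee_fin // ay_fin // ltnW.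
by apply: ab_fin; rewrite le_ij ltnW.
Qed.

Hypothesis ac_fin : forall i, (cauchy_sum (a i) c < +oo)%E.
Let h i := fine (cauchy_sum (a i) c).
Let h_gt0 i : 0 < h i. Proof. by case: (cauchy_sum_fin (a_tp i) c_tp (ac_fin i)). Qed.

Section Stochastic.
(* u i and v i stand for lambda^(i + 1) and mu^(i + 1). *)
Variables u v : nat -> part.

Definition first_kernel (la : part) : R := p_up (a 0) c empty_part (u 0%N) la.
Definition step_kernel i (la mu nu : part) : R :=
  p_down (b i) c la (v i) mu * p_up (a i.+1) c mu (u i.+1) nu.

Lemma first_kernel_ge0 la : 0 <= first_kernel la.
Proof. exact: p_up_ge0. Qed.
Lemma step_kernel_ge0 i la mu nu : 0 <= step_kernel i la mu nu.
Proof. by rewrite mulr_ge0 ?p_down_ge0 ?p_up_ge0. Qed.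

Lemma p_up_neq0 (x y : nat -> R) (la mu nu : part) :
  p_up x y la mu nu != 0 -> sk y nu mu != 0.
Proof. by apply: contraNneq => e; rewrite /p_up e mulr0 mul0r. Qed.

(** The relation to the old entry [u n] is what [down_defined] asks of the new entry, so that the
    next transition is defined. *)
Lemma chain_weight_last n (x : state n) :
  chain_weight first_kernel step_kernel x != 0 -> sk c (x.1 ord_max) (u n) != 0.
Proof.
rewrite /chain_weight; case: n x => [|n] x.
  rewrite big_ord0 mulr1 => /p_up_neq0; congr (sk c (x.1 _) _ != 0); exact: val_inj.
rewrite big_ord_recr /= mulf_eq0 negb_or => /andP[_].
rewrite mulf_eq0 negb_or => /andP[_]; rewrite mulf_eq0 negb_or => /andP[_ /p_up_neq0].
by congr (sk c (x.1 _) _ != 0); apply: val_inj.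
Qed.

(** The old partition [u i] supplies a positive term: [c] leads from [la] down to it and [b i] on to
    [v i]. The order of the two may be exchanged, a union being symmetric. *)
Lemma down_defined i (la : part) :
  0 < sk (b i) (u i) (v i) -> sk c la (u i) != 0 -> 0 < sk (convol (b i) c) la (v i).
Proof.
move=> b_gt0 nz; have c_gt0 : 0 < sk c la (u i) by rewrite lt_def nz c_ge0.
have -> : sk (convol (b i) c) la (v i) = sk (convol c (b i)) la (v i).
  by apply: eq_sk => k _; exact: convolC.
by apply: lt_le_trans (sk_convol_ge la (u i) (v i) c_tp (b_tp i)); rewrite mulr_gt0.
Qed.

(** The old partition [v i] lies below both [mu] and [u i.+1], and supplies a positive term of the
    down-down sum. *)
Lemma up_defined i (mu : part) :
  0 < sk (a i.+1) (u i.+1) (v i) -> sk c mu (v i) != 0 ->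
  0 < down_down (a i.+1) c mu (u i.+1).
Proof.
move=> a_gt0 nz; have c_gt0 : 0 < sk c mu (v i) by rewrite lt_def nz c_ge0.
by apply: lt_le_trans (down_down_ge mu (u i.+1) (v i) (a_tp _) c_tp); rewrite mulr_gt0.
Qed.

Lemma chain_kernel n : 0 < sk (a 0) (u 0%N) empty_part ->
  (forall i, (i < n)%N -> 0 < sk (b i) (u i) (v i) /\ 0 < sk (a i.+1) (u i.+1) (v i)) ->
  chain n first_kernel step_kernel (fun=> 1%E) = 1%E.
Proof.
move=> u0 uv; elim: n uv => [|n IHn] uv.
  rewrite chain0; under eq_esum do rewrite mule1.
  by rewrite esum_p_up // down_down_empty_l //; case: c_tp.
have [b_gt0 a_gt0] := uv n (ltnSn n).
rewrite chainS //; [|exact: first_kernel_ge0|exact: step_kernel_ge0].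
rewrite -[RHS]IHn => [|i lt_i]; last by apply: uv; rewrite ltnW.
apply: eq_chain => x /chain_weight_last nz.
rewrite /chain_step -[RHS](esum_p_down (b_tp n) c_tp (down_defined b_gt0 nz)).
apply: eq_esum => mu _; set p := p_down _ _ _ _ _.
have p_ge0 : 0 <= p by exact: p_down_ge0.
under eq_esum do rewrite mule1 EFinM.
rewrite esumZl // => [|nu]; last by rewrite lee_fin p_up_ge0.
(* Where [p] vanishes the upward distribution may be undefined, but it carries the factor 0. *)
rewrite -/p; have [->|p_nz] := eqVneq p 0; first by rewrite mul0e.
rewrite esum_p_up ?mule1 // up_defined //.
by apply: contraNneq p_nz => e; rewrite /p /p_down e mulr0 mul0r.
Qed.

End Stochastic.

(* The sum over the old states, the new state y being fixed. *)
Lemma chain_commute n (y : state n) (u v : nat -> part) e :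
  (forall i : 'I_n.+1, y.1 i = u i) -> (forall i : 'I_n, y.2 i = v i) ->
  (forall la, 0 <= e la)%E ->
  chain n (fun la => first_weight la * p_up (a 0) c empty_part la (u 0%N))
    (fun i la mu nu => step_weight i la mu nu *
       (p_down (b i) c (u i) mu (v i) * p_up (a i.+1) c (v i) nu (u i.+1))) e =
  ((\prod_(i < n.+1) (h i)^-1 * chain_weight first_weight step_weight y)%:E *
   \esum_(la in [set: part]) ((sk c (u n) la)%:E * e la))%E.
Proof.
move=> yu yv.
have -> : chain_weight first_weight step_weight y =
    first_weight (u 0%N) * \prod_(i < n) step_weight i (u i) (v i) (u i.+1).
  rewrite /chain_weight yu; congr (_ * _); apply: eq_bigr => i _.
  by rewrite yv !yu.
elim: n {y yu yv} e => [|n IHn] e e_ge0.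
  rewrite chain0 big_ord1 big_ord0 mulr1.
  rewrite -esumZl => [||la]; last by rewrite mule_ge0 // lee_fin.
    apply: eq_esum => la _; rewrite muleA -EFinM; congr (_%:E * _)%E.
    (* The first factor of the Schur weight is, up to [h 0], the normalization of the first
       transition. *)
    rewrite -mulrA; have := p_up_mul (a_tp 0) c_tp (ac_fin 0) empty_part la (u 0%N).
    by rewrite down_down_empty_l //; case: c_tp.
  by rewrite mulr_ge0 ?invr_ge0 ?(ltW (h_gt0 0)) ?first_weight_ge0.
have G_ge0 i (la mu nu : part) : 0 <= step_weight i la mu nu *
    (p_down (b i) c (u i) mu (v i) * p_up (a i.+1) c (v i) nu (u i.+1)).
  apply: mulr_ge0; first exact: step_weight_ge0.
  by apply: mulr_ge0; [exact: p_down_ge0 | exact: p_up_ge0].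
rewrite chainS //; last first.
  by move=> la; apply: mulr_ge0; [exact: first_weight_ge0 | exact: p_up_ge0].
(* The earlier old entries are summed out by induction, for a general function of the last one; they
   leave the factor [sk c (u n) la]. *)
rewrite IHn; last first.
  move=> la; apply: esum_ge0 => mu _; apply: esum_ge0 => nu _.
  by apply: mule_ge0 => //; rewrite lee_fin.
set u0 := first_weight _; set P := \prod_(i < n) _.
set ui := u n; set vi := v n; set uj := u n.+1.
have [pd [pdE pd_ge0 pd_mul]] : exists pd, [/\ forall mu, p_down (b n) c ui mu vi = pd mu,
    forall mu, 0 <= pd mu & forall mu, sk (convol c (b n)) ui mu * pd mu = sk (b n) ui vi *
        sk c vi mu].
  exists (fun mu => p_down (b n) c ui mu vi); split=> // mu; first exact: p_down_ge0.
  rewrite -p_down_mul //; congr (_ * _); apply: eq_sk => k _; exact: convolC.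
have [pu [puE pu_ge0 pu_mul]] : exists pu, [/\ forall nu, p_up (a n.+1) c vi nu uj = pu nu,
    forall nu, 0 <= pu nu & forall nu, down_down (a n.+1) c vi nu * pu nu =
      (h n.+1)^-1 * (sk (a n.+1) uj vi * sk c uj nu)].
  exists (fun nu => p_up (a n.+1) c vi nu uj); split=> // nu; first exact: p_up_ge0.
  by rewrite p_up_mul.
pose w mu nu := sk (b n) ui vi * pu nu * (sk c vi mu * sk (a n.+1) nu mu).
have w_ge0 mu nu : 0 <= w mu nu by rewrite !mulr_ge0.
have sum_la : (\esum_(la in [set: part]) ((sk c ui la)%:E * chain_step
    (fun la mu nu => step_weight n la mu nu *
       (p_down (b n) c ui mu vi * p_up (a n.+1) c vi nu uj))%R e la) =
    \esum_(mu in [set: part]) \esum_(nu in [set: part]) ((w mu nu)%:E * e nu))%E.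
  transitivity (\esum_(la in [set: part]) \esum_(mu in [set: part]) \esum_(nu in [set: part])
    ((sk (a n.+1) nu mu * (pd mu * pu nu))%:E * e nu * (sk c ui la * sk (b n) la mu)%:E))%E.
    apply: eq_esum => la _; rewrite /chain_step -esumZl //; last first.
      by move=> mu; apply: esum_ge0 => nu _; apply: mule_ge0; rewrite ?lee_fin.
    apply: eq_esum => mu _; rewrite -esumZl //; last first.
      by move=> nu; apply: mule_ge0; rewrite ?lee_fin.
    apply: eq_esum => nu _; rewrite pdE puE [RHS]muleAC muleA -!EFinM /step_weight.
    by congr (_%:E * _)%E; ring.
  have t_ge0 la mu nu : (0 <= (sk (a n.+1) nu mu * (pd mu * pu nu))%:E * e nu *
      (sk c ui la * sk (b n) la mu)%:E)%E.
    by rewrite !mule_ge0 // lee_fin !mulr_ge0.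
  rewrite esum_exchange => [|la mu]; last by apply: esum_ge0.
  apply: eq_esum => mu _; rewrite esum_exchange //; apply: eq_esum => nu _.
  rewrite esumMl; first last.
  - by move=> la; rewrite lee_fin mulr_ge0.
  - by rewrite mule_ge0 // lee_fin !mulr_ge0.
  (* The sum over the old [la] is the normalization of [p_down], with [b n] and [c] exchanged. *)
  rewrite esum_down_up // muleAC -EFinM; congr (_%:E * _)%E.
  transitivity (sk (a n.+1) nu mu * pu nu * (sk (convol c (b n)) ui mu * pd mu)).
    by ring.
  by rewrite pd_mul /w; ring.
rewrite sum_la esum_exchange => [|mu nu]; last by rewrite mule_ge0 // lee_fin.
pose k := (h n.+1)^-1 * (sk (b n) ui vi * sk (a n.+1) uj vi).
transitivity ((\prod_(i < n.+1) (h i)^-1 * (u0 * P))%:E *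
    \esum_(nu in [set: part]) (k%:E * ((sk c uj nu)%:E * e nu)))%E.
  congr (_ * _)%E; apply: eq_esum => nu _.
  transitivity (\esum_(mu in [set: part]) ((sk (b n) ui vi * pu nu)%:E * e nu *
      (sk c vi mu * sk (a n.+1) nu mu)%:E))%E.
    by apply: eq_esum => mu _; rewrite [RHS]muleAC -EFinM.
  rewrite esumMl; first last.
  - by move=> la; rewrite lee_fin mulr_ge0.
  - by rewrite mule_ge0 // lee_fin !mulr_ge0.
  (* The sum over the old [mu] is, up to [h n.+1], the normalization of [p_up]. *)
  rewrite (@esum_down_down _ (a n.+1) c) // muleAC muleA -!EFinM; congr (_%:E * _)%E.
  rewrite /k -mulrA [pu nu * _]mulrC pu_mul; by ring.
rewrite esumZl; first last.
- by move=> nu; rewrite mule_ge0 // lee_fin.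
- by rewrite /k !mulr_ge0 ?invr_ge0 ?(ltW (h_gt0 n.+1)).
rewrite muleA -EFinM; congr (_%:E * _)%E.
rewrite [in RHS]big_ord_recr [\prod_(i < n.+1) step_weight _ _ _ _]big_ord_recr /= -/P.
by rewrite /k /step_weight; ring.
Qed.

End Process.

(** * The Schur process *)

Section Normalize.
Variables (R : realType) (T : choiceType) (w : T -> R[i]) (F : T -> R).
Hypothesis wE : forall t, w t = (F t)%:C%C.

Lemma total_weightE : total_weight w = (\esum_(t in [set: T]) (F t)%:E)%E.
Proof. by apply: eq_esum => t _; rewrite wE. Qed.

Lemma normalizeE t : normalize w t = F t / fine (\esum_(t in [set: T]) (F t)%:E)%E.
Proof. by rewrite /normalize total_weightE wE. Qed.

Hypothesis F_ge0 : forall t, 0 <= F t.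

Lemma normalizable_fin (s : R) : 0 < s ->
  (\esum_(t in [set: T]) (F t)%:E = s%:E)%E -> normalizable w.
Proof.
move=> s_gt0 Fs; split=> [t||]; first by rewrite wE ler0c.
  have [//|all0] := pselect (exists t, 0 < w t).
  have : s%:E = 0%E.
    rewrite -Fs esum1 // => t _; congr EFin; apply/eqP/negbNE/negP => nz.
    by apply: all0; exists t; rewrite wE ltcR lt_def nz F_ge0.
  by move=> [s0]; rewrite s0 ltxx in s_gt0.
by rewrite total_weightE Fs ltry.
Qed.

Lemma prob_on_normalize (s : R) (X : set T) : 0 < s ->
  (\esum_(t in [set: T]) (F t)%:E = s%:E)%E -> (forall t, F t != 0 -> X t) ->
  prob_on X (normalize w).
Proof.
move=> s_gt0 Fs FX.
have nE t : normalize w t = F t / s by rewrite normalizeE Fs.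
have n0 t : ~ X t -> normalize w t = 0.
  move=> nX; rewrite nE; have [->|/FX //] := eqVneq (F t) 0; by rewrite mul0r.
split=> [t _|//|]; first by rewrite nE divr_ge0 // ltW.
transitivity (\esum_(t in [set: T]) (s^-1%:E * (F t)%:E))%E.
  rewrite esum_mkcond; apply: eq_esum => t _; rewrite -EFinM mulrC -nE.
  by case: ifPn => // /negP nX; rewrite n0 // => Xt; apply: nX; rewrite inE.
rewrite esumZl ?invr_ge0 ?(ltW s_gt0) //.
by rewrite Fs -EFinM mulVf // gt_eqF.
Qed.

End Normalize.

Section Transitions.
Variables (R : realType) (rho varpi : specialization R).
Hypotheses (rho_ge0 : nonneg_specialization rho).
Hypotheses (varpi_ge0 : nonneg_specialization varpi).

Lemma hseq_total_positive (sigma : specialization R) :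
  nonneg_specialization sigma -> total_positive (hseq sigma).
Proof. by move=> s_ge0; split=> [|la mu]; [exact: hseq0 | exact: sk_hseq_ge0]. Qed.

Let x_tp := hseq_total_positive rho_ge0.
Let y_tp := hseq_total_positive varpi_ge0.

Lemma cauchyHE : cauchyH rho varpi = cauchy_sum (hseq rho) (hseq varpi).
Proof.
apply: eq_esum => la _.
by rewrite !schur_hseqE -?(rmorphM (real_complex R)) //; apply: nonneg_real.
Qed.

Lemma w_up_upE (la mu nu : part) : w_up_up rho varpi la mu nu =
  (sk (hseq rho) nu la * sk (hseq varpi) nu mu)%:C%C.
Proof.
by rewrite /w_up_up !skew_schurE -?(rmorphM (real_complex R)) //; apply: nonneg_real.
Qed.

Lemma w_down_upE (la mu nu : part) : w_down_up rho varpi la mu nu =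
  (sk (hseq rho) la nu * sk (hseq varpi) nu mu)%:C%C.
Proof.
by rewrite /w_down_up !skew_schurE -?(rmorphM (real_complex R)) //; apply: nonneg_real.
Qed.

Lemma P_down_upE (la mu nu : part) :
  P_down_up rho varpi la mu nu = p_down (hseq rho) (hseq varpi) la mu nu.
Proof. by rewrite /P_down_up (normalizeE (w_down_upE la mu)) esum_down_up. Qed.

Lemma P_down_up_def (la mu : part) :
  0 < sk (convol (hseq rho) (hseq varpi)) la mu -> P_down_up_defined rho varpi la mu.
Proof.
move=> gt0; apply: (normalizable_fin (w_down_upE la mu) _ gt0).
  by move=> nu; rewrite mulr_ge0 // sk_hseq_ge0.
by rewrite esum_down_up.
Qed.

Hypothesis H_fin : (cauchyH rho varpi < +oo)%E.

Let esum_w_up_up la mu : (\esum_(nu in [set: part])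
    (sk (hseq rho) nu la * sk (hseq varpi) nu mu)%:E =
  (down_down (hseq rho) (hseq varpi) la mu * fine (cauchy_sum (hseq rho) (hseq varpi)))%:E)%E.
Proof.
have [e _] := cauchy_sum_fin x_tp y_tp ltac:(by rewrite -cauchyHE).
by rewrite esum_up_up // {1}e.
Qed.

Lemma P_up_upE (la mu nu : part) :
  P_up_up rho varpi la mu nu = p_up (hseq rho) (hseq varpi) la mu nu.
Proof. by rewrite /P_up_up (normalizeE (w_up_upE la mu)) esum_w_up_up. Qed.

Lemma P_up_up_def (la mu : part) :
  0 < down_down (hseq rho) (hseq varpi) la mu -> P_up_up_defined rho varpi la mu.
Proof.
have [_ h_gt0] := cauchy_sum_fin x_tp y_tp ltac:(by rewrite -cauchyHE).
move=> gt0; split=> //; have gt0' := mulr_gt0 gt0 h_gt0.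
apply: (normalizable_fin (w_up_upE la mu) _ gt0').
  by move=> nu; rewrite mulr_ge0 // sk_hseq_ge0.
exact: esum_w_up_up.
Qed.

End Transitions.

Section SchurProcess.
Variables (R : realType) (n : nat).

(** Indices in [nat] suit the chains, whose length changes in inductions; the values outside the
    range are arbitrary. *)
Definition lam (x : state n) (i : nat) : part := x.1 (inord i).
Definition mus (x : state n) (i : nat) : part := oapp x.2 empty_part (insub i).

Lemma lamE (x : state n) (i : 'I_n.+1) : x.1 i = lam x i.
Proof. by rewrite /lam inord_val. Qed.
Lemma musE (x : state n) (i : 'I_n) : x.2 i = mus x i.
Proof. by rewrite /mus valK. Qed.

Variables (rhop rhom : 'I_n.+1 -> specialization R) (varpi : specialization R).
Hypotheses (rhop_ge0 : forall j, nonneg_specialization (rhop j)).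
Hypotheses (rhom_ge0 : forall j, nonneg_specialization (rhom j)).
Hypothesis varpi_ge0 : nonneg_specialization varpi.

(** [inord] sends indices beyond [n] to 0, so that positivity and finiteness hold for all indices in
    [nat]. *)
Let a i := hseq (rhop (inord i)).
Let b i := hseq (rhom (inord i)).
Let c := hseq varpi.
Let a_tp i : total_positive (a i). Proof. exact: hseq_total_positive. Qed.
Let b_tp i : total_positive (b i). Proof. exact: hseq_total_positive. Qed.
Let c_tp : total_positive c. Proof. exact: hseq_total_positive. Qed.

Definition real_weight (x : state n) : R :=
  chain_weight (first_weight a) (step_weight a b) x.

Lemma real_weight_ge0 x : 0 <= real_weight x.
Proof.
apply: chain_weight_ge0; first exact: first_weight_ge0.
exact: step_weight_ge0.
Qed.

Lemma inord_lower (i : 'I_n) : inord i = lower i.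
Proof. by apply: val_inj; rewrite /= inordK // ltnS ltnW. Qed.
Lemma inord_upper (i : 'I_n) : inord i.+1 = upper i.
Proof. by apply: val_inj; rewrite /= inordK // ltnS. Qed.
Lemma inord_ord0 : inord 0 = ord0 :> 'I_n.+1.
Proof. by apply: val_inj; rewrite /= inordK. Qed.
Lemma inord_ord_max : inord n = ord_max :> 'I_n.+1.
Proof. by apply: val_inj; rewrite /= inordK. Qed.

Lemma truncated_weightE x : truncated_weight rhop rhom x = (real_weight x)%:C%C.
Proof.
rewrite /real_weight /chain_weight (rmorphM (real_complex R)).
rewrite (rmorph_prod (real_complex R)) /truncated_weight; congr (_ * _).
  by rewrite schur_hseqE /first_weight /a ?inord_ord0 //; exact: nonneg_real.
apply: eq_bigr => i _; rewrite (rmorphM (real_complex R)) /= /a /b.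
by rewrite inord_lower inord_upper !skew_schurE //; exact: nonneg_real.
Qed.

Lemma admissible_statesE x : admissible_states rhop rhom x <-> real_weight x != 0.
Proof.
by rewrite /admissible_states /= truncated_weightE ltcR lt_def real_weight_ge0 andbT.
Qed.

Lemma real_weight_neq0 x : real_weight x != 0 ->
  [/\ sk (a 0) (lam x 0) empty_part != 0,
      forall i, (i < n)%N -> sk (b i) (lam x i) (mus x i) != 0 &
      forall i, (i < n)%N -> sk (a i.+1) (lam x i.+1) (mus x i) != 0].
Proof.
rewrite /real_weight /chain_weight mulf_eq0 negb_or => /andP[nz1 /prodf_neq0 nz2].
have nz i (lt_i : (i < n)%N) : step_weight a b i (lam x i) (mus x i) (lam x i.+1) != 0.
  by have := nz2 (Ordinal lt_i) isT; rewrite !lamE musE.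
split=> [|i /nz|i /nz]; first by move: nz1; rewrite lamE.
  by apply: contraNneq => e; rewrite /step_weight e mul0r.
by apply: contraNneq => e; rewrite /step_weight e mulr0.
Qed.

Hypothesis H_fin : forall j, (cauchyH (rhop j) varpi < +oo)%E.
Let ac_fin i : (cauchy_sum (a i) c < +oo)%E.
Proof. by rewrite -cauchyHE. Qed.

Lemma first_stepE (x y : state n) :
  first_step rhop varpi x y = p_up (a 0) c empty_part (lam x 0) (lam y 0).
Proof. by rewrite /first_step P_up_upE // /a inord_ord0 !lamE. Qed.

Lemma down_stepE (i : 'I_n) (x y : state n) :
  down_step rhom varpi i x y = p_down (b i) c (lam y i) (mus x i) (mus y i).
Proof. by rewrite /down_step P_down_upE // /b inord_lower !lamE !musE. Qed.

Lemma up_stepE (i : 'I_n) (x y : state n) :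
  up_step rhop varpi i x y = p_up (a i.+1) c (mus y i) (lam x i.+1) (lam y i.+1).
Proof. by rewrite /up_step P_up_upE // /a inord_upper !lamE !musE. Qed.

Lemma updateE (x y : state n) : update rhop rhom varpi x y =
  chain_weight (first_kernel a c (lam x)) (step_kernel a b c (lam x) (mus x)) y.
Proof.
rewrite /update /chain_weight first_stepE lamE; congr (_ * _).
apply: eq_bigr => i _; rewrite down_stepE up_stepE /step_kernel.
by rewrite !lamE musE.
Qed.

Lemma updateE_state (x y : state n) : update rhop rhom varpi x y =
  chain_weight (fun la => p_up (a 0) c empty_part la (lam y 0%N))
    (fun i la mu nu => p_down (b i) c (lam y i) mu (mus y i) *
       p_up (a i.+1) c (mus y i) nu (lam y i.+1)) x.
Proof.
rewrite /update /chain_weight first_stepE lamE; congr (_ * _).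
by apply: eq_bigr => i _; rewrite down_stepE up_stepE !lamE musE.
Qed.

Lemma update_ge0 (x y : state n) : 0 <= update rhop rhom varpi x y.
Proof.
rewrite updateE; apply: chain_weight_ge0; first exact: first_kernel_ge0.
exact: step_kernel_ge0.
Qed.

(** Every factor of the truncated weight of [y] also occurs in the numerator of some transition
    probability. *)
Lemma update_admissible (x y : state n) : update rhop rhom varpi x y != 0 ->
  admissible_states rhop rhom y.
Proof.
rewrite updateE mulf_eq0 negb_or => /andP[nz1 /prodf_neq0 nz2].
rewrite admissible_statesE mulf_neq0 //.
  by apply: contraNneq nz1; rewrite /first_weight /first_kernel /p_up => ->; rewrite !mul0r.
apply/prodf_neq0 => i _; apply: contraNneq (nz2 i isT) => /eqP.
rewrite mulf_eq0 /step_kernel /p_down /p_up => /orP[]/eqP->.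
  by rewrite !mul0r.
by rewrite !mul0r mulr0.
Qed.

Lemma admissible_gt0 x : admissible_states rhop rhom x ->
  0 < sk (a 0) (lam x 0) empty_part /\ forall i, (i < n)%N ->
  0 < sk (b i) (lam x i) (mus x i) /\ 0 < sk (a i.+1) (lam x i.+1) (mus x i).
Proof.
have gt0 y (la mu : part) : total_positive y -> sk y la mu != 0 -> 0 < sk y la mu.
  by move=> [_ y_ge0] nz; rewrite lt_def nz y_ge0.
move=> /admissible_statesE/real_weight_neq0[nz0 nz1 nz2].
split=> [|i lt_i]; first exact: gt0.
by split; apply: gt0 => //; [exact: nz1 | exact: nz2].
Qed.

Lemma update_stochastic :
  stochastic_on (admissible_states rhop rhom) (update rhop rhom varpi).
Proof.
move=> x /admissible_gt0[u0 uv]; split=> [y _|]; first exact: update_ge0.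
rewrite -(chain_kernel a_tp b_tp c_tp ac_fin u0 uv) esum_mkcond.
apply: eq_esum => y _; rewrite mule1 -updateE; case: ifPn => // /negP nX.
congr EFin; apply/esym/eqP/negbNE/negP => /update_admissible Xy.
by apply: nX; rewrite inE.
Qed.

Lemma update_defined :
  update_well_defined rhop rhom varpi (admissible_states rhop rhom).
Proof.
move=> x /admissible_gt0[u0 uv]; split.
  apply: P_up_up_def => //; rewrite down_down_empty_l; last by case: c_tp.
  by move: u0; rewrite /a inord_ord0 lamE.
move=> y i; rewrite lt_def mulf_eq0 negb_or => /andP[/andP[nz1 /prodf_neq0 nz2] _].
have [b_gt0 a_gt0] := uv i (ltn_ord i).
(* The transition that chose [lam y i], the first one or the upward step before [i], has nonzero
   probability. *)
have c_neq0 : sk c (lam y i) (lam x i) != 0.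
  case: i nz2 {b_gt0 a_gt0} => [[|i] lt_i] nz2 /=.
    by move: nz1; rewrite first_stepE => /p_up_neq0.
  have := nz2 (Ordinal (ltnW lt_i)) (leqnn _).
  by rewrite mulf_eq0 negb_or up_stepE => /andP[_ /p_up_neq0].
split.
  apply: P_down_up_def => //; rewrite lamE musE.
  have -> : hseq (rhom (lower i)) = b i by rewrite /b inord_lower.
  exact: (down_defined b_tp c_tp b_gt0 c_neq0).
move=> /lt0r_neq0; rewrite down_stepE => p_nz.
apply: P_up_up_def => //; rewrite lamE musE.
have -> : hseq (rhop (upper i)) = a i.+1 by rewrite /a inord_upper.
apply: (up_defined a_tp c_tp a_gt0).
by apply: contraNneq p_nz => e; rewrite /p_down e mulr0 mul0r.
Qed.

Hypothesis Hpm_fin : forall i j : 'I_n.+1, (i <= j)%N ->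
  (cauchyH (rhop i) (rhom j) < +oo)%E.

Let weight (x : state n) := real_weight x * sk (b n) (x.1 ord_max) empty_part.
Let weight' (x : state n) :=
  real_weight x * sk (convol (b n) c) (x.1 ord_max) empty_part.

Let weight_ge0 x : 0 <= weight x.
Proof. by rewrite mulr_ge0 ?real_weight_ge0 //; case: (b_tp n). Qed.

Let weight'_ge0 x : 0 <= weight' x.
Proof.
by rewrite mulr_ge0 ?real_weight_ge0 //; case: (total_positive_convol (b_tp n) c_tp).
Qed.

Lemma weight_sum : exists2 z : R, 0 < z &
  (\esum_(x in [set: state n]) (weight x)%:E = z%:E)%E.
Proof.
have ab_fin i j : (i <= j <= n)%N -> (cauchy_sum (a i) (b j) < +oo)%E.
  move=> /andP[le_ij le_jn]; rewrite -cauchyHE //; apply: Hpm_fin.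
  by rewrite !inordK // ltnS // (leq_trans le_ij).
have Z_fin : (\esum_(x in [set: state n]) (weight x)%:E < +oo)%E.
  apply: le_lt_trans (chain_weights_fin a_tp b_tp (b_tp n) _ _).
  - by apply: le_esum => x _; rewrite -EFinM.
  - by move=> i le_i; rewrite ab_fin // le_i leqnn.
  - by move=> i j /andP[le_ij lt_j]; rewrite ab_fin // le_ij ltnW.
have Z_ge1 : (1 <= \esum_(x in [set: state n]) (weight x)%:E)%E.
  pose x0 : state n := ([ffun=> empty_part], [ffun=> empty_part]).
  have <- : weight x0 = 1; last exact: (esum_ge_term (fun x => (weight x)%:E)).
  have sk1 y : total_positive y -> sk y empty_part empty_part = 1.
    by move=> [y0 _]; rewrite sk_diag.
  rewrite /weight /real_weight /chain_weight !ffunE /first_weight !sk1 // mulr1 mul1r.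
  by rewrite big1 // => i _; rewrite !ffunE /step_weight !sk1 ?mulr1.
have fin : (\esum_(x in [set: state n]) (weight x)%:E)%E \is a fin_num.
  by rewrite ge0_fin_numE // (le_trans _ Z_ge1).
exists (fine (\esum_(x in [set: state n]) (weight x)%:E)%E); last by rewrite fineK.
by rewrite fine_gt0 // Z_fin (lt_le_trans _ Z_ge1).
Qed.

Lemma schur_weightE x : schur_weight rhop rhom x = (weight x)%:C%C.
Proof.
rewrite /schur_weight truncated_weightE schur_hseqE; last exact: nonneg_real.
by rewrite -inord_ord_max -(rmorphM (real_complex R)) /weight -inord_ord_max.
Qed.

Lemma schur_weight_unionE rhoN : is_union (rhom ord_max) varpi rhoN -> forall x,
  schur_weight rhop (fun j => if j == ord_max then rhoN else rhom j) x =
  (weight' x)%:C%C.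
Proof.
move=> /(hseq_union (rhom_ge0 _) varpi_ge0)[rhoN_real rhoNE] x.
rewrite /schur_weight eqxx schur_hseqE //.
have -> : truncated_weight rhop (fun j => if j == ord_max then rhoN else rhom j) x =
    truncated_weight rhop rhom x.
  congr (_ * _); apply: eq_bigr => i _; rewrite ifF //.
  by apply/negbTE; rewrite -val_eqE /= neq_ltn ltn_ord.
rewrite truncated_weightE -(rmorphM (real_complex R)) /weight'; congr (real_complex _ (_ * _)).
by apply: eq_sk => k _; rewrite rhoNE /b inord_ord_max.
Qed.

Lemma weight_admissible x : weight x != 0 -> admissible_states rhop rhom x.
Proof. by move=> nz; apply/admissible_statesE; apply: contraNneq nz => e; rewrite /weight e
    mul0r. Qed.

Lemma weight'_admissible x : weight' x != 0 -> admissible_states rhop rhom x.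
Proof. by move=> nz; apply/admissible_statesE; apply: contraNneq nz => e; rewrite /weight'
    e mul0r. Qed.

(** [chain_commute] with the last Schur factor as [e]; the sum left over the last old partition is
    the branching rule for the union of rho_N^- and pi. *)
Lemma weight_update y : (\esum_(x in [set: state n]) (weight x * update rhop rhom varpi x
    y)%:E =
  (\prod_(i < n.+1) (fine (cauchy_sum (a i) c))^-1 * weight' y)%:E)%E.
Proof.
have e_ge0 la : (0 <= (sk (b n) la empty_part)%:E)%E.
  by rewrite lee_fin; case: (b_tp n).
have := chain_commute a_tp b_tp c_tp ac_fin (lamE y) (musE y) e_ge0.
under [X in _ = (_ * X)%E -> _]eq_esum do rewrite -EFinM.
rewrite esum_down_up // -EFinM => e.
transitivity (chain n
    (fun la => first_weight a la * p_up (a 0) c empty_part la (lam y 0))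
    (fun i la mu nu => step_weight a b i la mu nu *
      (p_down (b i) c (lam y i) mu (mus y i) * p_up (a i.+1) c (mus y i) nu (lam y i.+1)))
    (fun la => (sk (b n) la empty_part)%:E)).
  apply: eq_esum => x _; rewrite updateE_state chain_weightM -EFinM; congr EFin.
  by rewrite /weight /real_weight; ring.
rewrite e; congr EFin; rewrite -mulrA; congr (_ * (_ * _)).
rewrite (_ : y.1 ord_max = lam y n); last by rewrite /lam inord_ord_max.
by apply: eq_sk => k _; exact: convolC.
Qed.

Lemma esum_update x : admissible_states rhop rhom x ->
  (\esum_(y in [set: state n]) (update rhop rhom varpi x y)%:E = 1)%E.
Proof.
move=> /update_stochastic[_ <-]; rewrite [RHS]esum_mkcond; apply: eq_esum => y _.
case: ifPn => // /negP nX; congr EFin; apply/eqP/negbNE/negP => /update_admissible Xy.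
by apply: nX; rewrite inE.
Qed.

(** The double sum over old and new states is evaluated in both orders: [weight_update] gives one
    value, and unit row sums give the other. *)
Lemma weight'_sum (z : R) : 0 < z ->
  (\esum_(x in [set: state n]) (weight x)%:E = z%:E)%E ->
  (\esum_(y in [set: state n]) (weight' y)%:E =
     (z / \prod_(i < n.+1) (fine (cauchy_sum (a i) c))^-1)%:E)%E.
Proof.
move=> z_gt0 zE; set C := \prod_(i < n.+1) _.
have C_gt0 : 0 < C.
  apply: prodr_gt0 => i _; rewrite invr_gt0.
  by case: (cauchy_sum_fin (a_tp i) c_tp (ac_fin i)).
have e : (C%:E * (\esum_(y in [set: state n]) (weight' y)%:E) = z%:E)%E.
  rewrite -esumZl ?(ltW C_gt0) // -zE.
  transitivity (\esum_(y in [set: state n]) \esum_(x in [set: state n])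
      (weight x * update rhop rhom varpi x y)%:E)%E.
    by apply: eq_esum => y _; rewrite weight_update.
  rewrite esum_exchange => [|y x]; last by rewrite lee_fin mulr_ge0 ?update_ge0.
  apply: eq_esum => x _; under eq_esum do rewrite EFinM.
  rewrite esumZl // => [|y]; last by rewrite lee_fin update_ge0.
  have [->|/weight_admissible Xx] := eqVneq (weight x) 0; first by rewrite mul0e.
  by rewrite esum_update // mule1.
by rewrite mulrC EFinM -e muleA -EFinM mulVf ?mul1e // gt_eqF.
Qed.

Lemma schur_process_update (rhoN : specialization R) :
  is_union (rhom ord_max) varpi rhoN ->
  let X := admissible_states rhop rhom in
  let S := schur_process rhop rhom in
  let S' := schur_process rhop (fun j => if j == ord_max then rhoN else rhom j) in
  [/\ prob_on X S, prob_on X S' &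
      forall y, measure_mul X S (update rhop rhom varpi) y = (S' y)%:E].
Proof.
move=> rhoN_union X S S'; have [z z_gt0 zE] := weight_sum.
have w'E := schur_weight_unionE rhoN_union; have z'E := weight'_sum z_gt0 zE.
set C := \prod_(i < n.+1) _ in z'E.
have C_gt0 : 0 < C.
  apply: prodr_gt0 => i _; rewrite invr_gt0.
  by case: (cauchy_sum_fin (a_tp i) c_tp (ac_fin i)).
have SE x : S x = weight x / z by rewrite /S /schur_process (normalizeE schur_weightE) zE.
split.
- exact: (prob_on_normalize schur_weightE weight_ge0 z_gt0 zE weight_admissible).
- exact: (prob_on_normalize w'E weight'_ge0 (divr_gt0 z_gt0 C_gt0) z'E weight'_admissible).
move=> y; rewrite /S' /schur_process (normalizeE w'E) z'E.
transitivity (z^-1%:E *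
  \esum_(x in [set: state n]) (weight x * update rhop rhom varpi x y)%:E)%E.
  rewrite -esumZl ?invr_ge0 ?(ltW z_gt0) //; last first.
    by move=> x; rewrite lee_fin mulr_ge0 ?update_ge0.
  rewrite /measure_mul esum_mkcond; apply: eq_esum => x _; rewrite SE -EFinM.
  case: ifPn => [_|/negP nX]; congr EFin; first by rewrite mulrAC mulrC mulrA.
  have [->|/weight_admissible Xx] := eqVneq (weight x) 0; first by rewrite mul0r mulr0.
  by case: nX; rewrite inE.
rewrite weight_update -EFinM -/C; congr EFin.
by rewrite invfM invrK; ring.
Qed.

End SchurProcess.

Theorem theorem10 (R : realType) (n : nat)
    (rhop rhom : 'I_n.+1 -> specialization R) (varpi rhoN : specialization R)
    (rhop_adm : forall j, admissible (rhop j))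
    (rhom_adm : forall j, admissible (rhom j))
    (* The total weight, the product of these H(rho_i^+; rho_j^-), is finite. *)
    (H_fin : forall i j : 'I_n.+1, (i <= j)%N ->
      (cauchyH (rhop i) (rhom j) < +oo)%E)
    (pi_nonneg : nonneg_specialization varpi)
    (H_pi_fin : forall j, (cauchyH varpi (rhop j) < +oo)%E)
    (rhoN_union : is_union (rhom ord_max) varpi rhoN) :
  let X := admissible_states rhop rhom in
  let P := update rhop rhom varpi in
  let S := schur_process rhop rhom in
  let S' := schur_process rhop (fun j => if j == ord_max then rhoN else rhom j) in
  [/\ update_well_defined rhop rhom varpi X,
      stochastic_on X P,
      prob_on X S /\ prob_on X S' &
      forall y, X y -> measure_mul X S P y = (S' y)%:E].
Proof.
have rhop_ge0 j : nonneg_specialization (rhop j) by case: (rhop_adm j).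
have rhom_ge0 j : nonneg_specialization (rhom j) by case: (rhom_adm j).
have Hpi j : (cauchyH (rhop j) varpi < +oo)%E.
  by rewrite cauchyHE // cauchy_sumC -cauchyHE.
have [probS probS' SP] := schur_process_update rhop_ge0 rhom_ge0 pi_nonneg Hpi H_fin
    rhoN_union.
move=> X P S S'; split.
- exact: update_defined.
- exact: update_stochastic.
- by [].
- by move=> y _; apply: SP.
Qed.
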